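(* Let $p>1$, $s\in\mathbb{R}$ and $m\in\mathbb{N}\cup\{\infty\}$. Let $\Omega$ be a domain in $\mathbb{R}^N$, $N\ge 2$, and let $K$ be a closed piecewise smooth surface of codimension $k$, $k\in\{1,\ldots,N\}$, with finitely many connected components, where $K$ is a finite union of points if $k=N$ and $K=\partial\Omega$ if $k=1$. Let $d(x)=\mathrm{dist}(x,K)$. Suppose that $p\neq k+s$, that $\sup_{x\in\Omega}d(x)<\infty$, and that $$(k+s-p)(d\,\Delta d-k+1)\ge 0\quad\text{in }\Omega\setminus K$$ in the distributional sense. Let $H=\frac{k+s-p}{p}$ and let $\alpha,\beta,\gamma\in\mathbb{R}$ be fixed. Then there exists a positive constant $D_0\ge\sup_{x\in\Omega}d(x)$ (in particular large enough that $1+\alpha\eta_m+\beta\eta_m^2+\gamma\zeta_m>0$ in $\Omega$ for every $D\ge D_0$) such that for any $D\ge D_0$ and all real-valued $u\in C_c^\infty(\Omega\setminus K)$ there holds $$\begin{aligned} \int_\Omega d^{s}(1+\alpha\eta_m+\beta\eta_m^2+\gamma\zeta_m)|\nabla u|^p\,dx \ge{}& |H|^p\int_\Omega d^{s-p}|u|^p\,dx+|H|^p\alpha\int_\Omega d^{s-p}\eta_m|u|^p\,dx\\ &+\Bigl(|H|^p\beta+\frac{|H|^{p-2}H\alpha}{2}\Bigr)\int_\Omega d^{s-p}\eta_m^2|u|^p\,dx\\ &+\Bigl(\frac{p-1}{2p}|H|^{p-2}+\frac{|H|^{p-2}H\alpha}{2}+|H|^p\gamma\Bigr)\int_\Omega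 d^{s-p}\zeta_m|u|^p\,dx, \end{aligned}$$ where $\eta_m=\eta_m(d(x)/D)=\sum_{i=1}^m X_1(d(x)/D)\cdots X_i(d(x)/D)$ and $\zeta_m=\zeta_m(d(x)/D)=\sum_{i=1}^m X_1^2(d(x)/D)\cdots X_i^2(d(x)/D)$.
   Context: The iterated logarithmic functions $X_i$ are defined recursively by $X_1(t)=(1-\log t)^{-1}$ for $t\in(0,1]$ and $X_i(t)=X_1(X_{i-1}(t))$ for $i=2,3,\ldots$, $t\in(0,1]$. For $m\ge1$ an integer, $\eta_m(t)=\sum_{i=1}^m X_1(t)\cdots X_i(t)$ and $\zeta_m(t)=\sum_{i=1}^m X_1^2(t)\cdots X_i^2(t)$; for $m=\infty$, $\eta_\infty$ and $\zeta_\infty$ are the corresponding infinite series, which are known to converge for every $t\in(0,1)$. All functions are real-valued. The distance $d$ is Lipschitz; the distribution $d\,\Delta d$ on $\Omega\setminus K$ acts on test functions by $\varphi\mapsto-\int\nabla d\cdot\nabla(d\varphi)\,dx$. *)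

(* Defs.v *)
From HB Require Import structures.
From mathcomp Require Import all_boot all_order all_algebra.
From mathcomp Require Import all_classical all_reals all_analysis.

Set Implicit Arguments.
Unset Strict Implicit.
Unset Printing Implicit Defensive.

Import Order.TTheory GRing.Theory Num.Theory.
Import numFieldNormedType.Exports.

Local Open Scope classical_set_scope.
Local Open Scope ring_scope.

(* The sigma-algebra on 'rV[R]_n is the one generated by the coordinates, as
   for n.-tuple R in the library. *)
Section rV_measurable.
Context (R : realType) (n : nat).

Let coords : 'I_n -> 'rV[R]_n -> R := fun i x => x ord0 i.

Let rV_set0 : g_sigma_preimage coords set0.
Proof. exact: sigma_algebra0. Qed.

Let rV_setC A : g_sigma_preimage coords A -> g_sigma_preimage coords (~` A).
Proof. exact: sigma_algebraC. Qed.

Let rV_bigcup (F : (set _)^nat) : (forall i, g_sigma_preimage coords (F i)) ->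
  g_sigma_preimage coords (\bigcup_i (F i)).
Proof. exact: sigma_algebra_bigcup. Qed.

HB.instance Definition _ :=
  @isMeasurable.Build (measure_tuple_display default_measure_display)
    'rV[R]_n (g_sigma_preimage coords) rV_set0 rV_setC rV_bigcup.

End rV_measurable.

Section rV_measurable_fun.
Context (R : realType).

Lemma measurable_coord n (i : 'I_n) :
  measurable_fun [set: 'rV[R]_n] (fun x : 'rV[R]_n => x ord0 i).
Proof.
move=> _ Y mY; rewrite setTI; apply: sub_sigma_algebra => /=.
rewrite -bigcup_seq/=; exists i => /=; first by rewrite mem_index_enum.
by exists Y => //; rewrite setTI.
Qed.

Lemma measurable_fun_rV d (T : measurableType d) n (f : T -> 'rV[R]_n) :
  (forall i, measurable_fun [set: T] (fun t => f t ord0 i)) ->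
  measurable_fun [set: T] f.
Proof.
move=> mf _ A mA; rewrite setTI; move: A mA.
suff : @measurable _ 'rV[R]_n `<=` [set A | measurable (f @^-1` A)] by [].
apply: smallest_sub.
  split.
  - by rewrite /= preimage_set0.
  - by move=> A /= mA; rewrite setTD preimage_setC; exact: measurableC.
  - by move=> F /= mF; rewrite preimage_bigcup; exact: bigcupT_measurable.
move=> A; rewrite -bigcup_seq => -[i _ [B mB <-]] /=.
rewrite setTI -comp_preimage.
by have := mf i measurableT B mB; rewrite setTI.
Qed.

Definition cons_rV n (z : R * 'rV[R]_n) : 'rV[R]_n.+1 :=
  row_mx (z.1%:M : 'rV_1) z.2.

Definition uncons_rV n (x : 'rV[R]_n.+1) : R * 'rV[R]_n :=
  (x ord0 ord0, \row_i x ord0 (lift ord0 i)).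

Lemma cons_rV0 n (z : R * 'rV[R]_n) : cons_rV z ord0 ord0 = z.1.
Proof.
rewrite /cons_rV (_ : ord0 = lshift n (ord0 : 'I_1)); last exact/val_inj.
by rewrite (@row_mxEl _ 1 1 n) mxE eqxx mulr1n.
Qed.

Lemma cons_rVS n (z : R * 'rV[R]_n) i : cons_rV z ord0 (lift ord0 i) = z.2 ord0 i.
Proof.
rewrite /cons_rV (_ : lift ord0 i = rshift 1 i); last exact/val_inj.
by rewrite (@row_mxEr _ 1 1 n).
Qed.

Lemma cons_rVK n : cancel (@cons_rV n) (@uncons_rV n).
Proof.
move=> z; rewrite /uncons_rV cons_rV0 [RHS]surjective_pairing; congr pair.
by apply/rowP => i; rewrite mxE cons_rVS.
Qed.

Lemma measurable_cons_rV n : measurable_fun setT (@cons_rV n).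
Proof.
apply: measurable_fun_rV => i.
case: (unliftP ord0 i) => [j ->|->].
  apply: (eq_measurable_fun (fun z : R * 'rV[R]_n => z.2 ord0 j)).
    by move=> z _; rewrite cons_rVS.
  exact: measurableT_comp (measurable_coord j) measurable_snd.
apply: (eq_measurable_fun (fun z : R * 'rV[R]_n => z.1)); last exact: measurable_fst.
by move=> z _; rewrite cons_rV0.
Qed.

Lemma measurable_uncons_rV n : measurable_fun setT (@uncons_rV n).
Proof.
apply: measurable_fun_pair; first exact: measurable_coord.
apply: measurable_fun_rV => i.
apply: (eq_measurable_fun (fun x : 'rV[R]_n.+1 => x ord0 (lift ord0 i))).
  by move=> x _; rewrite mxE.
exact: measurable_coord.
Qed.

End rV_measurable_fun.

Lemma sigma_finite_product d1 d2 (T1 : measurableType d1)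
    (T2 : measurableType d2) (R : realType)
    (m1 : {sigma_finite_measure set T1 -> \bar R})
    (m2 : {sigma_finite_measure set T2 -> \bar R}) :
  sigma_finite setT (m1 \x m2)%E.
Proof.
have /sigma_finiteP[F [TF ndF Foo]] := sigma_finiteT m1.
have /sigma_finiteP[G [TG ndG Goo]] := sigma_finiteT m2.
exists (fun n => F n `*` G n).
  rewrite -setXTT TF TG predeqE => -[x y]; split.
    move=> [/= [n _ Fnx] [k _ Gky]]; exists (maxn n k) => //; split.
    - by move: x Fnx; exact/subsetPset/ndF/leq_maxl.
    - by move: y Gky; exact/subsetPset/ndG/leq_maxr.
  by move=> [n _ []/= ? ?]; split; exists n.
move=> k; have [? ?] := Foo k; have [? ?] := Goo k.
split; first exact: measurableX.
by rewrite product_measure1E// lte_mul_pinfty// ge0_fin_numE.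
Qed.

Section lebesgue_rV_succ.
Context (R : realType) (n : nat).
Variable mu : {sigma_finite_measure set 'rV[R]_n -> \bar R}.

Definition lebesgue_rV_succ : set 'rV[R]_n.+1 -> \bar R :=
  pushforward (@lebesgue_measure R \x mu)%E (@cons_rV R n).

Let mcons : measurable_fun
  [set: (measurableTypeR R * 'rV[R]_n)%type] (@cons_rV R n).
Proof. exact: measurable_cons_rV. Qed.

Let muncons : @measurable_fun _ _ _ (measurableTypeR R * 'rV[R]_n)%type
  [set: 'rV[R]_n.+1] (@uncons_rV R n).
Proof. exact: measurable_uncons_rV. Qed.

Let succ0 : lebesgue_rV_succ set0 = 0%E.
Proof. by rewrite /lebesgue_rV_succ /pushforward preimage_set0 measure0. Qed.

Let succ_ge0 A : (0 <= lebesgue_rV_succ A)%E.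
Proof. exact: measure_ge0. Qed.

Let succ_sigma_additive : semi_sigma_additive lebesgue_rV_succ.
Proof.
move=> F mF tF mUF; rewrite /lebesgue_rV_succ /pushforward preimage_bigcup.
apply: measure_semi_sigma_additive.
- by move=> k; rewrite -[X in measurable X]setTI; exact: mcons.
- apply/trivIsetP => /= i j _ _ ij; rewrite -preimage_setI.
  by move/trivIsetP : tF => /(_ _ _ _ _ ij) ->//; rewrite preimage_set0.
- by rewrite -preimage_bigcup -[X in measurable X]setTI; exact: mcons.
Qed.

HB.instance Definition _ := isMeasure.Build _ _ _ lebesgue_rV_succ
  succ0 succ_ge0 succ_sigma_additive.

Let succ_sigma_finite : sigma_finite setT lebesgue_rV_succ.
Proof.
have [F TF mF] := sigma_finite_product (@lebesgue_measure R) mu.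
exists (fun i => @uncons_rV R n @^-1` F i).
  by rewrite -preimage_bigcup -TF preimage_setT.
move=> i; have [mFi Fi_fin] := mF i; split.
  by rewrite -[X in measurable X]setTI; exact: muncons.
rewrite /lebesgue_rV_succ /pushforward -comp_preimage.
rewrite (_ : _ \o _ = id) //.
by apply/funext => z; exact: cons_rVK.
Qed.

HB.instance Definition _ := Measure_isSigmaFinite.Build _ _ _
  lebesgue_rV_succ succ_sigma_finite.

End lebesgue_rV_succ.

(* n-fold product of the Lebesgue measure on R; see [lebesgue_rV_box]. *)
Fixpoint lebesgue_rV (R : realType) (n : nat) :
    {sigma_finite_measure set 'rV[R]_n -> \bar R} :=
  if n is n'.+1 then lebesgue_rV_succ (lebesgue_rV R n')
  else \d_(0 : 'rV[R]_0).

Lemma measurable_box_rV (R : realType) n (a b : 'I_n -> R) :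
  measurable [set x : 'rV[R]_n | forall i, a i <= x ord0 i <= b i].
Proof.
rewrite (_ : mkset _ =
  \big[setI/setT]_(i < n) ((fun x : 'rV[R]_n => x ord0 i) @^-1` `[a i, b i])).
  apply: bigsetI_measurable => i _; rewrite -[X in measurable X]setTI.
  by apply: measurable_coord => //; exact: measurable_itv.
rewrite -bigcap_seq; apply/seteqP; split => x /= h.
  by move=> i _; rewrite /= in_itv/= h.
by move=> i; have := h i (mem_index_enum i); rewrite /= in_itv.
Qed.

Lemma lebesgue_rV_box (R : realType) n (a b : 'I_n -> R) :
  (forall i, a i <= b i) ->
  lebesgue_rV R n [set x | forall i, a i <= x ord0 i <= b i] =
  (\prod_(i < n) (b i - a i))%:E.
Proof.
elim: n a b => [|n ih] a b ab.
  rewrite big_ord0 /= diracE mem_set//= => -[]//.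
rewrite big_ord_recl /= /lebesgue_rV_succ /pushforward.
set B := [set x : 'rV[R]_n | forall i : 'I_n,
  a (lift ord0 i) <= x ord0 i <= b (lift ord0 i)].
rewrite [X in product_measure1 _ _ X](_ : _ = `[a ord0, b ord0] `*` B).
  rewrite product_measure1E; [|exact: measurable_itv|exact: measurable_box_rV].
  rewrite /B ih// EFinM; congr (_ * _)%E.
  have := lebesgue_measure_itv `[a ord0, b ord0]; rewrite /= lte_fin => ->.
  by case: ltgtP (ab ord0) => // ->; rewrite subrr.
apply/seteqP; split => [z /= h|z /= [+ h] i].
  split; first by have := h ord0; rewrite cons_rV0 in_itv.
  by move=> i; have := h (lift ord0 i); rewrite cons_rVS.
rewrite in_itv /= => h0; case: (unliftP ord0 i) => [j ->|->].
  by rewrite cons_rVS.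
by rewrite cons_rV0.
Qed.

Section calculus.
Context (R : realType).

Definition dotp n (u v : 'rV[R]_n) : R := \sum_(i < n) u ord0 i * v ord0 i.

(* The library norm `|v| on 'rV[R]_n is the sup norm. *)
Definition enorm n (v : 'rV[R]_n) : R := Num.sqrt (dotp v v).

Definition dist_to n (K : set 'rV[R]_n) (x : 'rV[R]_n) : R :=
  inf [set enorm (x - y) | y in K].

Definition pderiv n (V : normedModType R) (i : 'I_n) (f : 'rV[R]_n -> V) :
  'rV[R]_n -> V := 'D_(delta_mx ord0 i) f.

(* Partial derivatives have a default value where they do not exist; for a
   locally Lipschitz f this is a Lebesgue-null set. *)
Definition grad n (f : 'rV[R]_n -> R) (x : 'rV[R]_n) : 'rV[R]_n :=
  \row_(i < n) pderiv i f x.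

(* C^oo: all iterated partial derivatives exist and are differentiable, hence
   continuous, everywhere. *)
Definition smooth n (V : normedModType R) (f : 'rV[R]_n -> V) : Prop :=
  forall (l : seq 'I_n) (x : 'rV[R]_n),
    differentiable (foldr (@pderiv n V) f l) x.

(* C_c^oo(U), as functions extended by zero to the whole space. *)
Definition test_function n (U : set 'rV[R]_n) (u : 'rV[R]_n -> R) : Prop :=
  let supp := closure [set x | u x != 0] in
  [/\ smooth u, compact supp & supp `<=` U].

Definition domain n (U : set 'rV[R]_n) : Prop :=
  [/\ U !=set0, open U & connected U].

Definition boundary n (U : set 'rV[R]_n) : set 'rV[R]_n :=
  closure U `\` interior U.

Definition unit_cube n : set 'rV[R]_n :=
  [set y | forall i, 0 <= y ord0 i <= 1].

Definition open_unit_cube n : set 'rV[R]_n :=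
  [set y | forall i, 0 < y ord0 i < 1].

(* A regularly parametrized closed patch of dimension q. The parametrization is
   smooth up to the boundary of the parameter cube, but it is required to be
   one-to-one and immersive in the interior only, so that vertices of cones and
   the like are allowed. If q = 0, a patch is a point. *)
Definition smooth_patch q n (P : set 'rV[R]_n) : Prop :=
  exists phi : 'rV[R]_q -> 'rV[R]_n,
    [/\ smooth phi,
        set_inj (@open_unit_cube q) phi,
        (forall y, @open_unit_cube q y -> injective ('d phi y)) &
        P = phi @` @unit_cube q].

(* A nonempty closed set which is a locally finite union of patches of
   dimension n - k; it may be unbounded. *)
Definition piecewise_smooth_surface n (k : nat) (K : set 'rV[R]_n) : Prop :=
  [/\ K !=set0, closed K &
   exists (J : set nat) (P : nat -> set 'rV[R]_n),
     [/\ forall j, J j -> smooth_patch (n - k) (P j),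
         (forall x : 'rV[R]_n, exists2 U, nbhs x U &
            finite_set [set j | J j /\ P j `&` U !=set0]) &
         K = \bigcup_(j in J) P j]].

Definition components n (K : set 'rV[R]_n) : set (set 'rV[R]_n) :=
  [set connected_component K x | x in K].

(* Action of the distribution d (Lapl d) on phi. *)
Definition dLapl n (d : 'rV[R]_n -> R) (U : set 'rV[R]_n)
    (phi : 'rV[R]_n -> R) : R :=
  - \int[lebesgue_rV R n]_(x in U)
      dotp (grad d x) (grad (fun y => d y * phi y) x).

(* c (d Lapl d - k + 1) >= 0 in the distributional sense on U: tested against
   nonnegative functions of C_c^oo(U). *)
Definition distr_ge0 n (c : R) (k : nat) (d : 'rV[R]_n -> R)
    (U : set 'rV[R]_n) : Prop :=
  forall phi, test_function U phi -> (forall x, 0 <= phi x) ->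
    0 <= c * (dLapl d U phi
              - (k%:R - 1) * \int[lebesgue_rV R n]_(x in U) phi x).

(* [ln] is 0 on nonpositive reals; X1 is extended by its limit 0 at t = 0. *)
Definition X1 (t : R) : R := if 0 < t then (1 - ln t)^-1 else 0.

Definition Xlog (i : nat) (t : R) : R := iter i X1 t.

Definition eta_fin (m : nat) (t : R) : R :=
  \sum_(1 <= i < m.+1) \prod_(1 <= j < i.+1) Xlog j t.

Definition zeta_fin (m : nat) (t : R) : R :=
  \sum_(1 <= i < m.+1) \prod_(1 <= j < i.+1) Xlog j t ^+ 2.

(* [None] stands for m = infinity; the limit exists for 0 <= t < 1. *)
Definition eta_log (m : option nat) (t : R) : R :=
  if m is Some m' then eta_fin m' t
  else limn (fun m' => eta_fin m' t).

Definition zeta_log (m : option nat) (t : R) : R :=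
  if m is Some m' then zeta_fin m' t
  else limn (fun m' => zeta_fin m' t).

Definition weight (alpha beta gamma : R) (m : option nat) (t : R) : R :=
  1 + alpha * eta_log m t + beta * eta_log m t ^+ 2 + gamma * zeta_log m t.

End calculus.

(* Main.v *)
Require Import Defs.
From HB Require Import structures.
From mathcomp Require Import all_boot all_order all_algebra.
From mathcomp Require Import all_classical all_reals all_analysis.
From mathcomp Require Import measurable_realfun ring lra.

Set Implicit Arguments.
Unset Strict Implicit.
Unset Printing Implicit Defensive.

Import Order.TTheory GRing.Theory Num.Theory.
Import numFieldNormedType.Exports.

Local Open Scope classical_set_scope.
Local Open Scope ring_scope.

(** Why the theorem holds.  Write $f$ for a function of $t = d/D$ and
   $w = 1 + \alpha\eta + \beta\eta^2 + \gamma\zeta$.  The proof tests the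
   hypothesis $(k+s-p)(d \Delta d - k + 1) \ge 0$ with
   $\varphi = d^{s-p} f(d/D) |u|^p$; this amounts to integrating the
   divergence of the vector field $|H|^{p-2} H d^{s-p+1} f \nabla d$ against
   $|u|^p$.  Since $|\nabla d| = 1$ almost everywhere, it gives
   $H \int [d^{s-p} (pHf + tf') |u|^p + d^{s-p+1} f \nabla d \cdot
   \nabla |u|^p] \le 0$, and Young's inequality bounds the gradient term by
   $\int d^s w |\nabla u|^p$ at the price of
   $(p-1) |H|^p \int d^{s-p} w (f/w)^{p/(p-1)} |u|^p$ ([hardy_pointwise]).
   What remains is an inequality between functions of $t$:
   $$p f + t f'/H - (p-1) w (f/w)^{p/(p-1)} \ge w +
     \frac{\alpha}{2H}(\eta^2 + \zeta) + \frac{p-1}{2pH^2}\zeta.$$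
   It holds for small $t$ with $f = w + a\eta + b\eta^2$, for
   $a = (p-1)/(pH)$ and $b/H$ large ([log_weight_inequality]), because
   $t \eta' = (\eta^2 + \zeta)/2$ ([is_derive_eta_fin]) and because
   $\eta^2$ and $\zeta$ are comparable.  The bound $\eta_m(t) \le 4/(-\ln t)$
   ([eta_fin_bound]) makes all constants independent of $m$, so that
   $m = \infty$ follows by dominated convergence ([hardy_log]).

   The remaining work is to justify the choice of $\varphi$, as neither $d$
   nor $|u|^p$ is smooth.  Everything about $d$ rests on one remark: if $y_0$
   is a point of $K$ nearest to $x$, then
   $d(x+v)^2 \le d(x)^2 + 2 v \cdot (x - y_0) + |v|^2$
   ([dist_to_supergradient]), so that $|x|^2 - d(x)^2$ is convex with
   subgradient $2 y_0$.  Consequently the partial derivative of $d^2$ in a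
   coordinate direction exists and equals $2 (x - y_0)_i$ outside a set that
   meets each line of that direction in a countable set, hence is null
   ([ridge_null]); in particular $|\nabla d| = 1$ almost everywhere
   ([enorm_dist_field]).  Moreover, for semiconcave
   functions pointwise convergence implies convergence of the derivatives
   wherever the limit is differentiable ([cvg_slope_off_ridge]).  It is
   therefore enough to approximate $d^2$ by smooth semiconcave functions, for
   which smooth minima $-\varepsilon \ln (\frac1m \sum_j e^{-|x - y_j|^2 /
   \varepsilon})$ over finite subsets of $K$ are used ([softmin],
   [sqr_dist_to_approx]).  Replacing also $|u|^p$ by
   $(u^2 + r)^{p/2} - r^{p/2}$ yields admissible test functions, and dominated
   convergence gives the tested inequality for $\varphi$
   ([weak_inequality_power]). *)

(** * Iterated logarithms *)

Section iterated_logarithms.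
Context (R : realType).
Implicit Types t : R.

Definition Ylog (i : nat) t : R := \prod_(1 <= j < i.+1) Xlog j t.

(** This is $t \zeta_m'(t) / 2$. *)
Definition xi_fin (m : nat) t : R :=
  \sum_(1 <= i < m.+1) Ylog i t ^+ 2 * eta_fin i t.

Lemma XlogS i t : Xlog i.+1 t = X1 (Xlog i t). Proof. by []. Qed.

Lemma XlogSr i t : Xlog i.+1 t = Xlog i (X1 t).
Proof. by rewrite /Xlog iterSr. Qed.

Lemma Ylog0 t : Ylog 0 t = 1. Proof. by rewrite /Ylog big_geq. Qed.

Lemma YlogS i t : Ylog i.+1 t = Ylog i t * Xlog i.+1 t.
Proof. by rewrite /Ylog big_nat_recr. Qed.

Lemma YlogSr i t : Ylog i.+1 t = X1 t * Ylog i (X1 t).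
Proof.
elim: i => [|i ih]; first by rewrite YlogS !Ylog0 mul1r mulr1.
by rewrite YlogS ih -mulrA XlogSr -YlogS.
Qed.

Lemma eta_fin0 t : eta_fin 0 t = 0.
Proof. by rewrite /eta_fin big_geq. Qed.

Lemma eta_finS m t : eta_fin m.+1 t = eta_fin m t + Ylog m.+1 t.
Proof. by rewrite /eta_fin big_nat_recr. Qed.

Lemma zeta_fin0 t : zeta_fin 0 t = 0.
Proof. by rewrite /zeta_fin big_geq. Qed.

Lemma zeta_finS m t : zeta_fin m.+1 t = zeta_fin m t + Ylog m.+1 t ^+ 2.
Proof. by rewrite /zeta_fin big_nat_recr//= /Ylog prodrXl. Qed.

Lemma xi_fin0 t : xi_fin 0 t = 0.
Proof. by rewrite /xi_fin big_geq. Qed.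

Lemma xi_finS m t :
  xi_fin m.+1 t = xi_fin m t + Ylog m.+1 t ^+ 2 * eta_fin m.+1 t.
Proof. by rewrite /xi_fin big_nat_recr. Qed.

Lemma eta_finSr m t : eta_fin m.+1 t = X1 t * (1 + eta_fin m (X1 t)).
Proof.
elim: m => [|m ih].
  by rewrite eta_finS !eta_fin0 add0r addr0 YlogSr Ylog0.
by rewrite eta_finS ih YlogSr eta_finS -mulrDr addrA.
Qed.

Lemma X1_itv t : 0 < t < 1 -> 0 < X1 t < 1.
Proof.
move=> t01; have /andP[t0 _] := t01; rewrite /X1 t0.
have l0 : ln t < 0 by exact: ln_lt0.
rewrite invr_gt0 invf_lt1; lra.
Qed.

Lemma Xlog_itv i t : 0 < t < 1 -> 0 < Xlog i t < 1.
Proof. by move=> t01; elim: i => // i ih; exact: X1_itv. Qed.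

Lemma Ylog_itv i t : 0 < t < 1 -> 0 < Ylog i t <= 1.
Proof.
move=> t01; elim: i => [|i /andP[Y0 Y1]]; first by rewrite Ylog0 ltr01 lexx.
have /andP[X0 X1] := Xlog_itv i.+1 t01.
by rewrite YlogS mulr_gt0//= mulr_ile1// ltW.
Qed.

Lemma eta_fin_ge0 m t : 0 < t < 1 -> 0 <= eta_fin m t.
Proof.
move=> t01; elim: m => [|m ih]; first by rewrite eta_fin0.
by rewrite eta_finS addr_ge0// ltW//; have /andP[] := Ylog_itv m.+1 t01.
Qed.

Lemma zeta_fin_ge0 m t : 0 <= zeta_fin m t.
Proof.
by apply: sumr_ge0 => i _; apply: prodr_ge0 => j _; exact: sqr_ge0.
Qed.

Lemma eta_fin_le t m n : 0 < t < 1 -> (m <= n)%N -> eta_fin m t <= eta_fin n t.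
Proof.
move=> t01; elim: n => [|n ih]; first by rewrite leqn0 => /eqP ->.
rewrite leq_eqVlt => /predU1P[->//|]; rewrite ltnS => /ih/le_trans; apply.
by rewrite eta_finS lerDl ltW//; have /andP[] := Ylog_itv n.+1 t01.
Qed.

Lemma zeta_fin_le t m n : (m <= n)%N -> zeta_fin m t <= zeta_fin n t.
Proof.
elim: n => [|n ih]; first by rewrite leqn0 => /eqP ->.
rewrite leq_eqVlt => /predU1P[->//|]; rewrite ltnS => /ih/le_trans; apply.
by rewrite zeta_finS lerDl sqr_ge0.
Qed.

Lemma zeta_le_eta m t : 0 < t < 1 -> zeta_fin m t <= eta_fin m t.
Proof.
move=> t01; elim: m => [|m ih]; first by rewrite eta_fin0 zeta_fin0.
rewrite zeta_finS eta_finS lerD//.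
by have /andP[Y0 Y1] := Ylog_itv m.+1 t01; rewrite expr2 ler_piMr// ltW.
Qed.

Lemma zeta_le_eta2 m t : 0 < t < 1 -> zeta_fin m t <= eta_fin m t ^+ 2.
Proof.
move=> t01; elim: m => [|m ih]; first by rewrite eta_fin0 zeta_fin0 expr0n.
rewrite zeta_finS eta_finS.
have /andP[Y0 Y1] := Ylog_itv m.+1 t01; have := eta_fin_ge0 m t01; nra.
Qed.

Lemma xi_fin_itv m t : 0 < t < 1 ->
  0 <= xi_fin m t <= eta_fin m t * zeta_fin m t.
Proof.
move=> t01; elim: m => [|m /andP[ih0 ih]].
  by rewrite xi_fin0 zeta_fin0 mulr0 lexx.
rewrite xi_finS zeta_finS eta_finS.
have /andP[Y0 Y1] := Ylog_itv m.+1 t01; have e0 := eta_fin_ge0 m t01.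
have z0 := zeta_fin_ge0 m t.
apply/andP; split; first by rewrite addr_ge0// mulr_ge0 ?sqr_ge0// addr_ge0// ltW.
have := mulr_ge0 (ltW Y0) z0; rewrite mulrDr mulrDl; lra.
Qed.

Lemma is_derive_X1 t : 0 < t < 1 -> is_derive t 1 (@X1 R) (X1 t ^+ 2 / t).
Proof.
move=> t01; have /andP[t0 _] := t01.
have l0 : ln t < 0 by exact: ln_lt0.
apply: (@near_eq_is_derive _ _ _ (fun x => (1 - ln x)^-1)).
  by near=> z; rewrite /X1 ifT//; near: z; exact: lt_nbhsr.
have L : is_derive t 1 (fun x => 1 - ln x) (- t^-1).
  by rewrite -[X in is_derive _ _ _ X]add0r; apply: is_deriveB; exact: is_derive1_ln.
have n0 : 1 - ln t != 0 by rewrite gt_eqF//; lra.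
have Ld : derivable (fun x => 1 - ln x) t 1 by case: L.
split; first exact: derivableV.
rewrite (@deriveV _ _ (fun x => 1 - ln x))//.
have -> : 'D_1 (fun x => 1 - ln x) t = - t^-1 by case: L.
rewrite /X1 t0 scalerN scaleNr opprK /GRing.scale/= exprVn//.
Unshelve. all: by end_near. Qed.

Lemma is_derive_Xlog i t : 0 < t < 1 ->
  is_derive t 1 (@Xlog R i) (Ylog i t * Xlog i t / t).
Proof.
move=> t01; have /andP[t0 _] := t01; elim: i => [|i ih].
  rewrite Ylog0 mul1r [Xlog _ _]/= divff ?gt_eqF//.
  exact: is_derive_id.
have Xi := Xlog_itv i t01.
have := @is_derive1_comp _ (@X1 R) (@Xlog R i) t _ _ (is_derive_X1 Xi) ih.
move=> D; apply: (is_derive_eq D).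
have /andP[Xi0 _] := Xi; rewrite YlogS XlogS.
by rewrite /GRing.scale/=; field; rewrite !gt_eqF.
Qed.

Lemma is_derive_Ylog i t : 0 < t < 1 ->
  is_derive t 1 (Ylog i) (Ylog i t * eta_fin i t / t).
Proof.
move=> t01; have /andP[t0 _] := t01; elim: i => [|i ih].
  rewrite eta_fin0 mulr0 mul0r (_ : Ylog 0 = cst 1); first exact: is_derive_cst.
  by apply/funext => x; rewrite Ylog0.
rewrite (_ : Ylog i.+1 = Ylog i * Xlog i.+1); last first.
  by apply/funext => x; rewrite YlogS.
apply: (is_derive_eq (is_deriveM ih (is_derive_Xlog i.+1 t01))).
by rewrite /GRing.scale !fctE/= -XlogS eta_finS YlogS; field; rewrite gt_eqF.
Qed.

(** Since $t Y_i' = Y_i \eta_i$ for $Y_i = X_1 \cdots X_i$, the term $Y_{m+1}$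
   adds $Y_{m+1} \eta_{m+1}$ to $t \eta_m'$; this is also what it adds to
   $(\eta_m^2 + \zeta_m)/2$. *)
Lemma is_derive_eta_fin m t : 0 < t < 1 ->
  is_derive t 1 (@eta_fin R m) ((eta_fin m t ^+ 2 + zeta_fin m t) / 2 / t).
Proof.
move=> t01; have /andP[t0 _] := t01; elim: m => [|m ih].
  rewrite eta_fin0 zeta_fin0 expr0n/= addr0 !mul0r.
  rewrite (_ : eta_fin 0 = cst 0); first exact: is_derive_cst.
  by apply/funext => x; rewrite eta_fin0.
rewrite (_ : eta_fin m.+1 = eta_fin m + Ylog m.+1); last first.
  by apply/funext => x; rewrite eta_finS.
apply: (is_derive_eq (is_deriveD ih (is_derive_Ylog m.+1 t01))).
by rewrite fctE zeta_finS eta_finS; field; rewrite gt_eqF.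
Qed.

Lemma is_derive_zeta_fin m t : 0 < t < 1 ->
  is_derive t 1 (@zeta_fin R m) (2 * xi_fin m t / t).
Proof.
move=> t01; have /andP[t0 _] := t01; elim: m => [|m ih].
  rewrite xi_fin0 mulr0 mul0r (_ : zeta_fin 0 = cst 0); first exact: is_derive_cst.
  by apply/funext => x; rewrite zeta_fin0.
rewrite (_ : zeta_fin m.+1 = zeta_fin m + Ylog m.+1 * Ylog m.+1); last first.
  by apply/funext => x; rewrite zeta_finS expr2.
have dY := is_derive_Ylog m.+1 t01.
apply: (is_derive_eq (is_deriveD ih (is_deriveM dY dY))).
by rewrite /GRing.scale/= xi_finS; field; rewrite gt_eqF.
Qed.

(** With $r = \sqrt{1+x}$, it follows from $\ln(1+x) = 2 \ln r \ge 2(1 - 1/r)$.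
   A factor smaller than $1$ before $x$ in the denominator is what makes
   the next bound possible. *)
Lemma ln1D_ge x : 0 <= x -> x / (1 + 3 / 4 * x) <= ln (1 + x :> R).
Proof.
move=> x0; pose r := Num.sqrt (1 + x).
have r1 : 1 <= r by rewrite -[leLHS]sqrtr1 ler_sqrt; lra.
have r2 : r ^+ 2 = 1 + x by rewrite sqr_sqrtr//; lra.
have lnr : 1 - r^-1 <= ln r.
  have : ln (1 + (r^-1 - 1)) <= r^-1 - 1.
    apply: le_ln1Dx; have : 0 < r^-1 by rewrite invr_gt0; lra.
    lra.
  by rewrite addrC subrK lnV ?posrE; lra.
rewrite -r2 lnXn; last lra.
rewrite mulr2n; apply: (@le_trans _ _ (2 * (1 - r^-1))); last lra.
have -> : x = r ^+ 2 - 1 by rewrite r2; lra.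
rewrite ler_pdivrMr; last nra.
rewrite -subr_ge0.
have -> : 2 * (1 - r^-1) * (1 + 3 / 4 * (r ^+ 2 - 1)) - (r ^+ 2 - 1) =
  (r - 1) * (r - 1) ^+ 2 / (2 * r) by field; lra.
by rewrite divr_ge0 ?mulr_ge0 ?sqr_ge0//; lra.
Qed.

(** A bound independent of the number of terms: $4/(-\ln t)$ is a
   supersolution of the recursion $\eta_{m+1}(t) = X_1(t)(1+\eta_m(X_1(t)))$. *)
Lemma eta_fin_bound m t : 0 < t < 1 -> eta_fin m t <= 4 / - ln t.
Proof.
elim: m t => [|m ih] t t01; have l0 : ln t < 0 by exact: ln_lt0.
  by rewrite eta_fin0 divr_ge0//; lra.
have /andP[t0 _] := t01.
rewrite eta_finSr; have X01 := X1_itv t01; have /andP[X0 _] := X01.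
pose L := - ln t; have L0 : 0 < L by rewrite /L; lra.
have XE : X1 t = (1 + L)^-1 by rewrite /X1 t0.
have lX : - ln (X1 t) = ln (1 + L).
  by rewrite XE lnV ?opprK// posrE; lra.
have lnL := ln1D_ge (ltW L0).
have a0 : 0 < L / (1 + 3 / 4 * L) by rewrite divr_gt0//; lra.
have := ih _ X01; rewrite lX => e.
have {}e : eta_fin m (X1 t) <= 4 / (L / (1 + 3 / 4 * L)).
  apply: (le_trans e); rewrite ler_pM2l// lef_pV2 ?posrE//.
  exact: lt_le_trans lnL.
rewrite -/L; apply: (@le_trans _ _ (X1 t * (1 + 4 / (L / (1 + 3 / 4 * L))))).
  by rewrite ler_pM2l// lerD2l.
rewrite XE le_eqVlt; apply/orP; left; apply/eqP; field.
by rewrite !gt_eqF//; lra.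
Qed.

Lemma eta_fin_small m t (e : R) : 0 < e -> 0 < t <= expR (- (4 / e)) ->
  0 < t < 1 /\ eta_fin m t <= e.
Proof.
move=> e0 /andP[t0 te].
have t1 : t < 1.
  by apply: (le_lt_trans te); rewrite expR_lt1 oppr_lt0 divr_gt0.
have t01 : 0 < t < 1 by rewrite t0.
split=> //; apply: (le_trans (eta_fin_bound m t01)).
have l0 : ln t < 0 by exact: ln_lt0.
have : ln t <= - (4 / e) by rewrite -[leRHS]expRK ler_ln ?posrE ?expR_gt0.
move=> lt; rewrite ler_pdivrMr; last lra.
have : 4 / e <= - ln t by lra.
by rewrite ler_pdivrMr// mulrC.
Qed.

(** As $t \to 0$, $\eta_m$ is of the order of its first term $X_1$, hence
   $\eta_m^2$ and $\zeta_m$ are comparable, uniformly in $m$. *)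
Lemma eta2_le_zeta m t : 0 < t <= expR (- 1) ->
  eta_fin m t ^+ 2 <= 64 * zeta_fin m t.
Proof.
move=> /andP[t0 te].
have t1 : t < 1 by apply: (le_lt_trans te); rewrite expR_lt1; lra.
have t01 : 0 < t < 1 by rewrite t0.
case: m => [|m]; first by rewrite eta_fin0 zeta_fin0 expr0n mulr0.
have lt : ln t <= - 1 by rewrite -[leRHS]expRK ler_ln ?posrE ?expR_gt0.
have /andP[X0 _] := X1_itv t01.
have eX : eta_fin m.+1 t <= 8 * X1 t.
  apply: (le_trans (eta_fin_bound _ t01)); rewrite /X1 t0.
  rewrite ler_pdivrMr; last lra.
  by rewrite mulrAC ler_pdivlMr; lra.
have zX : X1 t ^+ 2 <= zeta_fin m.+1 t.
  apply: le_trans (@zeta_fin_le t 1 m.+1 isT).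
  by rewrite zeta_finS zeta_fin0 add0r YlogSr Ylog0 mulr1.
have := eta_fin_ge0 m.+1 t01; nra.
Qed.

End iterated_logarithms.

(** * The inequality between logarithmic weights *)

Section pointwise_inequality.
Context (R : realType).
Implicit Types p q x y : R.

Lemma ge0_of_derive_ge0 (F dF : R -> R) (b : R) :
  F 0 = 0 -> (forall x, 0 <= x <= b -> is_derive x 1 F (dF x)) ->
  (forall x, 0 <= x <= b -> 0 <= dF x) -> forall x, 0 <= x <= b -> 0 <= F x.
Proof.
move=> F0 dFE dF0 x /andP[x0 xb].
have ud y : y \in `]0, x[ -> is_derive y 1 F (dF y).
  by rewrite in_itv/= => /andP[y0 yx]; apply: dFE; rewrite ltW//= (le_trans (ltW yx)).
have cF : {within `[0, x], continuous F}.
  apply: derivable_within_continuous => y; rewrite in_itv/= => /andP[y0 yx].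
  by have [] : is_derive y 1 F (dF y) by apply: dFE; rewrite y0 (le_trans yx).
have [c cx] := MVT_segment x0 ud cF.
rewrite F0 !subr0 => ->; move: cx; rewrite in_itv/= => /andP[c0 cx].
by rewrite mulr_ge0// dF0// c0 (le_trans cx).
Qed.

Lemma is_derive_powR_affine (r s x : R) : 0 < 1 + s * x ->
  is_derive x 1 (fun y => (1 + s * y) `^ r) (r * s * (1 + s * x) `^ (r - 1)).
Proof.
move=> h; have dp := is_derive1_powR r h.
have da : is_derive x 1 (fun y : R => 1 + s * y) s.
  have d1 : is_derive x 1 (cst 1 + (s *: id) : R -> R) (0 + s *: 1).
    exact: is_deriveD.
  by apply: (is_derive_eq d1); rewrite add0r /GRing.scale/= mulr1.
have := @is_derive1_comp _ (fun y => y `^ r) (fun y => 1 + s * y) x _ _ dp da.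
by move=> D; apply: (is_derive_eq D); rewrite mulrAC.
Qed.

Lemma powR_le_expR_ln2 x (r : R) : 2^-1 <= x <= 2 -> x `^ r <= expR (`|r| * ln 2).
Proof.
move=> /andP[x1 x2]; have x0 : 0 < x by apply: lt_le_trans x1; rewrite invr_gt0.
rewrite /powR gt_eqF// ler_expR (le_trans (ler_norm _))// normrM.
rewrite ler_wpM2l// ler_norml -lnV ?posrE//.
by rewrite !ler_ln ?posrE ?invr_gt0// x1 x2.
Qed.

(** The remainder and its first two derivatives vanish at $0$ and its third
   derivative is nonnegative for $C$ large; the sign $s$ covers arguments of
   both signs while $x$ stays nonnegative. *)
Lemma powR1D_taylor_pos (q s : R) : s = 1 \/ s = -1 -> exists2 C, 0 <= C &
  forall x, 0 <= x <= 2^-1 -> (1 + s * x) `^ q <=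
    1 + q * (s * x) + q * (q - 1) / 2 * x ^+ 2 + C * x ^+ 3.
Proof.
move=> s1.
pose C := `|q * (q - 1) * (q - 2)| * expR (`|q - 3| * ln 2) / 6.
have C0 : 0 <= C by rewrite divr_ge0// mulr_ge0// expR_ge0.
exists C => // x x12.
have pos y : 0 <= y <= 2^-1 -> 2^-1 <= 1 + s * y <= 2 by case: s1 => ->; lra.
have gt0 y : 0 <= y <= 2^-1 -> 0 < 1 + s * y by move/pos; lra.
have ss : s * s = 1 by case: s1 => ->; lra.
pose F3 y : R := 6 * C - q * (q - 1) * (q - 2) * s * (1 + s * y) `^ (q - 3).
pose F2 y : R := q * (q - 1) + 6 * C * y - q * (q - 1) * (1 + s * y) `^ (q - 2).
pose F1 y : R := q * s + q * (q - 1) * y + 3 * C * y ^+ 2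
  - q * s * (1 + s * y) `^ (q - 1).
pose F0 y : R := 1 + q * (s * y) + q * (q - 1) / 2 * y ^+ 2 + C * y ^+ 3
  - (1 + s * y) `^ q.
have poly (a0 a1 a2 a3 y : R) :
    is_derive y 1 (fun y : R => a0 + a1 * y + a2 * y ^+ 2 + a3 * y ^+ 3)
      (a1 + 2 * a2 * y + 3 * a3 * y ^+ 2).
  have d1 := is_derive_id y (1 : R); have d2 := is_deriveM d1 d1.
  have d3 := is_deriveM d2 d1.
  have D := is_deriveD (is_deriveD (is_deriveD (is_derive_cst a0 y 1)
    (is_deriveZ a1 d1)) (is_deriveZ a2 d2)) (is_deriveZ a3 d3).
  rewrite (_ : (fun _ => _) = (cst a0 + a1 \*: id + a2 \*: (id * id)
    + a3 \*: (id * id * id) : R -> R)); last first.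
    apply/funext => z; rewrite !fctE /GRing.scale/= !exprS expr0 !mulr1.
    by rewrite [in RHS](mulrC (z * z)).
  apply: (is_derive_eq D); rewrite !fctE /GRing.scale/= !mulr1.
  by move: y {d1 d2 d3 D} => y; ring.
have gen (a0 a1 a2 a3 k r : R) y : 0 <= y <= 2^-1 ->
    is_derive y 1 (fun y : R => a0 + a1 * y + a2 * y ^+ 2 + a3 * y ^+ 3
       - k * (1 + s * y) `^ r)
      (a1 + 2 * a2 * y + 3 * a3 * y ^+ 2 - k * (r * s * (1 + s * y) `^ (r - 1))).
  move=> y12.
  exact: (is_deriveB (poly a0 a1 a2 a3 y)
    (is_deriveZ k (is_derive_powR_affine r (gt0 _ y12)))).
have F3_ge0 y : 0 <= y <= 2^-1 -> 0 <= F3 y.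
  move=> y12; rewrite /F3 subr_ge0 (le_trans (ler_norm _))//.
  rewrite normrM [X in _ * X]ger0_norm ?powR_ge0// normrM.
  have -> : `|s| = 1 by case: s1 => ->; rewrite ?normrN normr1.
  rewrite mulr1 /C mulrCA divff ?mulr1 ?pnatr_eq0//.
  by rewrite ler_wpM2l// powR_le_expR_ln2// pos.
have F2_ge0 y : 0 <= y <= 2^-1 -> 0 <= F2 y.
  apply: (@ge0_of_derive_ge0 F2 F3 _ _ _ F3_ge0).
    by rewrite /F2 !mulr0 !addr0 powR1 mulr1 subrr.
  move=> z z12; have := gen (q * (q - 1)) (6 * C) 0 0 (q * (q - 1)) (q - 2) z z12.
  move=> D; rewrite (_ : F2 = (fun y : R => q * (q - 1) + 6 * C * y + 0 * y ^+ 2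
    + 0 * y ^+ 3 - q * (q - 1) * (1 + s * y) `^ (q - 2))).
    apply: (is_derive_eq D); rewrite /F3 (_ : q - 2 - 1 = q - 3); first ring.
    by ring.
  by apply/funext => t; rewrite /F2; ring.
have F1_ge0 y : 0 <= y <= 2^-1 -> 0 <= F1 y.
  apply: (@ge0_of_derive_ge0 F1 F2 _ _ _ F2_ge0).
    by rewrite /F1 expr0n/= !mulr0 !addr0 powR1 mulr1 subrr.
  move=> z z12; have := gen (q * s) (q * (q - 1)) (3 * C) 0 (q * s) (q - 1) z z12.
  move=> D; rewrite (_ : F1 = (fun y : R => q * s + q * (q - 1) * y
    + 3 * C * y ^+ 2 + 0 * y ^+ 3 - q * s * (1 + s * y) `^ (q - 1))).
    apply: (is_derive_eq D); rewrite /F2 (_ : q - 1 - 1 = q - 2); last by ring.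
    by case: s1 => ->; ring.
  by apply/funext => t; rewrite /F1; ring.
have F0_ge0 y : 0 <= y <= 2^-1 -> 0 <= F0 y.
  apply: (@ge0_of_derive_ge0 F0 F1 _ _ _ F1_ge0).
    by rewrite /F0 !expr0n/= !mulr0 !addr0 powR1 subrr.
  move=> z z12; have := gen 1 (q * s) (q * (q - 1) / 2) C 1 q z z12.
  move=> D; rewrite (_ : F0 = (fun y : R => 1 + q * s * y
    + q * (q - 1) / 2 * y ^+ 2 + C * y ^+ 3 - 1 * (1 + s * y) `^ q)).
    by apply: (is_derive_eq D); rewrite /F1; field.
  by apply/funext => t; rewrite /F0; ring.
by have := F0_ge0 x x12; rewrite /F0 subr_ge0.
Qed.

Lemma powR1D_taylor (q : R) : exists2 C, 0 <= C &
  forall x, `|x| <= 2^-1 -> (1 + x) `^ q <=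
    1 + q * x + q * (q - 1) / 2 * x ^+ 2 + C * `|x| ^+ 3.
Proof.
have [C C0 hC] := powR1D_taylor_pos q (or_introl (erefl 1)).
have [D D0 hD] := powR1D_taylor_pos q (or_intror (erefl (-1))).
exists (C + D); first exact: addr_ge0.
move=> x x12; have [x0|x0] := leP 0 x.
  move: x12; rewrite ger0_norm// => x12.
  have := hC x; rewrite x0 x12 mul1r => /(_ isT) /le_trans; apply.
  by rewrite mulrDl lerD2l lerDl mulr_ge0// exprn_ge0.
move: x12; rewrite ltr0_norm// => x12.
have Nx0 : 0 <= - x by lra.
have := hD (- x); rewrite Nx0 x12 mulN1r opprK sqrrN => /(_ isT) /le_trans; apply.
by rewrite mulrDl lerD2l lerDr mulr_ge0// exprn_ge0.
Qed.

(** Young's inequality for the product of $y$ and $x^{p-1}$, with equality at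
   $y = x$. *)
Lemma powR_young p x y : 1 < p -> 0 <= x -> 0 <= y ->
  p * y * x `^ (p - 1) <= y `^ p + (p - 1) * x `^ p.
Proof.
move=> p1 x0 y0; have p0 : 0 < p by lra.
have := @conjugate_powR R y (x `^ (p - 1)) p (p / (p - 1)) y0 (powR_ge0 _ _).
have -> : 0 < p / (p - 1) by rewrite divr_gt0//; lra.
have -> : p^-1 + (p / (p - 1))^-1 = 1 by field; rewrite !gt_eqF//; lra.
move=> /(_ p0 isT erefl).
rewrite -powRrM mulrCA divff ?mulr1; last by rewrite gt_eqF//; lra.
move=> h; have := ler_wpM2l (ltW p0) h; rewrite mulrA => /le_trans; apply.
rewrite le_eqVlt; apply/orP; left; apply/eqP; field.
by rewrite !gt_eqF//; lra.
Qed.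

(** Here $e$, $z$ and $x$ stand for $\eta$, $\zeta$ and $t \zeta'/2$, and $df$
   for $t f'$.  Expand $(f/w)^q$ to second order in $(f - w)/w$, where
   $q = p/(p-1)$, and let $c$ be the coefficient of $(f-w)^2/w$ in
   $(p-1) w (f/w)^q$.  The terms of order at most two in $e$ cancel for
   $a = (p-1)/(pH)$.  Of the cubic terms in $b$ only $(b/H) e z$ remains, as
   $2 c a = 1/H$.  The other cubic terms are bounded by a constant
   independent of $b$ times $e z$, because $e^2 \le 64 z$.  They are absorbed
   by taking $b/H$ large, and then the quartic term in $b$ by taking
   $\delta$ small. *)
Lemma log_weight_inequality p (H alpha beta gamma : R) : 1 < p -> H != 0 ->
  exists a b delta : R, 0 < delta /\
  forall e z x : R, 0 <= e <= delta -> 0 <= z <= e ^+ 2 -> e ^+ 2 <= 64 * z ->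
    0 <= x <= e * z ->
    let w := 1 + alpha * e + beta * e ^+ 2 + gamma * z in
    let f := w + a * e + b * e ^+ 2 in
    let df := (alpha + a) * (e ^+ 2 + z) / 2 + (beta + b) * e * (e ^+ 2 + z)
      + 2 * gamma * x in
    [/\ 0 < w, 0 < f &
      w + alpha / (2 * H) * (e ^+ 2 + z) + (p - 1) / (2 * p * H ^+ 2) * z <=
      p * f + df / H - (p - 1) * w * (f / w) `^ (p / (p - 1))].
Proof.
move=> p1 H0; set q := p / (p - 1).
have [C C0 taylor] := powR1D_taylor q.
have p0 : 0 < p by lra.
have pn0 : p != 0 by rewrite gt_eqF.
have p1n0 : p - 1 != 0 by rewrite gt_eqF//; lra.
pose a := (p - 1) / (p * H).
pose c := p / (2 * (p - 1)).
have c0 : 0 < c by rewrite divr_gt0//; lra.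
pose M := `|alpha| + `|beta| + `|gamma|.
pose A := `|a| + 1.
pose C1 := (p - 1) * (2 * (C * (2 * A) ^+ 3)).
pose B := 65 * `|beta / H| + 2 * `|gamma / H| + 64 * (1 + 2 * M * c * A ^+ 2 + C1).
pose b := H * B.
have M0 : 0 <= M by rewrite !addr_ge0.
have A0 : 0 < A by rewrite ltr_wpDl.
have C10 : 0 <= C1.
  apply: mulr_ge0; first lra.
  by rewrite mulr_ge0// mulr_ge0// exprn_ge0//; lra.
pose Q := 1 + 2 * M + `|b| + 4 * A + c * b ^+ 2.
have b0 : 0 <= `|b| by [].
have cb0 : 0 <= c * b ^+ 2 by rewrite mulr_ge0 ?sqr_ge0// ltW.
have Q0 : 0 < Q by rewrite /Q; lra.
exists a, b, Q^-1; split; first by rewrite invr_gt0.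
move=> e z x /andP[e0 eQ] /andP[z0 ze] ez /andP[x0 xez] w f df.
have {}eQ : e * Q <= 1 by rewrite -ler_pdivlMr// div1r.
have Me0 : 0 <= e * M by rewrite mulr_ge0.
have be0 : 0 <= e * `|b| by rewrite mulr_ge0.
have Ae0 : 0 <= e * A by rewrite mulr_ge0// ltW.
have cbe0 : 0 <= e * (c * b ^+ 2) by rewrite mulr_ge0.
have eQE : e * Q = e + 2 * (e * M) + e * `|b| + 4 * (e * A) + e * (c * b ^+ 2).
  by rewrite /Q; ring.
have e1 : e <= 1 by clear -eQ eQE e0 Me0 be0 Ae0 cbe0; lra.
have e2e : e ^+ 2 <= e by rewrite expr2 ler_piMl.
have wM : `|w - 1| <= e * M.
  rewrite (_ : w - 1 = alpha * e + beta * e ^+ 2 + gamma * z); last by rewrite /w; ring.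
  rewrite (le_trans (ler_normD _ _))// mulrDr lerD//; last first.
    by rewrite normrM (ger0_norm z0) mulrC ler_wpM2r//; clear -ze e2e; lra.
  rewrite (le_trans (ler_normD _ _))// mulrDr lerD//.
    by rewrite normrM (ger0_norm e0) mulrC.
  by rewrite normrM (ger0_norm (sqr_ge0 _)) mulrC ler_wpM2r//.
have w12 : 2^-1 <= w <= 2 by move: wM e1 eQ; rewrite eQE ler_norml; clear -e0 Me0 be0 Ae0 cbe0; lra.
have w0 : 0 < w by case/andP: w12 => h _; clear -h; lra.
have wn0 : w != 0 by rewrite gt_eqF.
pose g := a * e + b * e ^+ 2.
have fE : f = w + g by rewrite /f /g addrA.
have eb1 : e * `|b| <= 1 by clear -eQ eQE e0 Me0 be0 Ae0 cbe0; lra.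
have gA : `|g| <= e * A.
  rewrite (le_trans (ler_normD _ _))// mulrDr lerD//.
    by rewrite normrM (ger0_norm e0) mulrC.
  by rewrite normrM (ger0_norm (sqr_ge0 _)) expr2 mulrCA ler_wpM2l// mulrC.
pose eps := g / w.
have epsA : `|eps| <= 2 * A * e.
  rewrite normrM normfV (ger0_norm (ltW w0)) ler_pdivrMr//.
  by apply: (le_trans gA); case/andP: w12 => w12 _; clear -w12 Ae0; nra.
have eps12 : `|eps| <= 2^-1.
  by apply: (le_trans epsA); clear -eQ eQE e0 Me0 be0 Ae0 cbe0; lra.
have fw : f / w = 1 + eps by rewrite fE /eps; field.
have f0 : 0 < f.
  have -> : f = w * (f / w) by field.
  rewrite mulr_gt0// fw; move: eps12; rewrite ler_norml => /andP[h _].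
  by clear -h; lra.
split=> //.
rewrite fw.
have e3 : 0 <= e ^+ 3 by rewrite exprn_ge0.
have main : (p - 1) * w * (1 + eps) `^ q <=
    (p - 1) * w + p * g + c * g ^+ 2 / w + C1 * e ^+ 3.
  have pw0 : 0 <= (p - 1) * w by rewrite mulr_ge0 ?subr_ge0 ?(ltW p1) ?(ltW w0).
  apply: (le_trans (ler_wpM2l pw0 (taylor eps eps12))).
  have -> : (p - 1) * w * (1 + q * eps + q * (q - 1) / 2 * eps ^+ 2
      + C * `|eps| ^+ 3) =
    (p - 1) * w + p * g + c * g ^+ 2 / w + (p - 1) * w * (C * `|eps| ^+ 3).
    by rewrite /q /eps /c; field; rewrite wn0 p1n0.
  rewrite lerD2l.
  have -> : C1 * e ^+ 3 = (p - 1) * (2 * (C * ((2 * A) ^+ 3 * e ^+ 3))).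
    by rewrite /C1; ring.
  rewrite -mulrA ler_wpM2l ?subr_ge0 ?(ltW p1)//.
  have h2 : 0 <= C * `|eps| ^+ 3 by rewrite mulr_ge0// exprn_ge0.
  apply: ler_pM => //; [exact: ltW|by case/andP: w12|].
  have A20 : 0 <= 2 * A by rewrite mulr_ge0// ltW.
  by rewrite ler_wpM2l// -exprMn lerXn2r// nnegrE mulr_ge0.
have gw : c * g ^+ 2 / w <= c * g ^+ 2 + 2 * M * c * A ^+ 2 * e ^+ 3.
  have -> : c * g ^+ 2 / w = c * g ^+ 2 + c * g ^+ 2 * ((1 - w) / w) by field.
  rewrite lerD2l.
  have h : (1 - w) / w <= 2 * (e * M).
    rewrite ler_pdivrMr//; move: wM; rewrite ler_norml => /andP[wM _].
    apply: (@le_trans _ _ (e * M)); first by clear -wM; lra.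
    by case/andP: w12 => w12 _; clear -w12 Me0; nra.
  have g2 : 0 <= c * g ^+ 2 by rewrite mulr_ge0 ?sqr_ge0// ltW.
  apply: (le_trans (ler_wpM2l g2 h)).
  have g2A : g ^+ 2 <= (e * A) ^+ 2.
    by rewrite -[leLHS]real_normK ?num_real// lerXn2r// nnegrE.
  have h3 : 0 <= 2 * (e * M) * c by rewrite mulr_ge0 ?(ltW c0)// mulr_ge0.
  have := ler_wpM2l h3 g2A.
  by rewrite [leLHS](_ : _ = c * g ^+ 2 * (2 * (e * M))); [move/le_trans; apply;
    rewrite le_eqVlt; apply/orP; left; apply/eqP|]; ring.
have ez0 : 0 <= e * z by rewrite mulr_ge0.
have e3z : e ^+ 3 <= 64 * (e * z).
  by rewrite exprS (_ : 64 * _ = e * (64 * z)); [rewrite ler_wpM2l|ring].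
have g2E : c * g ^+ 2 = a / (2 * H) * e ^+ 2 + b / H * e ^+ 3
     + e * (c * b ^+ 2) * e ^+ 3.
  by rewrite /g /c /a; field; rewrite H0 pn0 p1n0.
have cb3 : e * (c * b ^+ 2) * e ^+ 3 <= e ^+ 3.
  by rewrite ler_piMl//; clear -eQ eQE e0 Me0 be0 Ae0 cbe0; lra.
have betaH : - (65 * `|beta / H|) * (e * z) <= beta / H * (e * (e ^+ 2 + z)).
  have : `|beta / H * (e * (e ^+ 2 + z))| <= 65 * `|beta / H| * (e * z).
    rewrite normrM mulrAC mulrC ler_wpM2r// ger0_norm ?mulr_ge0 ?addr_ge0 ?sqr_ge0//.
    by rewrite mulrCA ler_wpM2l//; clear -ez; lra.
  by rewrite ler_norml mulNr => /andP[].
have gammaH : - (2 * `|gamma / H|) * (e * z) <= gamma / H * (2 * x).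
  have : `|gamma / H * (2 * x)| <= 2 * `|gamma / H| * (e * z).
    rewrite normrM [2 * `|_|]mulrC -mulrA ler_wpM2l// ger0_norm; clear -x0 xez; lra.
  by rewrite ler_norml mulNr => /andP[].
have K0 : 0 <= 1 + 2 * M * c * A ^+ 2 + C1.
  by rewrite addr_ge0// addr_ge0// mulr_ge0 ?sqr_ge0// mulr_ge0 ?(ltW c0)// mulr_ge0.
have e3K := ler_wpM2l K0 e3z.
have dfE : df / H = alpha / (2 * H) * (e ^+ 2 + z) + a / (2 * H) * (e ^+ 2 + z)
    + beta / H * (e * (e ^+ 2 + z)) + B * (e ^+ 3 + e * z) + gamma / H * (2 * x).
  by rewrite /df /b; field.
have aH : (p - 1) / (2 * p * H ^+ 2) = a / (2 * H).
  by rewrite /a; field; rewrite H0 pn0.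
have bH : b / H = B by rewrite /b mulrC mulKf.
rewrite dfE aH fE.
have BE : B * (e * z) = 65 * `|beta / H| * (e * z) + 2 * `|gamma / H| * (e * z)
   + (1 + 2 * M * c * A ^+ 2 + C1) * (64 * (e * z)) by rewrite /B; ring.
move: main gw g2E; rewrite bH.
set P := (_ `^ _); set T := c * g ^+ 2 / w; set T2 := c * g ^+ 2.
move=> main gw g2E.
have P1 : p * (w + g) = p * w + p * g by ring.
have P2 : (p - 1) * w = p * w - w by ring.
have E3 : (1 + 2 * M * c * A ^+ 2 + C1) * e ^+ 3 =
  e ^+ 3 + 2 * M * c * A ^+ 2 * e ^+ 3 + C1 * e ^+ 3 by ring.
rewrite !(mulrDr B) in betaH *.
clear -main gw g2E cb3 betaH gammaH e3K P1 P2 E3 BE; lra.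
Qed.

End pointwise_inequality.

(** * Measurability and null sets in Euclidean space *)

Lemma natSinv_lt (R : realType) (r : R) : 0 < r ->
  exists n0, forall k, (n0 <= k)%N -> k.+1%:R^-1 < r.
Proof.
move=> r0; have [N _ hN] := near_infty_natSinv_lt (PosNum r0).
by exists N => k; exact: hN.
Qed.

Section euclidean_measurability.
Context (R : realType).

Lemma rV_coord_le_norm n (x : 'rV[R]_n) i : `|x ord0 i| <= `|x|.
Proof.
rewrite [leRHS]/Num.norm /= mx_normrE; apply/bigmax_geP; right => /=.
by exists (ord0, i).
Qed.

Lemma rV_norm_le n (x : 'rV[R]_n) (M : R) : 0 <= M ->
  (forall i, `|x ord0 i| <= M) -> `|x| <= M.
Proof.
move=> M0 h; rewrite [leLHS]/Num.norm /= mx_normrE; apply/bigmax_leP; split => //=.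
by move=> [a i] _ /=; rewrite ord1.
Qed.

(** An open set is the union of the cubes with rational centre and radius
   $1/(k+1)$ that it contains. *)
Lemma open_measurable_rV n (U : set 'rV[R]_n) : open U -> measurable U.
Proof.
move=> oU.
pose box (q : 'rV[rat]_n * nat) : set 'rV[R]_n := [set x : 'rV[R]_n | forall i,
  ratr (q.1 ord0 i) - q.2.+1%:R^-1 <= x ord0 i
    <= ratr (q.1 ord0 i) + q.2.+1%:R^-1].
have mbox q : measurable (box q) by exact: measurable_box_rV.
pose F q := if `[< box q `<=` U >] then box q else set0.
rewrite (_ : U = \bigcup_q F q).
  apply: countable_bigcupT_measurable; first exact: countableP.
  by move=> q; rewrite /F; case: asboolP.
apply/seteqP; split => [x Ux|x [q _]]; last first.
  by rewrite /F; case: asboolP => // + bx; exact.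
have /nbhs_ballP[e /= e0 xeU] := open_nbhs_nbhs (conj oU Ux).
have [k ke] : exists k, k.+1%:R^-1 < e / 2.
  have [N hN] := natSinv_lt (divr_gt0 e0 (ltr0n R 2)).
  by exists N; exact: hN.
have k0 : 0 < k.+1%:R^-1 :> R by rewrite invr_gt0.
have {k0 ke}[r rE [k0 ke]] : exists2 r : R, r = k.+1%:R^-1 & 0 < r /\ r < e / 2.
  by exists k.+1%:R^-1.
have q_ i : {q : rat | x ord0 i - r < ratr q < x ord0 i + r}.
  apply: cid; have /rat_in_itvoo[q] : x ord0 i - r < x ord0 i + r by lra.
  by rewrite in_itv/= => qx; exists q.
exists (\row_i sval (q_ i), k) => //.
have bU : box (\row_i sval (q_ i), k) `<=` U.
  move=> y /= h; apply: xeU; rewrite -ball_normE /ball_/=.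
  apply: (@le_lt_trans _ _ (2 * r)); last lra.
  apply: rV_norm_le => [|i]; first by rewrite mulr_ge0// ltW.
  rewrite !mxE ler_norml; have := h i; rewrite mxE -rE; case: (q_ i) => q /= hq; lra.
rewrite /F; case: asboolP => // _ i; rewrite /= mxE -rE.
by case: (q_ i) => q /=; lra.
Qed.

Lemma closed_measurable_rV n (U : set 'rV[R]_n) : closed U -> measurable U.
Proof.
by move=> cU; rewrite -[U]setCK; apply: measurableC; apply: open_measurable_rV;
  exact: closed_openC.
Qed.

Lemma continuous_measurable_rV n (f : 'rV[R]_n -> R) :
  continuous f -> measurable_fun setT f.
Proof.
move=> /continuousP cf; apply: (measurability _ (measurable_realfun.RGenOpens.measurableE R)).
move=> _ [_ [a [b ->] <-]]; rewrite setTI; apply: open_measurable_rV.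
exact/cf/interval_open.
Qed.

Lemma lebesgue_rV_bounded n (A : set 'rV[R]_n) : measurable A ->
  bounded_set A -> (lebesgue_rV R n A < +oo)%E.
Proof.
move=> mA [M [_ AM]]; have {}AM := AM (`|M| + 1) (ltr_pwDr ltr01 (ler_norm _)).
set r := `|M| + 1 in AM.
have r0 : 0 <= r by rewrite addr_ge0.
apply: (@le_lt_trans _ _ (lebesgue_rV R n
    [set x | forall i : 'I_n, (fun=> - r) i <= x ord0 i <= (fun=> r) i])).
  apply: le_measure; rewrite ?inE//; first exact: measurable_box_rV.
  move=> x /AM/= xr i; rewrite -ler_norml.
  exact: le_trans (rV_coord_le_norm x i) xr.
by rewrite lebesgue_rV_box ?ltry// => i; lra.
Qed.

Let lebesgue_rVS n (A : set 'rV[R]_n.+1) :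
  lebesgue_rV R n.+1 A =
  (@lebesgue_measure R \x lebesgue_rV R n)%E (@cons_rV R n @^-1` A).
Proof. by []. Qed.

Lemma cons_rVD0 n (a t : R) (y : 'rV[R]_n) :
  cons_rV (a, y) + t *: delta_mx ord0 ord0 = cons_rV (a + t, y).
Proof.
apply/rowP => i; rewrite [LHS]mxE [X in _ + X]mxE [X in _ * X]mxE.
case: (unliftP ord0 i) => [j|] ->.
  by rewrite !cons_rVS/= mulr0 addr0.
by rewrite !cons_rV0/= mulr1.
Qed.

Lemma cons_rVDS n (a t : R) (y : 'rV[R]_n) j :
  cons_rV (a, y) + t *: delta_mx ord0 (lift ord0 j) =
  cons_rV (a, y + t *: delta_mx ord0 j).
Proof.
apply/rowP => i; rewrite [LHS]mxE [X in _ + X]mxE [X in _ * X]mxE.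
case: (unliftP ord0 i) => [l|] ->.
  by rewrite !cons_rVS/= !mxE (inj_eq lift_inj).
by rewrite !cons_rV0/= mulr0 addr0.
Qed.

(** Fubini's theorem, by induction on the dimension: the measure is built by
   splitting off the first coordinate, so that either this is the direction
   of the slices, or it can be frozen. *)
Lemma null_of_null_slices n (i : 'I_n) (A : set 'rV[R]_n) : measurable A ->
  (forall x, lebesgue_measure [set t : R | A (x + t *: delta_mx ord0 i)] = 0) ->
  lebesgue_rV R n A = 0.
Proof.
elim: n i A => [[]//|n ih] i A mA A0.
have mcA : measurable (@cons_rV R n @^-1` A).
  by rewrite -[X in measurable X]setTI; exact: measurable_cons_rV.
rewrite lebesgue_rVS; case: (unliftP ord0 i) A0 => [j|] -> A0.
  rewrite /product_measure1; apply: integral0_eq => a _ /=.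
  have -> : xsection (@cons_rV R n @^-1` A) a = [set y | A (cons_rV (a, y))].
    by apply/seteqP; split => y; rewrite /xsection/= inE.
  apply: (ih j).
    have := measurable_xsection a mcA.
    congr measurable; by apply/seteqP; split => y; rewrite /xsection/= inE.
  by move=> y; rewrite -[RHS](A0 (cons_rV (a, y))); congr lebesgue_measure;
    apply/seteqP; split => t /=; rewrite cons_rVDS.
rewrite (@product_measure_unique _ _ _ _ _ (@lebesgue_measure R) (lebesgue_rV R n)
  (@lebesgue_measure R \x^ lebesgue_rV R n)%E)//; last first.
  by move=> B C mB mC; exact: product_measure2E.
rewrite /= /product_measure2; apply: integral0_eq => y _ /=.
rewrite -[RHS](A0 (cons_rV (0, y))); congr lebesgue_measure.
by apply/seteqP; split => t /=; rewrite /ysection/= inE/= cons_rVD0 add0r.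
Qed.

End euclidean_measurability.

(** * Directional derivatives and the Euclidean norm *)

Section derivative_estimates.
Context (R : realType) (V : normedModType R).
Implicit Types (f : V -> R) (x v : V).

(** First-order expansions with explicit error, the form in which convexity
   yields and uses directional derivatives. *)
Lemma is_derive_epsP f x v (l : R) : is_derive x v f l <->
  (forall e : R, 0 < e -> exists2 r : R, 0 < r &
     forall t : R, `|t| < r -> `|f (x + t *: v) - f x - t * l| <= e * `|t|).
Proof.
pose q (t : R) : R := t^-1 *: ((f \o shift x) (t *: v) - f x).
have qE t : t != 0 -> f (x + t *: v) - f x - t * l = t * (q t - l).
  move=> t0; rewrite /q/= /GRing.scale/= mulrBr mulrA divff// mul1r.
  by rewrite [t *: v + x]addrC.
split=> [[cf dl]|h].
  have {}cf : q t @[t --> 0^'] --> l by rewrite -dl; exact: cf.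
  move=> e e0; have /cvgrPdist_le/(_ _ e0) := cf.
  move=> /nbhs_ballP[r /= r0 hr]; exists r => // t tr.
  have [->|t0] := eqVneq t 0.
    by rewrite scale0r addr0 mul0r !subrr normr0 mulr0.
  have := hr t; rewrite -ball_normE/= sub0r normrN => /(_ tr t0) {}hr.
  by rewrite qE// normrM mulrC ler_wpM2r// distrC.
have cf : q t @[t --> 0^'] --> l.
  apply/cvgrPdist_le => e e0; have [r r0 hr] := h e e0.
  apply/nbhs_ballP; exists r => //= t; rewrite -ball_normE/= sub0r normrN => tr t0.
  have := hr t tr; rewrite qE// normrM mulrC ler_pM2r ?normr_gt0//.
  by rewrite distrC.
have df : derivable f x v by apply/cvg_ex; exists l.
by split=> //; exact: cvg_lim.
Qed.

End derivative_estimates.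

Section directional_derivatives.
Context (R : realType) (V : normedModType R).
Implicit Types (f : V -> R) (x v : V).

Lemma is_derive_lineP f x v (l : R) :
  is_derive x v f l <-> is_derive 0 (1 : R) (fun t : R => f (x + t *: v)) l.
Proof.
split=> /is_derive_epsP D; apply/is_derive_epsP => e e0; have [r r0 hr] := D e e0;
  exists r => // t tr; have := hr t tr;
  by rewrite add0r scale0r addr0 [t *: 1]mulr1.
Qed.

Lemma is_derive_chain f (F : R -> R) x v (df dF : R) :
  is_derive x v f df -> is_derive (f x) (1 : R) F dF ->
  is_derive x v (fun y => F (f y)) (dF * df).
Proof.
move=> /is_derive_lineP dfx dFx; apply/is_derive_lineP.
apply: (@is_derive1_comp _ F (fun t : R => f (x + t *: v))) => //.
by rewrite scale0r addr0.
Qed.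

End directional_derivatives.

Section euclidean_structure.
Context (R : realType).
Implicit Types n : nat.

Lemma dotpC n (u v : 'rV[R]_n) : dotp u v = dotp v u.
Proof. by apply: eq_bigr => i _; rewrite mulrC. Qed.

Lemma dotpDl n (u v w : 'rV[R]_n) : dotp (u + v) w = dotp u w + dotp v w.
Proof. by rewrite -big_split; apply: eq_bigr => i _; rewrite mxE mulrDl. Qed.

Lemma dotpDr n (u v w : 'rV[R]_n) : dotp u (v + w) = dotp u v + dotp u w.
Proof. by rewrite dotpC dotpDl ![dotp _ u]dotpC. Qed.

Lemma dotpZl n (a : R) (u v : 'rV[R]_n) : dotp (a *: u) v = a * dotp u v.
Proof. by rewrite /dotp mulr_sumr; apply: eq_bigr => i _; rewrite mxE mulrA. Qed.

Lemma dotpZr n (a : R) (u v : 'rV[R]_n) : dotp u (a *: v) = a * dotp u v.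
Proof. by rewrite dotpC dotpZl dotpC. Qed.

Lemma dotpNl n (u v : 'rV[R]_n) : dotp (- u) v = - dotp u v.
Proof. by rewrite -scaleN1r dotpZl mulN1r. Qed.

Lemma dotpNr n (u v : 'rV[R]_n) : dotp u (- v) = - dotp u v.
Proof. by rewrite dotpC dotpNl dotpC. Qed.

Lemma dotp_ge0 n (u : 'rV[R]_n) : 0 <= dotp u u.
Proof. by apply: sumr_ge0 => i _; rewrite -expr2 sqr_ge0. Qed.

Lemma dotp_delta n (i : 'I_n) (u : 'rV[R]_n) : dotp (delta_mx ord0 i) u = u ord0 i.
Proof.
rewrite /dotp (bigD1 i)//= mxE !eqxx mul1r big1 ?addr0// => j ji.
by rewrite mxE (negbTE ji) mul0r.
Qed.

Lemma coord_sq_le_dotp n (i : 'I_n) (u : 'rV[R]_n) : u ord0 i ^+ 2 <= dotp u u.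
Proof.
rewrite /dotp (bigD1 i)//= -expr2 lerDl; apply: sumr_ge0 => j _.
by rewrite -expr2 sqr_ge0.
Qed.

Lemma dotp_eq0 n (u : 'rV[R]_n) : dotp u u = 0 -> u = 0.
Proof.
move=> u0; apply/rowP => i; have := coord_sq_le_dotp i u.
by rewrite u0 mxE => h; apply/eqP; rewrite -sqrf_eq0 eq_le h sqr_ge0.
Qed.

Lemma enorm_ge0 n (u : 'rV[R]_n) : 0 <= enorm u.
Proof. exact: sqrtr_ge0. Qed.

Lemma enorm_sqr n (u : 'rV[R]_n) : enorm u ^+ 2 = dotp u u.
Proof. by rewrite sqr_sqrtr// dotp_ge0. Qed.

Lemma enormN n (u : 'rV[R]_n) : enorm (- u) = enorm u.
Proof. by rewrite /enorm dotpNl dotpNr opprK. Qed.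

Lemma norm_le_enorm n (u : 'rV[R]_n) : `|u| <= enorm u.
Proof.
apply: rV_norm_le => [|i]; first exact: enorm_ge0.
rewrite -[leRHS]ger0_norm ?enorm_ge0// -sqrtr_sqr -[leRHS]sqrtr_sqr.
by apply: ler_wsqrtr; rewrite enorm_sqr coord_sq_le_dotp.
Qed.

Lemma cauchy_schwarz n (u v : 'rV[R]_n) : `|dotp u v| <= enorm u * enorm v.
Proof.
have [v0|v0] := eqVneq (dotp v v) 0.
  have -> : v = 0 by exact: dotp_eq0.
  by rewrite -(scale0r 0) dotpZr mul0r normr0 mulr_ge0// enorm_ge0.
have vp : 0 < dotp v v by rewrite lt0r v0 dotp_ge0.
have h := dotp_ge0 (dotp v v *: u - dotp u v *: v).
have {h} : dotp u v ^+ 2 <= dotp u u * dotp v v.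
  move: h; rewrite dotpDl !dotpDr !dotpNl !dotpNr !dotpZl !dotpZr (dotpC v u) => h.
  have : 0 <= dotp v v * (dotp u u * dotp v v - dotp u v ^+ 2).
    by apply: (le_trans h); rewrite le_eqVlt; apply/orP; left; apply/eqP; ring.
  by rewrite pmulr_rge0// subr_ge0.
rewrite -!enorm_sqr -exprMn => /ler_wsqrtr.
by rewrite !sqrtr_sqr [X in _ <= X]ger0_norm// mulr_ge0// enorm_ge0.
Qed.

Lemma enorm_triangle n (u v : 'rV[R]_n) : enorm (u + v) <= enorm u + enorm v.
Proof.
have h : enorm (u + v) ^+ 2 <= (enorm u + enorm v) ^+ 2.
  rewrite enorm_sqr dotpDl !dotpDr (dotpC v u) -!enorm_sqr.
  have := le_trans (ler_norm _) (cauchy_schwarz u v); clear; lra.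
by move: h; rewrite ler_pXn2r// nnegrE ?addr_ge0 ?enorm_ge0.
Qed.

Lemma enorm_le_norm n (u : 'rV[R]_n) : enorm u <= n%:R * `|u|.
Proof.
have h : enorm u ^+ 2 <= (n%:R * `|u|) ^+ 2.
  rewrite enorm_sqr exprMn.
  apply: (@le_trans _ _ (\sum_(i < n) `|u| ^+ 2)).
    apply: ler_sum => i _; rewrite -expr2 -real_normK ?num_real//.
    by rewrite lerXn2r ?nnegrE// rV_coord_le_norm.
  rewrite sumr_const card_ord -[leLHS]mulr_natl ler_wpM2r ?sqr_ge0//.
  by rewrite -natrX ler_nat; case: n u => // n _; rewrite expnS expn1 leq_pmull.
by move: h; rewrite ler_pXn2r// nnegrE ?mulr_ge0 ?enorm_ge0.
Qed.

Lemma continuous_enorm n : continuous (@enorm R n).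
Proof.
move=> x; suff : enorm y @[y --> x] --> enorm x by [].
apply/(@cvgrPdist_le _ _ _ _ (nbhs_filter x)) => e e0.
have ne0 : 0 < e / n.+1%:R by rewrite divr_gt0.
apply/nbhs_ballP; exists (e / n.+1%:R) => //= y; rewrite -ball_normE => /ltW xy.
have exy : enorm (x - y) <= e.
  apply: (le_trans (enorm_le_norm _)); apply: (@le_trans _ _ (n.+1%:R * (e / n.+1%:R))).
    by apply: ler_pM => //; rewrite ler_nat.
  by rewrite mulrCA divff ?mulr1.
rewrite ler_norml; apply/andP; split.
  have := enorm_triangle (y - x) x; rewrite subrK -[enorm (y - x)]enormN opprB => h.
  by move: h exy; clear; lra.
have := enorm_triangle (x - y) y; rewrite subrK => h.
by move: h exy; clear; lra.
Qed.

End euclidean_structure.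

(** * Semiconcavity of the squared distance *)

Section monotone_jumps.
Context (R : realType).

(** A rational number can be inserted in each jump of a nondecreasing
   function, and jumps at distinct points are disjoint. *)
Lemma countable_jumps (M : R -> R) : {homo M : s t / s <= t} ->
  countable [set t | exists2 c : R, 0 < c &
    forall n, c <= M (t + n.+1%:R^-1) - M (t - n.+1%:R^-1)].
Proof.
move=> ndM; set B := [set t | _].
pose P (t : R) (q : rat) := forall s, (s < t -> M s < ratr q) /\ (t < s -> ratr q < M s).
have exq t : B t -> exists q, P t q.
  move=> [c c0 ht]; pose S := [set M s | s in [set s | s < t]].
  have S0 : S !=set0 by exists (M (t - 1)), (t - 1) => //=; rewrite gtrBl.
  have ubS : has_ubound S by exists (M t) => _ [s st <-]; exact/ndM/ltW.
  have gap s : t < s -> sup S + c <= M s.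
    move=> ts; rewrite -lerBrDr; apply: ge_sup => // _ [s' /= s't <-].
    rewrite lerBrDr.
    have st' : 0 < s - t by rewrite subr_gt0.
    have ts' : 0 < t - s' by rewrite subr_gt0.
    have [n1 h1] := natSinv_lt st'; have [n2 h2] := natSinv_lt ts'.
    have := ht (maxn n1 n2).
    have := h1 (maxn n1 n2) (leq_maxl _ _).
    have := h2 (maxn n1 n2) (leq_maxr _ _).
    set u := _^-1 => us' us h.
    have : M (t + u) <= M s by apply: ndM; lra.
    have : M s' <= M (t - u) by apply: ndM; lra.
    by move: h; clear; lra.
  have /rat_in_itvoo[q] : sup S < sup S + c by rewrite ltrDl.
  rewrite in_itv/= => /andP[q1 q2]; exists q => s; split => st.
    by apply: le_lt_trans q1; apply: ub_le_sup => //; exists s.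
  by apply: lt_le_trans q2 _; exact: gap.
apply/countable_injP.
exists (fun t => pickle (xget 0%R [set q : rat | P t q])) => s t.
rewrite !inE => Bs Bt /(pcan_inj pickleK).
have := xgetPex 0%R (exq s Bs); have := xgetPex 0%R (exq t Bt).
set qt := xget _ _; set qs := xget _ _ => /= hs ht qst.
have key (x y : R) (q : rat) : P x q -> P y q -> x < y -> False.
  move=> Px Py xy; have [_ h1] := Px ((x + y) / 2); have [h2 _] := Py ((x + y) / 2).
  have {}h1 : ratr q < M ((x + y) / 2) by apply: h1; rewrite midf_lt.
  have {}h2 : M ((x + y) / 2) < ratr q by apply: h2; rewrite midf_lt.
  by have := lt_trans h1 h2; rewrite ltxx.
rewrite qst in ht.
case: (ltgtP s t) => // st; exfalso.
- exact: key ht hs st.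
- exact: key hs ht st.
Qed.

End monotone_jumps.

Lemma continuous_subl (R : realType) (V : normedModType R) (x : V) :
  continuous (fun y => x - y).
Proof. by move=> y; apply: continuousB; [exact: cst_continuous|exact: cvg_id]. Qed.

Lemma continuous_addr (R : realType) (V : normedModType R) (v : V) :
  continuous (fun y => y + v).
Proof. by move=> y; apply: continuousD; [exact: cvg_id|exact: cst_continuous]. Qed.

Section distance_function.
Context (R : realType) (n : nat) (K : set 'rV[R]_n).
Hypothesis (K0 : K !=set0) (cK : closed K).
Implicit Types (x y v : 'rV[R]_n) (i : 'I_n).

Local Notation d := (dist_to K).

Lemma dist_to_le x y : K y -> d x <= enorm (x - y).
Proof.
move=> Ky; apply: ge_inf; last by exists y.
by exists 0 => _ [z _ <-]; exact: enorm_ge0.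
Qed.

Lemma dist_to_attained x : exists2 y, K y & d x = enorm (x - y).
Proof.
have [z Kz] := K0.
pose A := K `&` [set y | `|x - y| <= enorm (x - z)].
have cts : continuous (fun y => enorm (x - y)).
  move=> y; apply: (@continuous_comp _ _ _ (fun y => x - y)); last exact: continuous_enorm.
  exact: continuous_subl.
have Az : A z by split => //; exact: norm_le_enorm.
have cA : compact A.
  apply: bounded_closed_compact.
    exists (`|x| + enorm (x - z)); split; first exact: num_real.
    move=> M hM y [_ /= xy]; apply: le_trans (ltW hM).
    have := ler_normB x (x - y); rewrite subKr => /le_trans; apply.
    by rewrite lerD2l.
  apply: closedI => //.
  apply: (@preimage_closed _ _ (fun y => `|x - y|) [set r | r <= enorm (x - z)]).
    move=> y _; apply: (@continuous_comp _ _ _ (fun y => x - y) Num.norm).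
      exact: continuous_subl.
    exact: norm_continuous.
  exact: closed_le.
have [c cA' hc] := EVT_min_rV (ex_intro _ z Az) cA (continuous_subspaceT cts).
move: cA'; rewrite inE => -[Kc xc]; exists c => //.
apply/eqP; rewrite eq_le dist_to_le//=; apply: lb_le_inf.
  by exists (enorm (x - z)), z.
move=> _ [y Ky <-]; have [yA|yA] := pselect (A y).
  by apply: hc; rewrite inE.
apply: (@le_trans _ _ (enorm (x - z))); first by apply: hc; rewrite inE.
rewrite leNgt; apply/negP => h; apply: yA; split => //=.
exact: le_trans (norm_le_enorm _) (ltW h).
Qed.

Definition nearest x : 'rV[R]_n := sval (cid2 (dist_to_attained x)).

Lemma nearestP x : K (nearest x) /\ d x = enorm (x - nearest x).
Proof. by rewrite /nearest; case: cid2. Qed.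

(** Where $d^2$ is differentiable this is $d \nabla d$. *)
Definition offset x : 'rV[R]_n := x - nearest x.

Lemma dist_to_offset x : dotp (offset x) (offset x) = d x ^+ 2.
Proof. by rewrite (nearestP x).2 enorm_sqr. Qed.

Lemma dist_to_ge0 x : 0 <= d x.
Proof. by rewrite (nearestP x).2 enorm_ge0. Qed.

Lemma dist_to_gt0 x : ~ K x -> 0 < d x.
Proof.
move=> Kx; rewrite lt0r dist_to_ge0 andbT; apply/eqP => dx0; apply: Kx.
have : offset x = 0 by apply: dotp_eq0; rewrite dist_to_offset dx0 expr0n.
by rewrite /offset => /subr0_eq ->; exact: (nearestP x).1.
Qed.

Lemma dist_to_mem x : K x -> d x = 0.
Proof.
move=> Kx; apply/eqP; rewrite eq_le dist_to_ge0 andbT.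
rewrite (le_trans (dist_to_le x Kx))// subrr -(scale0r 0).
by rewrite /enorm dotpZl mul0r sqrtr0.
Qed.

Lemma dist_to_lip x y : d x <= d y + enorm (x - y).
Proof.
apply: (le_trans (dist_to_le x (nearestP y).1)).
rewrite (nearestP y).2 [leRHS]addrC; apply: le_trans (enorm_triangle _ _).
by rewrite addrA subrK.
Qed.

Lemma continuous_dist_to : continuous d.
Proof.
move=> x; suff : d y @[y --> x] --> d x by [].
apply/(@cvgrPdist_le _ _ _ _ (nbhs_filter x)) => e e0.
have : enorm (x - y) @[y --> x] --> enorm (x - x).
  have cts : continuous (fun y => enorm (x - y)).
    move=> y; apply: (@continuous_comp _ _ _ (fun y => x - y)); last exact: continuous_enorm.
    exact: continuous_subl.
  exact: cts.
move=> /(@cvgrPdist_le _ _ _ _ (nbhs_filter x)) /(_ e e0).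
have -> : enorm (x - x) = 0.
  by rewrite subrr -(scale0r 0) /enorm dotpZl mul0r sqrtr0.
apply: filterS => y; rewrite sub0r normrN ger0_norm ?enorm_ge0// => xy.
have h1 := dist_to_lip x y; have := dist_to_lip y x.
rewrite -[enorm (y - x)]enormN opprB => h2.
by rewrite ler_norml; move: xy h1 h2; clear; lra.
Qed.

(** Comparing with the point nearest to $x$ shows that $|x|^2 - d(x)^2$ has
   the subgradient $2 y_0$ at $x$; this function is therefore convex. *)
Lemma dist_to_supergradient x v :
  d (x + v) ^+ 2 <= d x ^+ 2 + 2 * dotp v (offset x) + dotp v v.
Proof.
have := dist_to_le (x + v) (nearestP x).1.
rewrite -ler_sqr ?nnegrE ?dist_to_ge0 ?enorm_ge0// => /le_trans; apply.
have -> : x + v - nearest x = offset x + v by rewrite /offset addrAC.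
rewrite enorm_sqr (dotpDl (offset x) v) (dotpDr (offset x)) (dotpDr v).
by rewrite dist_to_offset (dotpC (offset x)); clear; lra.
Qed.

Local Notation e_ i := (delta_mx ord0 i : 'rV[R]_n).

Lemma dist_to_supergradient1 x i (t : R) :
  d (x + t *: e_ i) ^+ 2 <= d x ^+ 2 + 2 * t * offset x ord0 i + t ^+ 2.
Proof.
apply: (le_trans (dist_to_supergradient x (t *: e_ i))).
have ei : (e_ i) ord0 i = 1 by rewrite mxE !eqxx.
by rewrite !dotpZl dotpZr !dotp_delta ei mulr1 mulrA expr2.
Qed.

(** Second differences of the convex function $|x|^2 - d(x)^2$ in direction
   $i$, divided by the increment; they decrease to the jump at $x$ of the
   derivative in that direction. *)
Definition jump i k x : R := k.+1%:R * (2 * d x ^+ 2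
  - d (x + k.+1%:R^-1 *: e_ i) ^+ 2 - d (x - k.+1%:R^-1 *: e_ i) ^+ 2)
  + 2 * k.+1%:R^-1.

(** The points where $d^2$ has different one-sided derivatives in
   direction $i$. *)
Definition ridge i : set 'rV[R]_n :=
  [set x | exists j, forall k, j.+1%:R^-1 <= jump i k x].

Lemma continuous_sqr_dist_to : continuous (fun x => d x ^+ 2).
Proof.
by move=> x; apply: (@continuous_comp _ _ _ d (fun t : R => t ^+ 2));
  [exact: continuous_dist_to|exact: exprn_continuous].
Qed.

Lemma continuous_sqr_dist_to_shift v : continuous (fun x => d (x + v) ^+ 2).
Proof.
move=> x; apply: (@continuous_comp _ _ _ (fun x => x + v) (fun y => d y ^+ 2)).
  exact: continuous_addr.
exact: continuous_sqr_dist_to.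
Qed.

Lemma continuous_jump i k : continuous (jump i k).
Proof.
move=> x.
have h0 : d y ^+ 2 @[y --> x] --> d x ^+ 2 by exact: continuous_sqr_dist_to.
have h v : d (y + v) ^+ 2 @[y --> x] --> d (x + v) ^+ 2.
  exact: continuous_sqr_dist_to_shift.
exact: (cvgD (cvgM (cvg_cst _) (cvgB (cvgB (cvgM (cvg_cst _) h0) (h _)) (h _)))
  (cvg_cst _)).
Qed.

Lemma measurable_ridge i : measurable (ridge i).
Proof.
rewrite (_ : ridge i = \bigcup_j \bigcap_k [set x | j.+1%:R^-1 <= jump i k x]).
  apply: bigcupT_measurable => j; apply: bigcapT_measurable => k.
  apply: closed_measurable_rV.
  apply: (@preimage_closed _ _ (jump i k) [set r | j.+1%:R^-1 <= r]).
    by move=> x _; exact: continuous_jump.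
  exact: closed_ge.
by apply/seteqP; split => [x [j h]|x [j _ h]]; exists j => // k; first move=> _; exact: h.
Qed.

(** On a line in direction $i$ the coordinate $i$ of the nearest point is a
   subgradient of a convex function, hence nondecreasing; it jumps at the
   points of the ridge, which are therefore countable. *)
Lemma ridge_null i : lebesgue_rV R n (ridge i) = 0.
Proof.
have second_difference (dt dp dm xi t u mp mm : R) :
    dt <= dp + 2 * (t - (t + u)) * (xi + (t + u) - mp / 2) + (t - (t + u)) ^+ 2 ->
    dt <= dm + 2 * (t - (t - u)) * (xi + (t - u) - mm / 2) + (t - (t - u)) ^+ 2 ->
    2 * dt - dp - dm + u * (2 * u) <= u * (mp - mm).
  by clear; lra.
have slopes_mono (dt ds xi s t ms mt : R) :
    ds <= dt + 2 * (s - t) * (xi + t - mt / 2) + (s - t) ^+ 2 ->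
    dt <= ds + 2 * (t - s) * (xi + s - ms / 2) + (t - s) ^+ 2 ->
    0 <= (mt - ms) * (t - s).
  by clear; nra.
apply: (@null_of_null_slices _ _ i); first exact: measurable_ridge.
move=> x; apply: countable_lebesgue_measure0.
pose y (t : R) := x + t *: e_ i.
pose M (t : R) := 2 * (nearest (y t)) ord0 i.
have yD s t : y s + t *: e_ i = y (s + t) by rewrite /y -addrA -scalerDl.
have off t : offset (y t) ord0 i = x ord0 i + t - M t / 2.
  rewrite /offset /M /y !mxE !eqxx mulr1 -[in RHS]/(y t).
  by congr (_ - _); rewrite mulrC mulKf.
have grad s t : d (y t) ^+ 2 <= d (y s) ^+ 2
    + 2 * (t - s) * (x ord0 i + s - M s / 2) + (t - s) ^+ 2.
  have := dist_to_supergradient1 (y s) i (t - s).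
  by rewrite yD off [s + _]addrC subrK.
apply: (sub_countable (@subset_card_le _ _ _ _) (countable_jumps (M := M) _)).
  move=> t /= [j hj]; exists j.+1%:R^-1; first by rewrite invr_gt0.
  move=> k; apply: (le_trans (hj k)); rewrite /jump -/(y t).
  set u := k.+1%:R^-1.
  have em : y t - u *: e_ i = y (t - u) by rewrite -scaleNr yD.
  rewrite yD em.
  have u0 : 0 < u by rewrite invr_gt0.
  have -> : k.+1%:R = u^-1 by rewrite invrK.
  have h1 := grad (t + u) t; have h2 := grad (t - u) t.
  rewrite -(ler_pM2l u0) mulrDr mulrA divff ?gt_eqF// mul1r.
  exact: (second_difference _ _ _ _ _ _ _ _ h1 h2).
move=> s t; rewrite le_eqVlt => /predU1P[->//|st].
have := slopes_mono _ _ _ _ _ _ _ (grad t s) (grad s t).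
by rewrite pmulr_lge0 ?subr_gt0// subr_ge0.
Qed.

End distance_function.

(** * The gradient of the distance *)

Section distance_gradient.
Context (R : realType) (n : nat) (K : set 'rV[R]_n).
Hypothesis (K0 : K !=set0) (cK : closed K).
Implicit Types (x y v : 'rV[R]_n) (i : 'I_n).

Local Notation d := (dist_to K).
Local Notation offset := (offset K0 cK).
Local Notation ridge := (ridge K).
Local Notation jump := (jump K).
Local Notation e_ i := (delta_mx ord0 i : 'rV[R]_n).

(** Convexity of $|x|^2 - d(x)^2$ bounds its increments, and hence those of
   $d^2$, by the second differences at a larger scale. *)
Lemma jump_bounds_slope x i k (t : R) : `|t| <= k.+1%:R^-1 ->
  t ^+ 2 - `|t| * jump i k x
    <= d (x + t *: e_ i) ^+ 2 - d x ^+ 2 - t * (2 * offset x ord0 i) <= t ^+ 2.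
Proof.
have alg (tau r V W dx dz dp dm du v : R) : 0 <= tau ->
    (v = r /\ du = dp) \/ (v = - r /\ du = dm) ->
    (1 - tau) * dx <= (1 - tau) * (dz + 2 * - (tau * v) * W + (- (tau * v)) ^+ 2) ->
    tau * du <= tau * (dz + 2 * (v - tau * v) * W + (v - tau * v) ^+ 2) ->
    dp <= dx + 2 * r * V + r ^+ 2 -> dm <= dx + 2 * - r * V + (- r) ^+ 2 ->
    (tau * v) ^+ 2 - tau * (2 * dx - dp - dm + 2 * r ^+ 2)
      <= dz - dx - tau * v * (2 * V).
  clear=> tau0 uE h3 h4 ks kms.
  have kp := ler_wpM2l tau0 ks; have km := ler_wpM2l tau0 kms.
  by case: uE h3 h4 => -[-> ->] h3 h4; lra.
move=> ts; apply/andP; split; last first.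
  by have := dist_to_supergradient1 K0 cK x i t; clear; lra.
rewrite /jump; move: ts; have : 0 < k.+1%:R^-1 :> R by rewrite invr_gt0.
have -> : k.+1%:R = (k.+1%:R^-1)^-1 :> R by rewrite invrK.
set s := k.+1%:R^-1; rewrite invrK => s0 ts.
have -> : x - s *: e_ i = x + (- s) *: e_ i by rewrite scaleNr.
have [u uE tE] : exists2 u, u = s \/ u = - s & t = `|t| / s * u.
  have [t0|t0] := leP 0 t.
    by exists s; [left|rewrite ger0_norm// divfK// gt_eqF].
  by exists (- s); [right|rewrite ltr0_norm// mulrN divfK ?gt_eqF// opprK].
(* z is the point x + t e_i, at the fraction tau of the way from x to x + u e_i;
   its supergradient is evaluated at both ends. *)
pose tau := `|t| / s.
have tau0 : 0 <= tau by rewrite divr_ge0// ltW.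
have tau1 : 0 <= 1 - tau by rewrite subr_ge0 ler_pdivrMr// mul1r.
set z := x + t *: e_ i; pose W := offset z ord0 i.
have h1 := dist_to_supergradient1 K0 cK z i (- t).
have h2 := dist_to_supergradient1 K0 cK z i (u - t).
have z1 : z + (- t) *: e_ i = x by rewrite /z scaleNr addrK.
have z2 : z + (u - t) *: e_ i = x + u *: e_ i.
  by rewrite /z -addrA -scalerDl [t + _]addrC subrK.
rewrite z1 in h1; rewrite z2 in h2.
have h3 := ler_wpM2l tau1 h1; have h4 := ler_wpM2l tau0 h2.
have ks := dist_to_supergradient1 K0 cK x i s.
have kms := dist_to_supergradient1 K0 cK x i (- s).
have ts' : `|t| = tau * s by rewrite /tau divfK// gt_eqF.
have {}tE : t = tau * u by rewrite tE.
have {}uE : (u = s /\ d (x + u *: e_ i) ^+ 2 = d (x + s *: e_ i) ^+ 2) \/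
    (u = - s /\ d (x + u *: e_ i) ^+ 2 = d (x + (- s) *: e_ i) ^+ 2).
  by case: uE => ->; [left|right].
have sV : s * s^-1 = 1 by rewrite divff// gt_eqF.
have jE (y : R) : `|t| * (s^-1 * y + 2 * s) = tau * (y + 2 * s ^+ 2).
  by rewrite ts' mulrDr mulrA -[tau * s * s^-1]mulrA sV mulr1; ring.
rewrite jE tE; rewrite tE in h3 h4.
exact: (alg _ _ _ _ _ _ _ _ _ _ tau0 uE h3 h4 ks kms).
Qed.

Lemma is_derive_sqr_dist_to x i : ~ ridge i x ->
  is_derive x (e_ i) (fun y => d y ^+ 2) (2 * offset x ord0 i).
Proof.
move=> xr; apply/is_derive_epsP => e e0.
have [j0 hj] := natSinv_lt e0; have {hj}je := hj j0 (leqnn _).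
have [k hk] : exists k, jump i k x < j0.+1%:R^-1.
  apply: contrapT => h; apply: xr; exists j0 => k.
  by rewrite leNgt; apply/negP => hk; apply: h; exists k.
have k0 : 0 < k.+1%:R^-1 :> R by rewrite invr_gt0.
exists (Num.min k.+1%:R^-1 e); first by rewrite lt_min k0 e0.
move=> t; rewrite lt_min => /andP[tk te].
have /andP[h1 h2] := jump_bounds_slope x i (ltW tk).
have h3 : t ^+ 2 <= e * `|t|.
  by rewrite -real_normK ?num_real// expr2 ler_wpM2r// ltW.
have h4 : `|t| * jump i k x <= e * `|t|.
  by rewrite mulrC ler_wpM2r// ltW// (lt_trans hk).
rewrite ler_norml; move: h1 h2 h3 h4; have := sqr_ge0 t; clear; lra.
Qed.

(** On a ridge the derivative of $d$ thus takes its default value. *)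
Lemma ridge_not_derivable x i : ridge i x -> ~ derivable d x (e_ i).
Proof.
have alg (jj s l dx dp dm : R) : 0 < s * jj -> s * s < s * (jj / 4) ->
    - (jj / 4 * s) <= dm - dx - - s * l -> - (jj / 4 * s) <= dp - dx - s * l ->
    2 * dx - dp - dm + s * (2 * s) < s * jj by clear; lra.
move=> [j hj] dd.
pose l := d x *: 'D_(e_ i) d x + d x *: 'D_(e_ i) d x.
have dd2 : is_derive x (e_ i) (d * d) l.
  by apply: is_deriveM; exact/derivableP.
have e0 : 0 < j.+1%:R^-1 / 4 :> R by rewrite divr_gt0// invr_gt0.
have [r r0 hr] := (is_derive_epsP _ _ _ _).1 dd2 _ e0.
have m0 : 0 < Num.min r (j.+1%:R^-1 / 4) by rewrite lt_min r0 e0.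
have [k0 /(_ k0 (leqnn _))] := natSinv_lt m0.
rewrite lt_min => /andP[k0r k0j]; have := hj k0; rewrite /jump.
have : 0 < k0.+1%:R^-1 :> R by rewrite invr_gt0.
have -> : k0.+1%:R = (k0.+1%:R^-1)^-1 :> R by rewrite invrK.
move: k0r k0j; set s := k0.+1%:R^-1; rewrite invrK => sr sj s0.
have -> : x - s *: e_ i = x + (- s) *: e_ i by rewrite scaleNr.
have := hr s; have := hr (- s); rewrite normrN (gtr0_norm s0).
move=> /(_ sr); rewrite ler_norml => /andP[h1 _].
move=> /(_ sr); rewrite ler_norml => /andP[h2 _].
apply/negP; rewrite -ltNge -(ltr_pM2l s0) mulrDr mulrA divff ?gt_eqF// mul1r.
have sqE z : (d * d) z = d z ^+ 2 by [].
rewrite !sqE in h1 h2.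
have ss : s * s < s * (j.+1%:R^-1 / 4) by rewrite ltr_pM2l.
have sj0 : 0 < s * j.+1%:R^-1 by rewrite mulr_gt0// invr_gt0.
exact: (alg _ _ _ _ _ _ sj0 ss h1 h2).
Qed.

Lemma is_derive_dist_to x i : ~ K x -> ~ ridge i x ->
  is_derive x (e_ i) d (offset x ord0 i / d x).
Proof.
move=> Kx xr; have d0 := dist_to_gt0 K0 cK Kx.
have -> : d = (fun y => Num.sqrt (d y ^+ 2)).
  by apply/funext => y; rewrite sqrtr_sqr ger0_norm// dist_to_ge0.
have d20 : 0 < d x ^+ 2 by rewrite exprn_gt0.
have := is_derive_chain (is_derive_sqr_dist_to xr) (is_derive1_sqrt d20).
move=> D; apply: (is_derive_eq D); rewrite sqrtr_sqr (gtr0_norm d0).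
by field; rewrite gt_eqF.
Qed.

(** Almost everywhere equal to $d \nabla d = \nabla (d^2/2)$; on a ridge a
   coordinate vanishes, as does the default value of the derivative. *)
Definition dist_field x : 'rV[R]_n :=
  \row_i (if x \in ridge i then 0 else offset x ord0 i).

Lemma pderiv_dist_to x i : ~ K x -> pderiv i d x = dist_field x ord0 i / d x.
Proof.
move=> Kx; rewrite mxE; case: ifPn => [|]; rewrite ?inE ?notin_setE => xr.
  by rewrite mul0r; apply: dvgP; exact: ridge_not_derivable xr.
by have [] := is_derive_dist_to Kx xr.
Qed.

(** The product rule, which holds on the ridges as well: there both sides
   lose the contribution of the coordinate concerned. *)
Lemma dotp_grad_dist_to x (phi : 'rV[R]_n -> R) : ~ K x -> differentiable phi x ->
  dotp (grad d x) (grad (fun y => d y * phi y) x) =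
  dotp (dist_field x) (grad phi x)
  + phi x * (dotp (dist_field x) (dist_field x) / d x ^+ 2).
Proof.
move=> Kx dphi; have d0 := dist_to_gt0 K0 cK Kx.
rewrite /dotp mulr_suml mulr_sumr -big_split/=; apply: eq_bigr => i _.
rewrite [grad d x _ _]mxE pderiv_dist_to//.
case: (pselect (ridge i x)) => xr.
  by rewrite [dist_field x _ _]mxE mem_set// !mul0r mulr0 addr0.
rewrite ![grad _ x _ _]mxE {1}/pderiv.
have [dd ddE] := is_derive_dist_to Kx xr.
rewrite [X in 'D__ X x](_ : _ = d * phi)// (deriveM dd (@diff_derivable _ _ _ _ _ _ dphi)) ddE.
rewrite /GRing.scale/= [dist_field x _ _]mxE memNset//.
by rewrite -/(pderiv i phi x); field; rewrite gt_eqF.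
Qed.

Lemma measurable_dist_field i :
  measurable_fun setT (fun x => dist_field x ord0 i).
Proof.
pose f k x : R := \1_(~` ridge i) x *
  (2^-1 * (k.+1%:R * (d (x + k.+1%:R^-1 *: e_ i) ^+ 2 - d x ^+ 2))).
apply: (@measurable_fun_cvg _ _ _ setT f) => [k|x _].
  apply: measurable_funM.
    by apply: measurable_indic; apply: measurableC; exact: measurable_ridge.
  apply: measurable_funM; first exact: measurable_cst.
  apply: measurable_funM; first exact: measurable_cst.
  apply: measurable_funB; apply: continuous_measurable_rV.
    exact: continuous_sqr_dist_to_shift.
  exact: continuous_sqr_dist_to.
rewrite /f indicE mxE in_setC.
case: (pselect (ridge i x)) => xr.
  rewrite mem_set//=.
  by under eq_fun do rewrite mul0r; exact: cvg_cst.
rewrite memNset//=.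
under eq_fun do rewrite mul1r.
apply/cvgrPdist_le => e e0.
have [r r0 hr] := (is_derive_epsP _ _ _ _).1 (is_derive_sqr_dist_to xr) e e0.
have [N hN] := natSinv_lt r0; exists N => // k /hN kr.
have k0 : 0 < k.+1%:R^-1 :> R by rewrite invr_gt0.
have := hr k.+1%:R^-1; rewrite (gtr0_norm k0) => /(_ kr).
have -> : k.+1%:R = (k.+1%:R^-1)^-1 :> R by rewrite invrK.
move: k0; set s := k.+1%:R^-1; rewrite invrK => s0.
rewrite -/s => h; rewrite distrC.
have -> : 2^-1 * (s^-1 * (d (x + s *: e_ i) ^+ 2 - d x ^+ 2)) - offset x ord0 i =
  (2 * s)^-1 * (d (x + s *: e_ i) ^+ 2 - d x ^+ 2 - s * (2 * offset x ord0 i)).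
  by field; rewrite gt_eqF.
rewrite normrM gtr0_norm ?invr_gt0 ?mulr_gt0// ler_pdivrMl ?mulr_gt0//.
by apply: (le_trans h); have := mulr_gt0 e0 s0; lra.
Qed.

Definition ridges : set 'rV[R]_n := \big[setU/set0]_i ridge i.

Lemma measurable_ridges : measurable ridges.
Proof. by apply: bigsetU_measurable => i _; exact: measurable_ridge. Qed.

Lemma ridges_null : lebesgue_rV R n ridges = 0.
Proof.
apply/negligibleP; first exact: measurable_ridges.
rewrite /ridges; elim/big_ind : _ => [||i _].
- exact: negligible_set0.
- by move=> A B; exact: negligibleU.
- by apply/negligibleP; [exact: measurable_ridge|exact: ridge_null].
Qed.

Lemma dist_field_offset x : ~ ridges x -> dist_field x = offset x.
Proof.
move=> xr; apply/rowP => i; rewrite mxE memNset// => xi; apply: xr.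
by rewrite /ridges -bigcup_seq; exists i => //=; rewrite mem_index_enum.
Qed.

Lemma enorm_dist_field x : ~ ridges x -> enorm (dist_field x) = d x.
Proof.
move=> /dist_field_offset ->; rewrite /enorm dist_to_offset sqrtr_sqr.
by rewrite ger0_norm// dist_to_ge0.
Qed.

End distance_gradient.

(** * Closure properties of smooth functions *)

Lemma near_eq_differentiable (R : realType) (V W : normedModType R)
    (f g : V -> W) (x : V) :
  (\near x, f x = g x) -> differentiable f x -> differentiable g x.
Proof.
move=> fg /diff_locallyP[cdf /eqaddoP fo].
have fgx : f x = g x by exact: nbhs_singleton fg.
have go : g \o shift x = cst (g x) + 'd f x +o_ 0 id.
  apply/eqaddoP => e e0; have := fo e e0.
  have fg' : \forall h \near (0 : V), ((fun z => f z = g z) \o shift x) h.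
    by move: fg; rewrite (near_shift 0) subr0.
  apply: filterS2 fg' => h /= fgh.
  by rewrite !fctE/= fgh fgx.
have dg := diff_unique cdf go.
by apply/diff_locallyP; rewrite dg.
Qed.

Section smooth_functions.
Context (R : realType) (n : nat).
Implicit Types (f g : 'rV[R]_n -> R) (A : set 'rV[R]_n) (x : 'rV[R]_n).

(** Peels derivatives from the inside, so that closure properties are proved
   by induction on the order with the function generalized. *)
Fixpoint diff_upto A (k : nat) f : Prop :=
  (forall x, A x -> differentiable f x) /\
  (if k is k'.+1 then forall i, diff_upto A k' (pderiv i f) else True).

Definition smooth_on A f := forall k, diff_upto A k f.

Lemma diff_upto_differentiable A k f x : diff_upto A k f -> A x -> differentiable f x.
Proof. by case: k => [|k] [h _]; exact: h. Qed.

Lemma diff_uptoW A k f : diff_upto A k.+1 f -> diff_upto A k f.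
Proof.
elim: k f => [|k ih] f [df Df]; split => //.
by move=> i; apply: ih; exact: Df.
Qed.

Lemma smooth_on_pderiv A f i : smooth_on A f -> smooth_on A (pderiv i f).
Proof. by move=> sf k; have [_] := sf k.+1; exact. Qed.

Lemma smooth_onP A f : smooth_on A f <->
  (forall (l : seq 'I_n) x, A x -> differentiable (foldr (@pderiv R n R^o) f l) x).
Proof.
split=> [sf l|].
  elim/last_ind: l f sf => [|l i ih] f sf x Ax.
    exact: diff_upto_differentiable (sf 0%N) Ax.
  by rewrite foldr_rcons; apply: ih => //; exact: smooth_on_pderiv.
move=> sf k; elim: k f sf => [|k ih] f sf.
  by split => // x Ax; exact: (sf [::]).
split=> [x Ax|i]; first exact: (sf [::]).
by apply: ih => l x Ax; rewrite -(foldr_rcons _ _ l i); exact: sf.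
Qed.

Lemma smoothP f : smooth f <-> smooth_on setT f.
Proof.
split=> [sf|/smooth_onP sf l x]; last exact: sf.
by apply/smooth_onP => l x _; exact: sf.
Qed.

Lemma smooth_onS A B f : A `<=` B -> smooth_on B f -> smooth_on A f.
Proof. by move=> AB /smooth_onP sf; apply/smooth_onP => l x /AB; exact: sf. Qed.

Lemma smooth_onU A B f : smooth_on A f -> smooth_on B f -> smooth_on (A `|` B) f.
Proof.
move=> /smooth_onP sA /smooth_onP sB; apply/smooth_onP => l x [].
  exact: sA.
exact: sB.
Qed.

Lemma eq_diff_upto A k f g : open A -> (forall x, A x -> f x = g x) ->
  diff_upto A k f -> diff_upto A k g.
Proof.
move=> oA; have near_eq f' g' x : (forall x, A x -> f' x = g' x) -> A x ->
    \near x, f' x = g' x.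
  move=> fg Ax; apply: filterS (open_nbhs_nbhs (conj oA Ax)) => y; exact: fg.
have deq f' g' : (forall x, A x -> f' x = g' x) ->
    (forall x, A x -> differentiable f' x) -> forall x, A x -> differentiable g' x.
  by move=> fg df x Ax; apply: near_eq_differentiable (df x Ax); exact: near_eq.
elim: k f g => [|k ih] f g fg [df Df]; split => //; try exact: deq df.
move=> i; apply: ih (Df i) => x Ax; apply: near_eq_derive; exact: near_eq.
Qed.

Lemma eq_smooth_on A f g : open A -> (forall x, A x -> f x = g x) ->
  smooth_on A f -> smooth_on A g.
Proof. by move=> oA fg sf k; apply: eq_diff_upto (sf k). Qed.

Lemma diff_upto_cst A k (c : R) : diff_upto A k (cst c).
Proof.
elim: k c => [|k ih] c; split => //.
  by move=> i; rewrite [pderiv i _](_ : _ = cst 0)//; apply/funext => x; exact: derive_cst.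
Qed.

Lemma smooth_on_cst A (c : R) : smooth_on A (cst c).
Proof. by move=> k; exact: diff_upto_cst. Qed.

Section closure.
Variable A : set 'rV[R]_n.
Hypothesis oA : open A.

Lemma diff_uptoD k f g : diff_upto A k f -> diff_upto A k g ->
  diff_upto A k (fun x => f x + g x).
Proof.
elim: k f g => [|k ih] f g [df Df] [dg Dg].
  by split=> // x Ax; apply: differentiableD; [exact: df|exact: dg].
split=> [x Ax|i]; first by apply: differentiableD; [exact: df|exact: dg].
apply: eq_diff_upto (ih _ _ (Df i) (Dg i)) => // x Ax.
by rewrite /pderiv [RHS]deriveD//; apply: diff_derivable; [exact: df|exact: dg].
Qed.

Lemma diff_uptoM k f g : diff_upto A k f -> diff_upto A k g ->
  diff_upto A k (fun x => f x * g x).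
Proof.
elim: k f g => [|k ih] f g.
  move=> [df _] [dg _]; split=> // x Ax.
  by apply: differentiableM; [exact: df|exact: dg].
move=> Hf Hg; have [df Df] := Hf; have [dg Dg] := Hg.
split=> [x Ax|i]; first by apply: differentiableM; [exact: df|exact: dg].
have := diff_uptoD (ih _ _ (diff_uptoW Hf) (Dg i)) (ih _ _ (diff_uptoW Hg) (Df i)).
apply: eq_diff_upto => // x Ax.
by rewrite /pderiv [RHS]deriveM//; apply: diff_derivable; [exact: df|exact: dg].
Qed.

Lemma smooth_onD f g : smooth_on A f -> smooth_on A g ->
  smooth_on A (fun x => f x + g x).
Proof. by move=> sf sg k; exact: diff_uptoD. Qed.

Lemma smooth_onM f g : smooth_on A f -> smooth_on A g ->
  smooth_on A (fun x => f x * g x).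
Proof. by move=> sf sg k; exact: diff_uptoM. Qed.

Lemma smooth_onZ (c : R) f : smooth_on A f -> smooth_on A (fun x => c * f x).
Proof. by move=> sf; apply: smooth_onM => //; exact: smooth_on_cst. Qed.

Lemma smooth_on_sum (I : Type) (r : seq I) (F : I -> 'rV[R]_n -> R) :
  (forall i, smooth_on A (F i)) -> smooth_on A (fun x => \sum_(i <- r) F i x).
Proof.
move=> sF; elim: r => [|i r ih].
  apply: eq_smooth_on (smooth_on_cst A 0) => // x _; by rewrite big_nil.
apply: eq_smooth_on (smooth_onD (sF i) ih) => // x _; by rewrite big_cons.
Qed.

Lemma smooth_on_coord i : smooth_on A (fun x => x ord0 i).
Proof.
have d1 x : differentiable (fun x : 'rV[R]_n => x ord0 i) x.
  exact: differentiable_coord.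
case=> [|k]; split => // j.
rewrite (_ : pderiv j _ = cst ((delta_mx ord0 j : 'rV[R]_n) ord0 i)).
  exact: diff_upto_cst.
apply/funext => x; rewrite /pderiv.
have D : is_derive x (delta_mx ord0 j) (fun x : 'rV[R]_n => x ord0 i)
    ((delta_mx ord0 j : 'rV[R]_n) ord0 i).
  apply/is_derive_epsP => e e0; exists 1 => // t _.
  rewrite [X in `|X - _ - _|]mxE [X in `|_ + X - _ - _|]mxE.
  rewrite [X in X - _]addrAC subrr add0r subrr normr0.
  by rewrite mulr_ge0// ltW.
by have [_] := D.
Qed.

Lemma diff_upto_comp k (F dF : R -> R) f :
  (forall x, A x -> is_derive (f x) (1 : R) F (dF (f x))) ->
  smooth_on A f -> diff_upto A k (fun x => dF (f x)) ->
  diff_upto A k.+1 (fun x => F (f x)).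
Proof.
move=> dFE sf sdF; split=> [x Ax|i].
  apply: (@differentiable_comp _ _ _ _ f F).
    exact: diff_upto_differentiable (sf 0%N) Ax.
  by apply/derivable1_diffP; have [] := dFE x Ax.
apply: eq_diff_upto (diff_uptoM sdF (smooth_on_pderiv i sf k)) => // x Ax.
have dfx : is_derive x (delta_mx ord0 i) f (pderiv i f x).
  by apply/derivableP/diff_derivable; exact: diff_upto_differentiable (sf 0%N) Ax.
by have [_] := is_derive_chain dfx (dFE x Ax).
Qed.

Lemma smooth_on_expR f : smooth_on A f -> smooth_on A (fun x => expR (f x)).
Proof.
move=> sf; have step k : diff_upto A k (fun x => expR (f x)) ->
    diff_upto A k.+1 (fun x => expR (f x)).
  by apply: diff_upto_comp => // x _; exact: is_derive_expR.
have s0 : diff_upto A 0 (fun x => expR (f x)).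
  split=> // x Ax; apply: (@differentiable_comp _ _ _ _ f (@expR R)).
    exact: diff_upto_differentiable (sf 0%N) Ax.
  exact/derivable1_diffP/derivable_expR.
by elim=> // k; exact: step.
Qed.

Lemma smooth_on_powR (a : R) f : (forall x, A x -> 0 < f x) -> smooth_on A f ->
  smooth_on A (fun x => f x `^ a).
Proof.
move=> f0 sf k.
have step j b : diff_upto A j (fun x => f x `^ (b - 1)) ->
    diff_upto A j.+1 (fun x => f x `^ b).
  move=> h; apply: (diff_upto_comp (F := fun t => t `^ b)
    (dF := fun t => b * t `^ (b - 1))) => //.
    by move=> x Ax; apply: is_derive1_powR; exact: f0.
  by apply: diff_uptoM => //; exact: diff_upto_cst.
elim: k a => [|k ih] a; last exact: step.
split=> // x Ax; apply: (@differentiable_comp _ _ _ _ f (fun t => t `^ a)).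
  exact: diff_upto_differentiable (sf 0%N) Ax.
by apply/derivable1_diffP; have [] := is_derive1_powR a (f0 x Ax).
Qed.

Lemma smooth_on_inv f : (forall x, A x -> 0 < f x) -> smooth_on A f ->
  smooth_on A (fun x => (f x)^-1).
Proof.
move=> f0 /(smooth_on_powR (-1) f0); apply: eq_smooth_on => // x Ax.
by rewrite powR_inv1// ltW// f0.
Qed.

Lemma smooth_on_ln f : (forall x, A x -> 0 < f x) -> smooth_on A f ->
  smooth_on A (fun x => ln (f x)).
Proof.
move=> f0 sf k; apply: diff_uptoW; apply: (diff_upto_comp (dF := GRing.inv)) => //.
  by move=> x Ax; apply: is_derive1_ln; exact: f0.
exact: smooth_on_inv.
Qed.

End closure.

End smooth_functions.

(** * Smooth minima and finite nets *)

Section softmin.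
Context (R : realType) (n m : nat) (Y : 'I_m.+1 -> 'rV[R]_n) (eps : R).
Hypothesis eps0 : 0 < eps.
Implicit Types (x : 'rV[R]_n) (i : 'I_n) (j : 'I_m.+1).

Local Notation e_ i := (delta_mx ord0 i : 'rV[R]_n).
Local Notation sqd x y := (dotp (x - y) (x - y)).

Definition gibbs x j : R := expR (- (eps^-1 * sqd x (Y j))).

Definition partition x : R := \sum_j gibbs x j.

(** A smooth approximation of $\min_j |x - Y_j|^2$; the normalization by the
   number of points makes it an upper bound of the minimum. *)
Definition softmin x : R := eps * (ln m.+1%:R - ln (partition x)).

(** The average of the derivatives of $|x - Y_j|^2$ in direction $i$ for the
   Gibbs weights. *)
Definition softmin_slope i x : R :=
  (\sum_j gibbs x j * (2 * (x - Y j) ord0 i)) / partition x.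

Lemma gibbs_gt0 x j : 0 < gibbs x j. Proof. exact: expR_gt0. Qed.

Lemma partition_gt0 x : 0 < partition x.
Proof.
rewrite /partition (bigD1 ord0)//= ltr_wpDr ?gibbs_gt0//.
by apply: sumr_ge0 => j _; rewrite ltW// gibbs_gt0.
Qed.

Lemma sqdD x y i (t : R) :
  sqd (x + t *: e_ i) y = sqd x y + (t * (2 * (x - y) ord0 i) + t ^+ 2).
Proof.
have -> : x + t *: e_ i - y = (x - y) + t *: e_ i by rewrite addrAC.
move: (x - y) => z; rewrite dotpDl !dotpDr !dotpZr !dotpZl (dotpC z (e_ i)).
have ei : (e_ i) ord0 i = 1 by rewrite mxE !eqxx.
by rewrite !dotp_delta ei; ring.
Qed.

Lemma smooth_on_gibbs j : smooth_on setT (gibbs ^~ j).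
Proof.
apply: smooth_on_expR; first exact: openT.
have oT := @openT 'rV[R]_n.
apply: (@eq_smooth_on _ _ _ (fun x => (- eps^-1) *
   \sum_(i < n) ((x ord0 i - Y j ord0 i) * (x ord0 i - Y j ord0 i)))) => //.
  move=> x _; rewrite mulNr /dotp; congr (- (_ * _)); apply: eq_bigr => i _.
  by rewrite !mxE.
apply: smooth_onZ => //; apply: smooth_on_sum => // i.
have h : smooth_on setT (fun x : 'rV[R]_n => x ord0 i - Y j ord0 i).
  apply: smooth_onD => //; first exact: smooth_on_coord.
  exact: smooth_on_cst.
exact: smooth_onM.
Qed.

Lemma smooth_on_softmin : smooth_on setT softmin.
Proof.
have oT := @openT 'rV[R]_n.
apply: smooth_onZ => //; apply: smooth_onD => //; first exact: smooth_on_cst.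
apply: (@eq_smooth_on _ _ _ (fun x => (-1) * ln (partition x))) => //.
  by move=> x _; rewrite mulN1r.
apply: smooth_onZ => //; apply: smooth_on_ln => //.
  by move=> x _; exact: partition_gt0.
by apply: smooth_on_sum => // j; exact: smooth_on_gibbs.
Qed.

Lemma is_derive_gibbs x i j : is_derive x (e_ i) (gibbs ^~ j)
  (gibbs x j * (- (eps^-1 * (2 * (x - Y j) ord0 i)))).
Proof.
rewrite /gibbs; apply: (is_derive_chain (F := @expR R) (f := fun x => - (eps^-1 * sqd x (Y j)))).
apply/is_derive_epsP => e e0; exists (e * eps); first exact: mulr_gt0.
move=> t te; rewrite sqdD.
rewrite (_ : _ - _ - _ = - (t ^+ 2 / eps)); last by field; rewrite gt_eqF.
have t2 : 0 <= t ^+ 2 / eps by rewrite divr_ge0 ?sqr_ge0// ltW.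
rewrite normrN ger0_norm// ler_pdivrMr//.
rewrite -real_normK ?num_real// mulrAC expr2 ler_wpM2r//.
exact: ltW.
Qed.

Lemma is_derive_softmin x i : is_derive x (e_ i) softmin (softmin_slope i x).
Proof.
have dS : is_derive x (e_ i) partition
    (\sum_j gibbs x j * (- (eps^-1 * (2 * (x - Y j) ord0 i)))).
  rewrite (_ : partition = \sum_j (gibbs ^~ j)); last first.
    by apply/funext => z; rewrite fct_sumE.
  by apply: is_derive_sum => j; exact: is_derive_gibbs.
have S0 := partition_gt0 x.
have dl := is_derive_chain dS (is_derive1_ln S0).
have := is_deriveZ eps (is_deriveB (is_derive_cst (ln m.+1%:R) x (e_ i)) dl).
move=> D; apply: (is_derive_eq D); rewrite /GRing.scale/= sub0r /softmin_slope.
have -> : \sum_j gibbs x j * (- (eps^-1 * (2 * (x - Y j) ord0 i))) =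
    - eps^-1 * \sum_j gibbs x j * (2 * (x - Y j) ord0 i).
  by rewrite mulr_sumr; apply: eq_bigr => j _; ring.
by move: (\sum_j _) => s; field; rewrite !gt_eqF.
Qed.

Lemma pderiv_softmin x i : pderiv i softmin x = softmin_slope i x.
Proof. by have [] := is_derive_softmin x i. Qed.

Lemma softmin_ge (c : R) x : (forall j, c <= sqd x (Y j)) -> c <= softmin x.
Proof.
move=> hc; have S0 := partition_gt0 x.
have : partition x <= m.+1%:R * expR (- (eps^-1 * c)).
  rewrite mulr_natl -[X in _ *+ X]card_ord -sumr_const; apply: ler_sum => j _.
  by rewrite ler_expR lerN2 ler_wpM2l// invr_ge0 ltW.
move=> h; have : ln (partition x) <= ln (m.+1%:R * expR (- (eps^-1 * c))).
  by rewrite ler_ln// posrE// mulr_gt0// expR_gt0.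
rewrite lnM ?posrE ?expR_gt0// expRK => {}h.
rewrite /softmin -ler_pdivrMl//; lra.
Qed.

Lemma softmin_le x j : softmin x <= sqd x (Y j) + eps * m.+1%:R.
Proof.
have S0 := partition_gt0 x.
have : gibbs x j <= partition x.
  rewrite /partition (bigD1 j)//= lerDl.
  by apply: sumr_ge0 => k _; rewrite ltW// gibbs_gt0.
rewrite -ler_ln ?posrE ?gibbs_gt0// expRK => h.
have lm : ln m.+1%:R <= m.+1%:R :> R by rewrite ltW// ln_sublinear.
have := lerB lm h; rewrite opprK => {}h.
have := ler_wpM2l (ltW eps0) h; rewrite -/(softmin x) mulrDr [_ * (_ * _)]mulrA.
by rewrite divff ?gt_eqF// mul1r addrC.
Qed.

(** Jensen's inequality for the Gibbs weights, through the tangent line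
   $e^z \ge 1 + z$. *)
Lemma softmin_semiconcave x i (t : R) :
  softmin (x + t *: e_ i) <= softmin x + t * softmin_slope i x + t ^+ 2.
Proof.
have S0 := partition_gt0 x; have S1 := partition_gt0 (x + t *: e_ i).
pose z j := t * (2 * (x - Y j) ord0 i) + t ^+ 2.
pose zbar := t * softmin_slope i x + t ^+ 2.
have zbarE : \sum_j gibbs x j * z j = zbar * partition x.
  rewrite /zbar /softmin_slope mulrDl -mulrA divfK ?gt_eqF//.
  rewrite mulr_sumr /partition mulr_sumr -big_split/=; apply: eq_bigr => j _.
  by rewrite /z; ring.
have : expR (- (eps^-1 * zbar)) * partition x <= partition (x + t *: e_ i).
  apply: (@le_trans _ _ (\sum_j expR (- (eps^-1 * zbar)) * (gibbs x j
      * (1 + eps^-1 * (zbar - z j))))).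
    rewrite -mulr_sumr ler_wpM2l ?expR_ge0//.
    rewrite (eq_bigr (fun j => gibbs x j * (1 + eps^-1 * zbar)
      - eps^-1 * (gibbs x j * z j))); last by move=> j _; ring.
    rewrite sumrB -mulr_suml -mulr_sumr zbarE -/(partition x).
    by rewrite le_eqVlt; apply/orP; left; apply/eqP; ring.
  apply: ler_sum => j _; rewrite /gibbs sqdD -/(z j).
  rewrite mulrCA (mulrDr eps^-1 (sqd x (Y j))) (opprD (eps^-1 * sqd x (Y j))) expRD ler_wpM2l ?expR_ge0//.
  have := expR_ge1Dx (eps^-1 * (zbar - z j)).
  move=> /(ler_wpM2l (expR_ge0 (- (eps^-1 * zbar)))) /le_trans; apply.
  by rewrite -expRD ler_expR; lra.
rewrite -ler_ln ?posrE ?mulr_gt0 ?expR_gt0// lnM ?posrE ?expR_gt0// expRK => h.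
have alg (e ei zb l0 l1 l : R) : 0 <= e -> e * ei = 1 -> - (ei * zb) + l0 <= l1 ->
    e * (l - l1) <= e * (l - l0) + zb.
  clear=> e0 eei h0; have h1 := ler_wpM2l e0 h0.
  have : e * (ei * zb) = zb by rewrite mulrA eei mul1r.
  by move: h1; rewrite mulrDr mulrN !mulrBr; lra.
rewrite /softmin -addrA -/zbar.
by apply: (alg _ eps^-1) => //; [exact: ltW|rewrite divff// gt_eqF].
Qed.

Lemma softmin_slope_le x i (c : R) : (forall j, `|(x - Y j) ord0 i| <= c) ->
  `|softmin_slope i x| <= 2 * c.
Proof.
move=> hc; have S0 := partition_gt0 x.
rewrite /softmin_slope normrM normfV (gtr0_norm S0) ler_pdivrMr//.
apply: (le_trans (ler_norm_sum _ _ _)); rewrite mulr_sumr; apply: ler_sum => j _.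
rewrite normrM (gtr0_norm (gibbs_gt0 x j)) mulrC ler_wpM2r//; first exact/ltW/gibbs_gt0.
by rewrite normrM gtr0_norm// ler_wpM2l.
Qed.

End softmin.

Section finite_nets.
Context (R : realType) (n : nat).

Lemma compact_net (A : set 'rV[R]_n) (r : R) : A !=set0 -> compact A -> 0 < r ->
  exists m (Y : 'I_m.+1 -> 'rV[R]_n), (forall j, A (Y j)) /\
    forall z, A z -> exists j, `|z - Y j| < r.
Proof.
move=> [a Aa]; rewrite compact_cover => cA r0.
have [||D DA AD] := cA 'rV[R]_n A (fun z => ball z r).
- by move=> z _; exact: ball_open.
- by move=> z Az; exists z => //; exact: ballxx.
pose s := finmap.enum_fset D.
have sD : (0 < size s)%N.
  have [y /= yD _] := AD a Aa; move: yD; rewrite -[_ \in _]/(y \in s).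
  by case: s.
have As y : y \in s -> A y by move=> ys; have := DA y ys; rewrite inE.
exists (size s).-1, (fun j => nth a s j); split.
  by move=> j; apply: As; apply: mem_nth; case: j => j /=; rewrite prednK.
move=> z /AD[y /= yD]; rewrite -ball_normE /= distrC => zy.
have yi : (index y s < (size s).-1.+1)%N by rewrite prednK// index_mem.
by exists (Ordinal yi) => /=; rewrite nth_index.
Qed.

End finite_nets.

(** * Smooth approximation of the distance and dominated convergence *)

Section distance_approximation.
Context (R : realType) (n : nat) (K : set 'rV[R]_n).
Hypothesis (K0 : K !=set0) (cK : closed K).
Implicit Types (x y v : 'rV[R]_n) (i : 'I_n).

Local Notation d := (dist_to K).
Local Notation e_ i := (delta_mx ord0 i : 'rV[R]_n).

(** On a bounded set, $d^2$ is the smooth minimum over finer and finer nets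
   of a compact part of $K$, up to an error tending to zero. *)
Lemma sqr_dist_to_approx (rho : R) : 0 <= rho ->
  exists (Psi : nat -> 'rV[R]_n -> R) (C : R),
  [/\ forall k, smooth_on setT (Psi k),
      forall k x, d x ^+ 2 <= Psi k x,
      forall k x, `|x| <= rho + 1 -> Psi k x <= d x ^+ 2 + C / k.+1%:R,
      forall k x i, `|x| <= rho -> `|pderiv i (Psi k) x| <= C &
      forall k x i (t : R),
        Psi k (x + t *: e_ i) <= Psi k x + t * pderiv i (Psi k) x + t ^+ 2].
Proof.
move=> rho0; have [z0 Kz0] := K0.
pose B := n%:R * (rho + 1 + `|z0|).
have B0 : 0 <= B by rewrite mulr_ge0// addr_ge0// addr_ge0.
pose M := rho + 1 + B.
have dB x : `|x| <= rho + 1 -> d x <= B.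
  move=> xr; apply: (le_trans (dist_to_le x Kz0)).
  apply: (le_trans (enorm_le_norm _)); rewrite ler_wpM2l//.
  by apply: (le_trans (ler_normB _ _)); rewrite lerD2r.
(* points of the ball have their nearest points in A *)
pose A := K `&` [set y | `|y| <= M].
have nearA x : `|x| <= rho + 1 -> A (nearest K0 cK x).
  move=> xr; have [Kn dn] := nearestP K0 cK x; split => //=.
  have := ler_normB x (x - nearest K0 cK x); rewrite subKr => /le_trans; apply.
  rewrite lerD//; apply: (le_trans (norm_le_enorm _)).
  by rewrite -dn; exact: dB.
have A0 : A !=set0.
  by exists (nearest K0 cK 0); apply: nearA; rewrite normr0 addr_ge0.
have cA : compact A.
  apply: bounded_closed_compact.
    exists M; split; first exact: num_real.
    by move=> r Mr y [_ /= yM]; exact: le_trans (ltW Mr).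
  apply: closedI => //.
  apply: (@preimage_closed _ _ (fun y : 'rV[R]_n => `|y|) [set r | r <= M]).
    by move=> y _; exact: norm_continuous.
  exact: closed_le.
have net (k : nat) : exists (mY : {m : nat & 'I_m.+1 -> 'rV[R]_n}),
    (forall j, A (tagged mY j)) /\
    (forall z, A z -> exists j, `|z - tagged mY j| < k.+1%:R^-1).
  have [|m [Y [h1 h2]]] := @compact_net R n A k.+1%:R^-1 A0 cA.
    by rewrite invr_gt0.
  by exists (existT _ m Y).
have {net}[Y hY] := choice net.
pose m k := tag (Y k).
(* the normalization of the smooth minimum then costs at most 1/(k+1) *)
pose eps k : R := (k.+1%:R * (m k).+1%:R)^-1.
have eps0 k : 0 < eps k by rewrite invr_gt0 mulr_gt0.
pose Psi k := softmin (tagged (Y k)) (eps k).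
pose C := 2 * B * n%:R + n%:R ^+ 2 + 1 + 2 * (rho + M).
have n0 : 0 <= n%:R :> R by [].
have C1 : 2 * B * n%:R + n%:R ^+ 2 + 1 <= C.
  by rewrite lerDl mulr_ge0// addr_ge0// /M !addr_ge0.
have C2 : 2 * (rho + M) <= C.
  by rewrite lerDr addr_ge0// addr_ge0 ?sqr_ge0// mulr_ge0// mulr_ge0.
exists Psi, C; split.
- by move=> k; apply: smooth_on_softmin; exact: eps0.
- move=> k x; apply: softmin_ge => // j.
  have := dist_to_le x ((hY k).1 j).1; rewrite -enorm_sqr.
  by rewrite -ler_sqr ?nnegrE ?enorm_ge0 ?dist_to_ge0.
- move=> k x xr; have [j hj] := (hY k).2 _ (nearA x xr).
  apply: (le_trans (softmin_le _ (eps0 k) x j)).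
  have -> : eps k * (m k).+1%:R = k.+1%:R^-1.
    by rewrite /eps invfM -mulrA mulVf ?mulr1.
  have h : enorm (x - tagged (Y k) j) <= d x + n%:R / k.+1%:R.
    rewrite (nearestP K0 cK x).2.
    have -> : x - tagged (Y k) j = (x - nearest K0 cK x)
        + (nearest K0 cK x - tagged (Y k) j) by rewrite addrA subrK.
    apply: (le_trans (enorm_triangle _ _)); rewrite lerD2l.
    by apply: (le_trans (enorm_le_norm _)); rewrite ler_wpM2l// ltW.
  rewrite -enorm_sqr.
  have : enorm (x - tagged (Y k) j) ^+ 2 <= (d x + n%:R / k.+1%:R) ^+ 2.
    by rewrite lerXn2r ?nnegrE ?enorm_ge0 ?addr_ge0 ?dist_to_ge0// divr_ge0.
  have := dB x xr; have := dist_to_ge0 K0 cK x.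
  have : 0 <= k.+1%:R^-1 :> R by rewrite invr_ge0.
  have : k.+1%:R^-1 <= 1 :> R by rewrite invf_le1// ler1n.
  move: C1 n0; set r := k.+1%:R^-1; clear => C1 n0 r1 r0 d0 dB h.
  have h1 := mulr_ge0 n0 r0.
  have h2 : d x * (n%:R * r) <= B * (n%:R * r) by rewrite ler_wpM2r.
  have h3 : (n%:R * r) ^+ 2 <= n%:R ^+ 2 * r.
    by rewrite exprMn ler_wpM2l ?sqr_ge0// expr2 ler_piMl.
  have h4 := ler_wpM2r r0 C1.
  by move: h h2 h3 h4; rewrite sqrrD !mulrDl mulr2n; lra.
- move=> k x i xr; rewrite /Psi (pderiv_softmin (tagged (Y k)) (eps0 k)).
  apply: le_trans C2; apply: softmin_slope_le => j.
  apply: (le_trans (rV_coord_le_norm _ _)); apply: (le_trans (ler_normB _ _)).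
  by rewrite lerD// ((hY k).1 j).2.
- move=> k x i t; rewrite /Psi (pderiv_softmin (tagged (Y k)) (eps0 k)).
  exact: softmin_semiconcave.
Qed.

(** Difference quotients bound the slopes of semiconcave functions from both
   sides, so that pointwise convergence forces convergence of the slopes. *)
Lemma cvg_slope_off_ridge (rho C : R) (Psi : nat -> 'rV[R]_n -> R) x i :
  (forall k x, d x ^+ 2 <= Psi k x) ->
  (forall k x, `|x| <= rho + 1 -> Psi k x <= d x ^+ 2 + C / k.+1%:R) ->
  (forall k x i (t : R),
      Psi k (x + t *: e_ i) <= Psi k x + t * pderiv i (Psi k) x + t ^+ 2) ->
  `|x| <= rho -> ~ ridge K i x ->
  pderiv i (Psi k) x @[k --> \oo] --> 2 * offset K0 cK x ord0 i.
Proof.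
move=> Psi_ge Psi_le Psi_sc xr xi; apply/cvgrPdist_le => e e0.
have e3 : 0 < e / 3 by rewrite divr_gt0.
have [r r0 hr] := (is_derive_epsP _ _ _ _).1 (is_derive_sqr_dist_to K0 cK xi) _ e3.
(* increments t and - t, kept small enough to stay in the ball and to make both
   t and the error of the derivative at most e/3 *)
pose t := Num.min (r / 2) (Num.min (e / 3) 1).
have t0 : 0 < t by rewrite !lt_min divr_gt0// e3 ltr01.
have [t1 t2 t3] : [/\ t < r, t <= e / 3 & t <= 1].
  split; last by rewrite !ge_min lexx !orbT.
    by rewrite gt_min ltr_pdivrMr// ltr_pMr// ltr1n.
  by rewrite !ge_min lexx !orbT.
have bound (s : R) : `|s| = t -> `|x + s *: e_ i| <= rho + 1.
  move=> st; apply: (le_trans (ler_normD _ _)); rewrite lerD//.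
  rewrite normrZ st; apply: mulr_ile1 => //; first exact: ltW.
  apply: rV_norm_le => // j.
  by rewrite mxE; case: (_ && _); rewrite ?normr1 ?normr0.
have C0 : 0 <= C.
  have := le_trans (Psi_ge 0%N x) (Psi_le 0%N x _); rewrite divr1 lerDl; apply.
  by rewrite ler_wpDr.
have [N _ hN] : \forall k \near \oo, C / k.+1%:R <= e / 3 * t.
  have ct : 0 < e / 3 * t / (C + 1) by rewrite divr_gt0 ?mulr_gt0// ltr_wpDl.
  have [N hN] := natSinv_lt ct.
  exists N => // k /hN /ltW h; rewrite -[leRHS](divfK (_ : C + 1 != 0)).
    rewrite mulrC; apply: ler_pM => //; last by rewrite lerDl.
    by rewrite gt_eqF// ltr_wpDl.
exists N => // k /hN kC.
have [kt kNt] : `|t| = t /\ `|- t| = t by rewrite normrN gtr0_norm.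
have := hr t; rewrite kt => /(_ t1); rewrite ler_norml => /andP[h1 _].
have := hr (- t); rewrite kNt => /(_ t1); rewrite ler_norml => /andP[h2 _].
have a1 := Psi_sc k x i t; have a2 := Psi_sc k x i (- t).
have b1 := Psi_ge k (x + t *: e_ i); have b2 := Psi_ge k (x + (- t) *: e_ i).
have b3 := Psi_le k x (ler_wpDr ler01 xr).
have t2' : t * t <= t * (e / 3) by rewrite ler_wpM2l// ltW.
have [k1 k2] : t * (2 * offset K0 cK x ord0 i - pderiv i (Psi k) x) <= t * e /\
    t * - e <= t * (2 * offset K0 cK x ord0 i - pderiv i (Psi k) x).
  move: a1 a2 b1 b2 b3 kC h1 h2 t2'.
  move: (Psi k x) (Psi k (x + t *: e_ i)) (Psi k (x + (- t) *: e_ i)) (d x ^+ 2)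
    (d (x + t *: e_ i) ^+ 2) (d (x + (- t) *: e_ i) ^+ 2) (C / k.+1%:R)
    (2 * offset K0 cK x ord0 i) (pderiv i (Psi k) x).
  by clear => *; split; lra.
by rewrite ler_norml; apply/andP; split; rewrite -(ler_pM2l t0).
Qed.

End distance_approximation.

Section bounded_support.
Context (R : realType) (n : nat) (D : set 'rV[R]_n).
Hypothesis mD : measurable D.
Local Notation mu := (lebesgue_rV R n).
Implicit Types (f : 'rV[R]_n -> R).

Let dominating (rho C : R) : mu.-integrable D
  (EFin \o (fun x => C * \1_[set x : 'rV[R]_n | `|x| <= rho] x)).
Proof.
have mB : measurable [set x : 'rV[R]_n | `|x| <= rho].
  apply: closed_measurable_rV.
  apply: (@preimage_closed _ _ (fun y : 'rV[R]_n => `|y|) [set r | r <= rho]).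
    by move=> y _; exact: norm_continuous.
  exact: closed_le.
have fB : (mu [set x : 'rV[R]_n | (`|x| <= rho)%R] < +oo)%E.
  apply: lebesgue_rV_bounded => //; exists rho; split; first exact: num_real.
  by move=> r rr x /= xr; exact: le_trans (ltW rr).
have h : mu.-integrable D (EFin \o (\1_[set x : 'rV[R]_n | `|x| <= rho])).
  apply: (@integrableS _ _ _ _ setT) => //; apply/integrableP; split.
    by apply/measurable_EFinP; exact: measurable_indic.
  rewrite (eq_integral (fun x => (\1_[set x : 'rV[R]_n | `|x| <= rho] x)%:E)).
    by rewrite integral_indic// setIT.
  by move=> x _; rewrite gee0_abs// lee_fin.
exact: (@integrableZl _ _ _ mu D mD C _ h).
Qed.

Lemma bounded_support_integrable f (rho C : R) : measurable_fun D f ->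
  (forall x, D x -> `|f x| <= C) -> (forall x, D x -> rho < `|x| -> f x = 0) ->
  mu.-integrable D (EFin \o f).
Proof.
move=> mf fC f0; apply: (le_integrable mD _ _ (dominating rho C)).
  exact/measurable_EFinP.
move=> x Dx /=; rewrite lee_fin indicE.
have C0 : 0 <= C by apply: le_trans (fC x Dx).
have [xr|xr] := leP `|x| rho.
  by rewrite mem_set//= mulr1 (le_trans (fC x Dx))// ler_norm.
by rewrite f0// normr0.
Qed.

Lemma bounded_support_cvg (f_ : nat -> 'rV[R]_n -> R) f (rho C : R) :
  (forall k, measurable_fun D (f_ k)) -> measurable_fun D f ->
  (forall k x, D x -> `|f_ k x| <= C) ->
  (forall k x, D x -> rho < `|x| -> f_ k x = 0) ->
  (exists2 N, measurable N /\ mu N = 0 &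
    forall x, D x -> ~ N x -> f_ k x @[k --> \oo] --> f x) ->
  mu.-integrable D (EFin \o f) /\
  (\int[mu]_(x in D) f_ k x)%R @[k --> \oo] --> (\int[mu]_(x in D) f x)%R.
Proof.
move=> mf_ mf fC f0 [N [mN N0] cvg_f].
have [|||||h1 _ h3] := @dominated_convergence _ _ _ mu D mD
  (fun k => EFin \o f_ k) (EFin \o f)
  (EFin \o (fun x => C * \1_[set x : 'rV[R]_n | `|x| <= rho] x)).
- by move=> k; apply/measurable_EFinP.
- exact/measurable_EFinP.
- exists N; split => // x /= /not_implyP[Dx fx]; apply: contrapT => Nx.
  by apply: fx; apply: cvg_EFin; [exact: nearW|exact: cvg_f].
- exact: dominating.
- exists set0; split => //; apply/subsetP => x; rewrite inE /= => h; exfalso.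
  apply: h => k Dx /=; rewrite lee_fin indicE.
  have [xr|xr] := leP `|x| rho; first by rewrite mem_set//= mulr1 fC.
  by rewrite f0// normr0 memNset//= ?mulr0// => /le_lt_trans/(_ xr); rewrite ltxx.
split=> //; apply: fine_cvg; rewrite fineK; last exact: integrable_fin_num.
exact: h3.
Qed.

End bounded_support.

(** * The distributional hypothesis for smooth test functions *)

Section test_functions.
Context (R : realType) (n : nat).
Implicit Types (f u phi : 'rV[R]_n -> R) (A U : set 'rV[R]_n).

Lemma continuous_compact_bounded A f : compact A -> continuous f ->
  exists C, forall x, A x -> `|f x| <= C.
Proof.
move=> cA cf; have [->|/set0P A0] := eqVneq A set0; first by exists 0.
have cnf : {within A, continuous (fun x => `|f x|)}.
  apply: continuous_subspaceT => x; apply: (@continuous_comp _ _ _ f Num.norm).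
    exact: cf.
  exact: norm_continuous.
have [c _ hc] := EVT_max_rV A0 cA cnf.
by exists `|f c| => x Ax; apply: hc; rewrite inE.
Qed.

Lemma smooth_continuous f : smooth f -> continuous f.
Proof. by move=> sf x; apply: differentiable_continuous; exact: (sf [::] x). Qed.

Lemma smooth_pderiv f i : smooth f -> smooth (pderiv i f).
Proof. by move=> /smoothP sf; apply/smoothP; exact: smooth_on_pderiv. Qed.

Definition supp u := closure [set x | u x != 0].

Lemma supp_notin u x : ~ supp u x -> u x = 0.
Proof.
by move=> ux; apply/eqP/negPn/negP => u0; apply: ux; exact: subset_closure.
Qed.

Lemma near_supp_notin u x : ~ supp u x -> \near x, u x = 0.
Proof.
move=> ux; have oS : open (~` supp u) by apply: closed_openC; exact: closed_closure.
by apply: filterS (open_nbhs_nbhs (conj oS ux)) => y; exact: supp_notin.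
Qed.

Lemma pderiv_supp_notin u i x : ~ supp u x -> pderiv i u x = 0.
Proof.
move=> /near_supp_notin ux; rewrite /pderiv (@near_eq_derive _ _ _ u (cst 0))//.
exact: derive_cst.
Qed.

Lemma compact_norm_bounded A : compact A -> exists2 rho : R, 0 <= rho &
  forall x, A x -> `|x| <= rho.
Proof.
move=> cA; have [C hC] := continuous_compact_bounded cA
  (f := fun x : 'rV[R]_n => `|x|) (@norm_continuous _ _).
by exists `|C| => // x Ax; rewrite -[`|x|]normr_id (le_trans (hC x Ax))// ler_norm.
Qed.

Lemma test_function_bounds U u : test_function U u -> exists rho C : R,
  [/\ 0 <= rho, 0 <= C, forall x, `|u x| <= C, forall x i, `|pderiv i u x| <= C &
      forall x, supp u x -> `|x| <= rho].
Proof.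
move=> [su cS _]; have [rho rho0 hrho] := compact_norm_bounded cS.
have [C0 hC0] := continuous_compact_bounded cS (smooth_continuous su).
have /choice[C1 hC1] i : exists C, forall x, supp u x -> `|pderiv i u x| <= C.
  exact: continuous_compact_bounded cS (smooth_continuous (smooth_pderiv i su)).
pose C := `|C0| + \sum_i `|C1 i|.
have C1C i : `|C1 i| <= C.
  rewrite /C (bigD1 i)//= addrCA lerDl addr_ge0//.
  by apply: sumr_ge0.
have C0C : `|C0| <= C by rewrite lerDl; apply: sumr_ge0.
have Cge0 : 0 <= C by apply: le_trans C0C.
exists rho, C; split => //.
- move=> x; have [xS|xS] := pselect (supp u x).
    by rewrite (le_trans (hC0 x xS))// (le_trans (ler_norm _)).
  by rewrite supp_notin// normr0.
- move=> x i; have [xS|xS] := pselect (supp u x).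
    by rewrite (le_trans (hC1 i x xS))// (le_trans (ler_norm _)).
  by rewrite pderiv_supp_notin// normr0.
Qed.

End test_functions.

Section weak_inequality.
Context (R : realType) (n : nat) (Omega K : set 'rV[R]_n).
Hypothesis (oO : open Omega) (K0 : K !=set0) (cK : closed K).
Local Notation d := (dist_to K).
Local Notation U := (Omega `\` K).
Local Notation mu := (lebesgue_rV R n).
Local Notation field := (dist_field K0 cK).
Implicit Types (u phi : 'rV[R]_n -> R) (D : set 'rV[R]_n) (x : 'rV[R]_n).

Let oU : open U.
Proof. by rewrite setDE; apply: openI => //; exact: closed_openC. Qed.

Let mU : measurable U. Proof. exact: open_measurable_rV. Qed.

Lemma dist_field_le x i : `|field x ord0 i| <= d x.
Proof.
have h : `|offset K0 cK x ord0 i| <= d x.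
  rewrite (nearestP K0 cK x).2 (le_trans (rV_coord_le_norm _ _))//.
  exact: norm_le_enorm.
by rewrite mxE; case: ifP => //; rewrite normr0 dist_to_ge0.
Qed.

Lemma measurable_dotp_field D (f : 'I_n -> 'rV[R]_n -> R) :
  (forall i, measurable_fun D (f i)) ->
  measurable_fun D (fun x => dotp (field x) (\row_i f i x)).
Proof.
move=> mf; apply: measurable_sum => i; apply: measurable_funM.
  exact: (measurable_funS measurableT (@subsetT _ _) (measurable_dist_field K0 cK i)).
by apply: eq_measurable_fun (mf i) => x _; rewrite mxE.
Qed.

Lemma measurable_pderiv D u i : smooth u -> measurable_fun D (pderiv i u).
Proof.
move=> su; apply: (measurable_funS measurableT (@subsetT _ _)).
by apply: continuous_measurable_rV; exact/smooth_continuous/smooth_pderiv.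
Qed.

Lemma measurable_smooth D u : smooth u -> measurable_fun D u.
Proof.
move=> su; apply: (measurable_funS measurableT (@subsetT _ _)).
by apply: continuous_measurable_rV; exact/smooth_continuous.
Qed.

Lemma dist_to_le_norm : exists2 C, 0 <= C & forall x, d x <= n%:R * `|x| + C.
Proof.
have [z Kz] := K0; exists (n%:R * `|z|); first by rewrite mulr_ge0.
move=> x; apply: (le_trans (dist_to_le x Kz)).
apply: (le_trans (enorm_le_norm _)); rewrite -mulrDr ler_wpM2l//.
exact: ler_normB.
Qed.

Variables (c : R) (k : nat).
Hypothesis superharm : distr_ge0 c k d U.

(** Off the null set of the ridges $d \nabla d$ is [dist_field] and
   $|\nabla d| = 1$, so that $\nabla d \cdot \nabla (d \varphi)$ is
   $d \nabla d \cdot \nabla \varphi + \varphi$. *)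
Lemma weak_inequality_test phi : test_function U phi -> (forall x, 0 <= phi x) ->
  c * (\int[mu]_(x in U) (dotp (field x) (grad phi x) + k%:R * phi x))%R <= 0.
Proof.
move=> tphi phi0; have := superharm tphi phi0; rewrite /dLapl.
have [sphi cS SU] := tphi.
have [rho [C [rho0 C0 phiC dphiC Srho]]] := test_function_bounds tphi.
have offS x : rho < `|x| -> ~ supp phi x by move=> rx /Srho; rewrite leNgt rx.
have mI : measurable_fun U (fun x => dotp (field x) (grad phi x)).
  by apply: measurable_dotp_field => i; exact: measurable_pderiv.
have mphi : measurable_fun U phi by exact: measurable_smooth.
have iphi : mu.-integrable U (EFin \o phi).
  apply: (@bounded_support_integrable _ _ _ mU phi rho C) => // x _ /offS.
  exact: supp_notin.
have [C' C'0 hC'] := dist_to_le_norm.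
have iI : mu.-integrable U (EFin \o (fun x => dotp (field x) (grad phi x))).
  apply: (@bounded_support_integrable _ _ _ mU _ rho
      (\sum_(i < n) (n%:R * rho + C') * C)) => //.
    move=> x _; have [xS|xS] := pselect (supp phi x).
      apply: (le_trans (ler_norm_sum _ _ _)); apply: ler_sum => i _.
      rewrite normrM; apply: ler_pM => //.
        apply: (le_trans (dist_field_le x i)); apply: (le_trans (hC' x)).
        by rewrite lerD2r ler_wpM2l// Srho.
      by rewrite mxE.
    rewrite /dotp big1 ?normr0.
      by apply: sumr_ge0 => i _; rewrite mulr_ge0// addr_ge0// mulr_ge0.
    by move=> i _; rewrite [grad phi x _ _]mxE pderiv_supp_notin// mulr0.
  move=> x _ /offS xS; apply: big1 => i _.
  by rewrite [grad phi x _ _]mxE pderiv_supp_notin// mulr0.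
have -> : (\int[mu]_(x in U) dotp (grad d x) (grad (fun y => d y * phi y) x))%R =
    (\int[mu]_(x in U) (dotp (field x) (grad phi x) + phi x))%R.
  rewrite (@eq_Rintegral _ _ _ mu U (fun x => dotp (field x) (grad phi x)
    + phi x * (dotp (field x) (field x) * (d x ^+ 2) `^ (-1)))); last first.
    move=> x; rewrite inE => -[Ox Kx]; rewrite dotp_grad_dist_to//.
      by rewrite powR_inv1// sqr_ge0.
    exact: (sphi [::] x).
  congr fine; apply: ae_eq_integral => //.
  - apply/measurable_EFinP; apply: measurable_funD => //.
    apply: measurable_funM => //; apply: measurable_funM.
      have := @measurable_dotp_field U (fun i x => field x ord0 i).
      move=> h; apply: (eq_measurable_fun (fun x => dotp (field x) (\row_i field x ord0 i))).
        by move=> x _; congr dotp; apply/rowP => i; rewrite mxE.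
      apply: h => i; apply: (measurable_funS measurableT (@subsetT _ _)).
      exact: measurable_dist_field.
    apply: (measurableT_comp (measurable_powR _)).
    apply: (measurable_funS measurableT (@subsetT _ _)).
    by apply: continuous_measurable_rV; exact: continuous_sqr_dist_to.
  - by apply/measurable_EFinP; apply: measurable_funD.
  exists (ridges K); split; first exact: measurable_ridges.
    exact: ridges_null.
  move=> x /= /not_implyP[[Ox Kx] hx]; apply: contrapT => xr; apply: hx.
  have d0 := dist_to_gt0 K0 cK Kx.
  rewrite -enorm_sqr enorm_dist_field// powR_inv1 ?sqr_ge0//.
  by rewrite divff ?mulr1// gt_eqF// exprn_gt0.
rewrite RintegralD// RintegralD//; last first.
  exact: (@integrableZl _ _ _ mu U mU k%:R _ iphi).
rewrite RintegralZl//; move: (Rintegral _ _ _) (Rintegral _ _ _) => a b h.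
by rewrite -oppr_ge0 (le_trans h)// le_eqVlt; apply/orP; left; apply/eqP; ring.
Qed.

End weak_inequality.

(** * Regularized powers *)

Lemma powR_sqr_half (R : realType) (p y : R) : (y ^+ 2) `^ (p / 2) = `|y| `^ p.
Proof.
by rewrite -(real_normK (num_real y)) -powR_mulrn// -powRrM mulrCA divff ?mulr1.
Qed.

Section regularized_power.
Context (R : realType).
Implicit Types (p y : R).

Let r k : R := k.+1%:R^-1.
Let r_gt0 k : 0 < r k. Proof. by rewrite invr_gt0. Qed.
Let r_le1 k : r k <= 1. Proof. by rewrite invf_le1// ler1n. Qed.
Let r_cvg0 : r k @[k --> \oo] --> 0.
Proof. exact: cvg_harmonic. Qed.

(** Smooth approximation of $|y|^p$ which still vanishes at $0$, so that
   composing with a test function does not enlarge its support. *)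
Definition regpow p k y : R := (y ^+ 2 + r k) `^ (p / 2) - r k `^ (p / 2).

Definition regpow_slope p k y : R := p * ((y ^+ 2 + r k) `^ (p / 2 - 1) * y).

Lemma regpow0 p k : regpow p k 0 = 0.
Proof. by rewrite /regpow expr0n add0r subrr. Qed.

Let reg_gt0 k y : 0 < y ^+ 2 + r k.
Proof. by rewrite ltr_wpDl ?sqr_ge0. Qed.

Lemma regpow_ge0 p k y : 0 < p -> 0 <= regpow p k y.
Proof.
move=> p0; rewrite subr_ge0 ge0_ler_powR ?nnegrE ?divr_ge0 ?(ltW p0) ?(ltW (r_gt0 _))//.
  by rewrite ltW.
by rewrite lerDr sqr_ge0.
Qed.

Lemma regpow_le p k y (C : R) : 0 < p -> `|y| <= C ->
  regpow p k y <= (C ^+ 2 + 1) `^ (p / 2).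
Proof.
move=> p0 yC; apply: (@le_trans _ _ ((y ^+ 2 + r k) `^ (p / 2))).
  by rewrite gerBl powR_ge0.
apply: ge0_ler_powR; rewrite ?nnegrE ?addr_ge0 ?sqr_ge0 ?(ltW (r_gt0 _))//.
  by rewrite divr_ge0// ltW.
apply: lerD => //; rewrite -real_normK ?num_real//.
by rewrite lerXn2r// nnegrE// (le_trans _ yC).
Qed.

Lemma regpow_slope_le p k y (C : R) : 1 < p -> `|y| <= C ->
  `|regpow_slope p k y| <= p * (C ^+ 2 + 1) `^ ((p - 1) / 2).
Proof.
move=> p1 yC; have p0 : 0 < p by apply: lt_trans p1.
rewrite normrM (gtr0_norm p0) ler_pM2l// normrM (ger0_norm (powR_ge0 _ _)).
apply: (@le_trans _ _ ((y ^+ 2 + r k) `^ ((p - 1) / 2))).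
  have -> : (p - 1) / 2 = (p / 2 - 1) + 2^-1 by field.
  rewrite (@powRD _ _ (p / 2 - 1) 2^-1); last by apply/implyP => _; rewrite gt_eqF.
  rewrite ler_wpM2l ?powR_ge0// powR12_sqrt; last exact: ltW.
  by rewrite -sqrtr_sqr ler_wsqrtr// lerDl ltW.
apply: ge0_ler_powR; rewrite ?nnegrE ?addr_ge0 ?sqr_ge0 ?(ltW (r_gt0 _))//.
  by rewrite divr_ge0// subr_ge0 ltW.
apply: lerD => //; rewrite -real_normK ?num_real//.
by rewrite lerXn2r// nnegrE// (le_trans _ yC).
Qed.

Lemma is_derive_regpow p k y :
  is_derive y (1 : R) (regpow p k) (regpow_slope p k y).
Proof.
have d1 := is_derive_id y (1 : R); have d2 := is_deriveM d1 d1.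
have d3 := is_deriveD d2 (is_derive_cst (r k) y (1 : R)).
have g0 : 0 < (id * id + cst (r k) : R -> R) y.
  exact: (reg_gt0 k y).
have d4 := is_derive_chain d3 (is_derive1_powR (p / 2) g0).
have d5 := is_deriveB d4 (is_derive_cst (r k `^ (p / 2)) y (1 : R)).
have -> : regpow p k = (fun z => (id * id + cst (r k) : R -> R) z `^ (p / 2))
    - cst (r k `^ (p / 2)) by apply/funext => z; rewrite /regpow expr2.
apply: (is_derive_eq d5).
rewrite /regpow_slope /GRing.scale/= !fctE/= expr2 !mulr1 subr0 addr0.
by move: (_ `^ _) => w; field.
Qed.

Let pos_powR_cvg (f : nat -> R) (a l : R) : 0 < l ->
  f k @[k --> \oo] --> l -> f k `^ a @[k --> \oo] --> l `^ a.
Proof.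
move=> l0 fl; have c : {for l, continuous (fun z : R => z `^ a)}.
  apply: differentiable_continuous; apply/derivable1_diffP.
  by have [] := is_derive1_powR a l0.
exact: (cvg_comp _ _ fl c).
Qed.

Let reg_cvg y : y ^+ 2 + r k @[k --> \oo] --> y ^+ 2.
Proof. by rewrite -[X in _ --> X]addr0; apply: cvgD; [exact: cvg_cst|exact: r_cvg0]. Qed.

Lemma regpow_cvg p y : 0 < p -> regpow p k y @[k --> \oo] --> `|y| `^ p.
Proof.
move=> p0; have [->|y0] := eqVneq y 0.
  rewrite normr0 powR0 ?gt_eqF//; under eq_fun do rewrite regpow0.
  exact: cvg_cst.
rewrite -[X in _ --> X]subr0; apply: cvgB.
  rewrite -powR_sqr_half; apply: pos_powR_cvg; last exact: reg_cvg.
  by rewrite exprn_even_gt0.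
have p20 : 0 < p / 2 by rewrite divr_gt0.
exact: (cvg_at_rightP (fun a : R => a `^ (p / 2)) 0 0).1 (powR_cvg0 p20) _ (conj r_gt0 r_cvg0).
Qed.

Lemma regpow_slope_cvg p y : 1 < p ->
  regpow_slope p k y @[k --> \oo] --> p * (`|y| `^ (p - 2) * y).
Proof.
move=> p1; have [->|y0] := eqVneq y 0.
  by rewrite mulr0; under eq_fun do rewrite /regpow_slope mulr0; exact: cvg_cst.
apply: cvgM; first exact: cvg_cst.
apply: cvgM; last exact: cvg_cst.
have -> : `|y| `^ (p - 2) = (y ^+ 2) `^ (p / 2 - 1).
  by rewrite -powR_sqr_half; congr (_ `^ _); field.
apply: pos_powR_cvg; last exact: reg_cvg.
by rewrite exprn_even_gt0.
Qed.

Lemma smooth_on_regpow n (A : set 'rV[R]_n) f p k : open A -> smooth_on A f ->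
  smooth_on A (fun x => regpow p k (f x)).
Proof.
move=> oA sf; apply: smooth_onD => //; last exact: smooth_on_cst.
apply: smooth_on_powR => //.
apply: smooth_onD => //; last exact: smooth_on_cst.
by apply: (eq_smooth_on oA _ (smooth_onM oA sf sf)) => x _; rewrite expr2.
Qed.

End regularized_power.

(** * The distributional hypothesis for powers of a test function *)

Lemma le_1Dsqr (R : realType) (y : R) : y <= 1 + y ^+ 2.
Proof. nra. Qed.

Lemma cvgn_sum (R : realType) (I : Type) (r : seq I) (f : I -> nat -> R) (l : I -> R) :
  (forall i, f i j @[j --> \oo] --> l i) ->
  \sum_(i <- r) f i j @[j --> \oo] --> \sum_(i <- r) l i.
Proof.
move=> fl; elim: r => [|i r ih].
  by rewrite big_nil; under eq_fun do rewrite big_nil; exact: cvg_cst.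
by rewrite big_cons; under eq_fun do rewrite big_cons; exact: cvgD.
Qed.

Section weak_inequality_power.
Context (R : realType) (n : nat) (Omega K : set 'rV[R]_n).
Hypothesis (oO : open Omega) (K0 : K !=set0) (cK : closed K).
Local Notation d := (dist_to K).
Local Notation U := (Omega `\` K).
Local Notation mu := (lebesgue_rV R n).
Local Notation field := (dist_field K0 cK).
Local Notation e_ i := (delta_mx ord0 i : 'rV[R]_n).
Implicit Types (x : 'rV[R]_n) (i : 'I_n).

Lemma continuous_itv_bounded (f : R -> R) (a b : R) :
  (forall q, a <= q <= b -> {for q, continuous f}) ->
  exists2 C, 0 <= C & forall q, a <= q <= b -> `|f q| <= C.
Proof.
move=> cf; have [ab|ba] := leP a b; last first.
  exists 0 => // q /andP[aq qb]; have := le_lt_trans (le_trans aq qb) ba.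
  by rewrite ltxx.
have cnf : {within `[a, b], continuous (fun q => `|f q|)}.
  apply: continuous_in_subspaceT => q; rewrite inE/= in_itv/= => qab.
  by apply: (@continuous_comp _ _ _ f Num.norm); [exact: cf|exact: norm_continuous].
have [z _ hz] := EVT_max ab cnf.
by exists `|f z| => // q qab; apply: hz; rewrite in_itv.
Qed.

Variables (c : R) (k : nat).
Hypothesis superharm : distr_ge0 c k d U.

Variables (T : R) (g dg : R -> R).
Hypothesis dO : forall x, Omega x -> d x ^+ 2 < T.
Hypothesis dgE : forall q : R, 0 < q < T -> is_derive q (1 : R) g (dg q).
Hypothesis dg_cont : forall q : R, 0 < q < T -> {for q, continuous dg}.
Hypothesis g_ge0 : forall q : R, 0 < q < T -> 0 <= g q.
Hypothesis g_smooth : forall (A : set 'rV[R]_n) (f : 'rV[R]_n -> R), open A ->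
  (forall x, A x -> 0 < f x < T) -> smooth_on A f -> smooth_on A (fun x => g (f x)).

Variables (p : R) (u : 'rV[R]_n -> R).
Hypothesis (p1 : 1 < p) (tu : test_function U u).

Let p0 : 0 < p. Proof. exact: lt_trans p1. Qed.

Let mU : measurable U.
Proof.
by apply: open_measurable_rV; rewrite setDE; apply: openI => //; exact: closed_openC.
Qed.

Let dU x : U x -> 0 < d x ^+ 2 < T.
Proof.
by move=> [Ox Kx]; rewrite dO// andbT exprn_gt0//; exact: dist_to_gt0.
Qed.

(** The value of $d \nabla d \cdot \nabla \varphi + k \varphi$, outside the
   ridges, for $\varphi = g(d^2) |u|^p$. *)
Definition power_integrand x : R :=
  (2 * d x ^+ 2 * dg (d x ^+ 2) + k%:R * g (d x ^+ 2)) * `|u x| `^ p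
  + g (d x ^+ 2) * (p * (`|u x| `^ (p - 2) * u x)) * dotp (field x) (grad u x).

Let g_cont q : 0 < q < T -> {for q, continuous g}.
Proof.
move=> qT; apply: differentiable_continuous; apply/derivable1_diffP.
by have [] := dgE qT.
Qed.

Let comp_d2_measurable (f : R -> R) :
  (forall q : R, 0 < q < T -> {for q, continuous f}) ->
  measurable_fun U (fun x => f (d x ^+ 2)).
Proof.
move=> cf; apply: (@measurable_comp _ _ _ _ _ _ `]0, T[%classic) => //.
- by move=> _ [x Ux <-]; rewrite /= in_itv/= dU.
- apply: open_continuous_measurable_fun; first exact: interval_open.
  by move=> q; rewrite inE/= in_itv/=; exact: cf.
- apply: (measurable_funS measurableT (@subsetT _ _)).
  by apply: continuous_measurable_rV; exact: continuous_sqr_dist_to.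
Qed.

Let mpower : measurable_fun U power_integrand.
Proof.
have [su _ _] := tu; have mu' : measurable_fun U u by exact: measurable_smooth.
have mabs : measurable_fun U (fun x => `|u x|) by exact: measurableT_comp.
have md2 : measurable_fun U (fun x => d x ^+ 2).
  apply: (measurable_funS measurableT (@subsetT _ _)).
  by apply: continuous_measurable_rV; exact: continuous_sqr_dist_to.
have mg := comp_d2_measurable g_cont; have mdg := comp_d2_measurable dg_cont.
apply: measurable_funD.
  apply: measurable_funM; last exact: (measurableT_comp (measurable_powR _)).
  apply: measurable_funD; last exact: measurable_funM.
  by apply: measurable_funM => //; exact: measurable_funM.
apply: measurable_funM; last first.
  by apply: measurable_dotp_field => i; exact: measurable_pderiv.
apply: measurable_funM => //; apply: measurable_funM => //.
by apply: measurable_funM => //; exact: (measurableT_comp (measurable_powR _)).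
Qed.

(** The function $g(d^2) |u|^p$ is not smooth.  It is replaced by
   $g(\Phi_j)$ times a regularized power of $u$, where $\Phi_j$ is a smooth
   minimum: its derivatives stay bounded on the support of $u$ and converge
   off the ridges, hence almost everywhere, so that dominated convergence
   applies. *)
Lemma weak_inequality_power :
  mu.-integrable U (EFin \o power_integrand) /\
  c * (\int[mu]_(x in U) power_integrand x)%R <= 0.
Proof.
have [su cS SU] := tu.
have [rho [Cu [rho0 Cu0 uC duC Srho]]] := test_function_bounds tu.
have [Psi [C [sPsi Psi_ge Psi_le dPsi_le Psi_sc]]] := sqr_dist_to_approx K0 cK rho0.
have suppU x : supp u x -> U x by move=> /SU.
have [a [b [a0 bT hab]]] : exists a b : R,
    [/\ 0 < a, b < T & forall x, supp u x -> a <= d x ^+ 2 <= b].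
  have [S0|/set0P S0] := eqVneq (supp u) set0.
    by exists 1, (T - 1); split; rewrite ?gtrBl// => x; rewrite S0.
  have cd : {within supp u, continuous (fun x => d x ^+ 2)}.
    by apply: continuous_subspaceT; exact: continuous_sqr_dist_to.
  have [y yS hy] := EVT_min_rV S0 cS cd.
  have [z zS hz] := EVT_max_rV S0 cS cd.
  move: yS zS; rewrite !inE => yS zS.
  have /andP[y0 _] := dU (suppU _ yS); have /andP[_ zT] := dU (suppU _ zS).
  exists (d y ^+ 2), (d z ^+ 2); split=> // x xS.
  by rewrite hy ?hz ?inE.
(* discarding k0 terms keeps the approximations of d^2 below T on the support *)
pose b' := (b + T) / 2.
have [bb' b'T] : b < b' /\ b' < T by rewrite /b' !midf_lt.
have C0 : 0 <= C.
  have h0 : `|0 : 'rV[R]_n| <= rho + 1 by rewrite normr0 addr_ge0.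
  have := le_trans (Psi_ge 0%N 0) (Psi_le 0%N 0 h0).
  by rewrite divr1 lerDl.
have [k0 hk0] : exists k0, forall j, C / (j + k0).+1%:R <= b' - b.
  have ct : 0 < (b' - b) / (C + 1) by rewrite divr_gt0 ?subr_gt0// ltr_wpDl.
  have [N hN] := natSinv_lt ct.
  exists N => j; have /ltW h := hN (j + N)%N (leq_addl _ _).
  have C10 : C + 1 != 0 by rewrite gt_eqF// ltr_wpDl.
  rewrite -[leRHS](divfK C10) mulrC; apply: ler_pM => //.
  by rewrite lerDl.
pose Phi j := Psi (j + k0)%N.
have Phi_itv j x : supp u x -> a <= Phi j x <= b'.
  move=> xS; have /andP[h1 h2] := hab x xS.
  rewrite (le_trans h1 (Psi_ge _ _))/=.
  have xr : `|x| <= rho + 1 by rewrite ler_wpDr// Srho.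
  apply: (le_trans (Psi_le (j + k0)%N x xr)).
  by apply: (le_trans (lerD h2 (hk0 j))); rewrite addrC subrK.
have itvT q : a <= q <= b' -> 0 < q < T.
  by move=> /andP[aq qb]; rewrite (lt_le_trans a0 aq) (le_lt_trans qb b'T).
have [G0 G00 hG0] := continuous_itv_bounded (fun q h => g_cont (itvT q h)).
have [G1 G10 hG1] := continuous_itv_bounded (fun q h => dg_cont (itvT q h)).
pose A j := [set x | 0 < Phi j x < T].
have oA j : open (A j).
  have cPhi : continuous (Phi j) by apply: smooth_continuous; apply/smoothP; exact: sPsi.
  rewrite (_ : A j = Phi j @^-1` `]0, T[%classic).
    by apply: (continuousP _).1 => //; exact: interval_open.
  by apply/seteqP; split => x; rewrite /A/= in_itv.
have SA j x : supp u x -> A j x by move=> xS; exact/itvT/Phi_itv.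
have oS : open (~` supp u) by apply: closed_openC; exact: closed_closure.
pose phi j x := g (Phi j x) * regpow p j (u x).
have phi0 j x : ~ supp u x -> phi j x = 0.
  by move=> xS; rewrite /phi (supp_notin xS) regpow0 mulr0.
have sgA j : smooth_on (A j) (fun x => g (Phi j x)).
  by apply: g_smooth => //; apply: smooth_onS (sPsi _).
have srA j (B : set 'rV[R]_n) : open B -> smooth_on B (fun x => regpow p j (u x)).
  move=> oB; apply: smooth_on_regpow => //.
  by apply: smooth_onS (@subsetT _ B) _; exact/smoothP.
have sphi j : smooth (phi j).
  (* g (Phi j) need not be smooth outside A j, but there phi j vanishes *)
  apply/smoothP; have h : smooth_on (A j `|` ~` supp u) (phi j).
    apply: smooth_onU.
      by apply: smooth_onM => //; exact: srA.
    apply: eq_smooth_on (smooth_on_cst _ 0) => // x xS.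
    by rewrite phi0.
  apply: smooth_onS h => x _; have [xS|xS] := pselect (supp u x).
    by left; exact: SA.
  by right.
have suppphi j : supp (phi j) `<=` supp u.
  have cl : supp u = closure (supp u) by apply/closure_id; exact: closed_closure.
  rewrite [X in _ `<=` X]cl; apply: closureS => x /= px; apply: contrapT => xS.
  by move: px; rewrite phi0// eqxx.
have tphi j : test_function U (phi j).
  split; [exact: sphi| |by move=> x /suppphi /SU].
  exact: (subclosed_compact (@closed_closure _ _) cS (suppphi j)).
have phi_ge0 j x : 0 <= phi j x.
  have [xS|xS] := pselect (supp u x); last by rewrite phi0.
  by rewrite mulr_ge0 ?regpow_ge0// g_ge0//; exact/itvT/Phi_itv.
have dphi j x i : supp u x -> pderiv i (phi j) x =
    dg (Phi j x) * pderiv i (Phi j) x * regpow p j (u x)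
    + g (Phi j x) * (regpow_slope p j (u x) * pderiv i u x).
  move=> xS; have PhiT := itvT _ (Phi_itv j x xS).
  have dP : is_derive x (e_ i) (Phi j) (pderiv i (Phi j) x).
    apply/derivableP/diff_derivable.
    exact: (diff_upto_differentiable (sPsi _ 0%N)).
  have du : is_derive x (e_ i) u (pderiv i u x).
    by apply/derivableP/diff_derivable; exact: (su [::] x).
  have D1 := is_derive_chain dP (dgE PhiT).
  have D2 := is_derive_chain du (is_derive_regpow p j (u x)).
  have [_ h] := is_deriveM D1 D2; apply: (eq_trans h).
  by rewrite /GRing.scale/= addrC [regpow p j (u x) * _]mulrC.
pose F j x := dotp (field x) (grad (phi j) x) + k%:R * phi j x.
have FE j x : supp u x -> F j x =
    dg (Phi j x) * regpow p j (u x) * (\sum_i field x ord0 i * pderiv i (Phi j) x)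
    + g (Phi j x) * regpow_slope p j (u x) * dotp (field x) (grad u x)
    + k%:R * (g (Phi j x) * regpow p j (u x)).
  move=> xS; rewrite /F; congr (_ + _).
  rewrite /dotp !mulr_sumr -big_split/=; apply: eq_bigr => i _.
  by rewrite !mxE dphi//; ring.
have F0 j x : ~ supp u x -> F j x = 0.
  move=> xS; rewrite /F phi0// mulr0 addr0; apply: big1 => i _.
  rewrite [grad _ _ _ _]mxE pderiv_supp_notin ?mulr0// => /suppphi.
  exact: xS.
have mF j : measurable_fun U (F j).
  apply: measurable_funD.
    by apply: measurable_dotp_field => i; exact: measurable_pderiv.
  by apply: measurable_funM => //; exact: measurable_smooth.
pose V := (Cu ^+ 2 + 1) `^ (p / 2); pose W := p * (Cu ^+ 2 + 1) `^ ((p - 1) / 2).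
pose E := G1 * V * (\sum_(i < n) (1 + T) * C) + G0 * W * (\sum_(i < n) (1 + T) * Cu)
  + k%:R * (G0 * V).
have V0 : 0 <= V by exact: powR_ge0.
have W0 : 0 <= W by rewrite mulr_ge0 ?powR_ge0// ltW.
have T0 x : supp u x -> d x <= 1 + T.
  move=> xS; have /andP[_ dT] := dU (suppU x xS).
  have d0 := dist_to_ge0 K0 cK x; apply: (@le_trans _ _ (1 + d x ^+ 2)).
    exact: le_1Dsqr.
  by rewrite lerD2l ltW.
have FC j x : `|F j x| <= Num.max E 0.
  have [xS|xS] := pselect (supp u x); last by rewrite F0// normr0 le_max lexx orbT.
  rewrite le_max; apply/orP; left; rewrite FE//.
  have PhiI := Phi_itv j x xS.
  have rV : `|regpow p j (u x)| <= V.
    by rewrite ger0_norm ?regpow_ge0// regpow_le.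
  have rW : `|regpow_slope p j (u x)| <= W by exact: regpow_slope_le.
  have fT i : `|field x ord0 i| <= 1 + T.
    by apply: (le_trans (dist_field_le K0 cK x i)); exact: T0.
  apply: (le_trans (ler_normD _ _)); apply: lerD; last first.
    rewrite normrM (ger0_norm (ler0n _ _)) ler_wpM2l// normrM.
    by apply: ler_pM => //; exact: hG0.
  apply: (le_trans (ler_normD _ _)); apply: lerD.
    rewrite normrM; apply: ler_pM => //.
      by rewrite normrM; apply: ler_pM => //; exact: hG1.
    apply: (le_trans (ler_norm_sum _ _ _)); apply: ler_sum => i _.
    by rewrite normrM; apply: ler_pM => //; apply: dPsi_le; exact: Srho.
  rewrite normrM; apply: ler_pM => //.
    by rewrite normrM; apply: ler_pM => //; exact: hG0.
  apply: (le_trans (ler_norm_sum _ _ _)); apply: ler_sum => i _.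
  by rewrite normrM; apply: ler_pM => //; rewrite mxE.
have Fcvg x : U x -> ~ ridges K x -> F j x @[j --> \oo] --> power_integrand x.
  move=> Ux xr; have [xS|xS] := pselect (supp u x); last first.
    rewrite (_ : power_integrand x = 0).
      by under eq_fun do rewrite F0//; exact: cvg_cst.
    rewrite /power_integrand (supp_notin xS) normr0 powR0 ?gt_eqF//.
    by rewrite !mulr0 mul0r addr0.
  under eq_fun do rewrite FE//.
  have dT := dU Ux.
  have Phicvg : Phi j x @[j --> \oo] --> d x ^+ 2.
    have sq : d x ^+ 2 + C / (j + k0).+1%:R @[j --> \oo] --> d x ^+ 2.
      rewrite -[X in _ --> X]addr0; apply: cvgD; first exact: cvg_cst.
      rewrite -[X in _ --> X](mulr0 C); apply: cvgM; first exact: cvg_cst.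
      by have := @cvg_harmonic R; rewrite -(cvg_shiftn k0).
    apply: squeeze_cvgr (cvg_cst _) sq; apply: nearW => j.
    by rewrite Psi_ge/=; apply: Psi_le; rewrite ler_wpDr// Srho.
  have gcvg : g (Phi j x) @[j --> \oo] --> g (d x ^+ 2).
    exact: (cvg_comp _ _ Phicvg (g_cont dT)).
  have dgcvg : dg (Phi j x) @[j --> \oo] --> dg (d x ^+ 2).
    exact: (cvg_comp _ _ Phicvg (dg_cont dT)).
  have rcvg : regpow p j (u x) @[j --> \oo] --> `|u x| `^ p by exact: regpow_cvg.
  have scvg : regpow_slope p j (u x) @[j --> \oo] --> p * (`|u x| `^ (p - 2) * u x).
    exact: regpow_slope_cvg.
  have slcvg : \sum_i field x ord0 i * pderiv i (Phi j) x @[j --> \oo]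
      --> 2 * d x ^+ 2.
    rewrite -(dist_to_offset K0 cK) mulr_sumr; apply: cvgn_sum => i.
    have xri : ~ ridge K i x.
      move=> xi; apply: xr; rewrite /ridges -bigcup_seq.
      by exists i => //=; rewrite mem_index_enum.
    have -> : 2 * (offset K0 cK x ord0 i * offset K0 cK x ord0 i) =
        field x ord0 i * (2 * offset K0 cK x ord0 i).
      by rewrite dist_field_offset//; ring.
    apply: cvgM; first exact: cvg_cst.
    have := cvg_slope_off_ridge Psi_ge Psi_le Psi_sc (Srho x xS) xri.
    by move=> /(_ K0 cK); rewrite -(cvg_shiftn k0).
  rewrite (_ : power_integrand x =
      dg (d x ^+ 2) * `|u x| `^ p * (2 * d x ^+ 2)
      + g (d x ^+ 2) * (p * (`|u x| `^ (p - 2) * u x)) * dotp (field x) (grad u x)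
      + k%:R * (g (d x ^+ 2) * `|u x| `^ p)); last first.
    by rewrite /power_integrand; ring.
  apply: cvgD; last first.
    by apply: cvgM; [exact: cvg_cst|exact: cvgM].
  apply: cvgD; first by apply: cvgM => //; exact: cvgM.
  by apply: cvgM; [exact: cvgM|exact: cvg_cst].
have Frho j x : U x -> rho < `|x| -> F j x = 0.
  by move=> _ rx; apply: F0 => /Srho; rewrite leNgt rx.
have Fae : exists2 N, measurable N /\ mu N = 0 &
    forall x, U x -> ~ N x -> F j x @[j --> \oo] --> power_integrand x.
  exists (ridges K); last exact: Fcvg.
  by split; [exact: measurable_ridges|exact: ridges_null].
have [iL cvgL] := bounded_support_cvg mU mF mpower (fun j x _ => FC j x) Frho Fae.
split=> //.
have : c * (\int[mu]_(x in U) F j x)%R @[j --> \oo] -->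
    c * (\int[mu]_(x in U) power_integrand x)%R.
  by apply: cvgM => //; exact: cvg_cst.
move=> h; apply: (ler_cvg_to h (cvg_cst (0 : R))); apply: nearW => j.
exact: (@weak_inequality_test _ _ _ _ oO K0 cK _ _ superharm _ (tphi j) (phi_ge0 j)).
Qed.

End weak_inequality_power.

(** * The radial test function *)

Section radial_profile.
Context (R : realType) (m : nat) (alpha beta gamma a b : R).
Implicit Types t q : R.

Local Notation eta := (@eta_fin R m).
Local Notation zeta := (@zeta_fin R m).
Local Notation wt := (weight alpha beta gamma (Some m)).

(** The radial part of the vector field to which Hardy's inequality is
   reduced, relative to the one for the inequality without logarithms. *)
Definition profile t : R := wt t + a * eta t + b * eta t ^+ 2.

(** This is $t$ times the derivative of [profile]. *)
Definition profile_slope t : R :=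
  (alpha + a) * (eta t ^+ 2 + zeta t) / 2 + (beta + b) * eta t * (eta t ^+ 2 + zeta t)
  + 2 * gamma * xi_fin m t.

Lemma is_derive_profile t : 0 < t < 1 ->
  is_derive t (1 : R) profile (profile_slope t / t).
Proof.
move=> t01; have de := is_derive_eta_fin m t01; have dz := is_derive_zeta_fin m t01.
have de2 := is_deriveM de de.
have D := is_deriveD (is_deriveD (is_deriveD (is_deriveD (is_deriveD
  (is_derive_cst (1 : R) t (1 : R)) (is_deriveZ alpha de)) (is_deriveZ beta de2))
  (is_deriveZ gamma dz)) (is_deriveZ a de)) (is_deriveZ b de2).
have -> : profile = cst 1 + alpha *: (eta : R -> R) + beta *: (eta * eta : R -> R)
    + gamma *: (zeta : R -> R) + a *: (eta : R -> R) + b *: (eta * eta : R -> R).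
  by apply/funext => z; rewrite /profile /weight /= !expr2.
apply: (is_derive_eq D); rewrite /GRing.scale/= /profile_slope.
move: (eta t) (zeta t) (xi_fin m t) => e z x; case/andP: t01 => t0 _.
by field; rewrite gt_eqF.
Qed.

Let continuous_derive (f : R -> R) t l : is_derive t (1 : R) f l -> {for t, continuous f}.
Proof.
by move=> D; apply: differentiable_continuous; apply/derivable1_diffP; have [] := D.
Qed.

Lemma continuous_eta_fin t : 0 < t < 1 -> {for t, continuous eta}.
Proof. by move=> t01; exact: continuous_derive (is_derive_eta_fin m t01). Qed.

Lemma continuous_zeta_fin t : 0 < t < 1 -> {for t, continuous zeta}.
Proof. by move=> t01; exact: continuous_derive (is_derive_zeta_fin m t01). Qed.

Lemma continuous_xi_fin j t : 0 < t < 1 -> {for t, continuous (@xi_fin R j)}.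
Proof.
move=> t01; elim: j => [|j ih].
  rewrite (_ : @xi_fin R 0 = cst 0); first exact: cst_continuous.
  by apply/funext => x; rewrite xi_fin0.
have cY : Ylog j.+1 x @[x --> t] --> Ylog j.+1 t.
  exact: continuous_derive (is_derive_Ylog j.+1 t01).
have ce : eta_fin j.+1 x @[x --> t] --> eta_fin j.+1 t.
  exact: continuous_derive (is_derive_eta_fin j.+1 t01).
have cx : xi_fin j x @[x --> t] --> xi_fin j t by exact: ih.
rewrite (_ : @xi_fin R j.+1 =
  (fun x => xi_fin j x + Ylog j.+1 x * Ylog j.+1 x * eta_fin j.+1 x)).
  exact: (cvgD cx (cvgM (cvgM cY cY) ce)).
by apply/funext => x; rewrite xi_finS expr2.
Qed.

Lemma continuous_profile_slope t : 0 < t < 1 -> {for t, continuous profile_slope}.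
Proof.
move=> t01.
have ce : eta x @[x --> t] --> eta t by exact: continuous_eta_fin.
have cz : zeta x @[x --> t] --> zeta t by exact: continuous_zeta_fin.
have cx : xi_fin m x @[x --> t] --> xi_fin m t by exact: continuous_xi_fin.
pose s x : R := eta x * eta x + zeta x.
have cs : s x @[x --> t] --> s t by exact: (cvgD (cvgM ce ce) cz).
have c1 : (alpha + a) * s x / 2 @[x --> t] --> (alpha + a) * s t / 2.
  by apply: cvgM; [apply: cvgM => //; exact: cvg_cst|exact: cvg_cst].
have c2 : (beta + b) * eta x * s x @[x --> t] --> (beta + b) * eta t * s t.
  by apply: cvgM => //; apply: cvgM => //; exact: cvg_cst.
have c3 : 2 * gamma * xi_fin m x @[x --> t] --> 2 * gamma * xi_fin m t.
  by apply: cvgM => //; exact: cvg_cst.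
rewrite (_ : profile_slope = (fun t => (alpha + a) * s t / 2
    + (beta + b) * eta t * s t + 2 * gamma * xi_fin m t)).
  exact: (cvgD (cvgD c1 c2) c3).
by apply/funext => x; rewrite /profile_slope !expr2.
Qed.

Variables (D r : R).
Hypothesis D0 : 0 < D.

(** The function of $q = d^2$ for which the distributional inequality is
   tested; in terms of $d$ it is $d^{2r}$ times the profile at $d/D$. *)
Definition testfun q : R := q `^ r * profile (q `^ 2^-1 / D).

(** The derivative of [testfun], arranged so that $2 q$ times it is visible. *)
Definition testfun_slope q : R :=
  q `^ r * (2 * r * profile (q `^ 2^-1 / D) + profile_slope (q `^ 2^-1 / D)) / (2 * q).

Let radius_derive q : 0 < q ->
  is_derive q (1 : R) (fun q => q `^ 2^-1 / D) (q `^ 2^-1 / D / (2 * q)).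
Proof.
move=> q0; have d1 := is_deriveZ D^-1 (is_derive1_powR 2^-1 q0).
have -> : (fun q => q `^ 2^-1 / D) = D^-1 *: (fun q : R => q `^ 2^-1).
  by apply/funext => z; rewrite /= mulrC.
apply: (is_derive_eq d1); rewrite /GRing.scale/=.
rewrite powRB; last by apply/implyP => _; rewrite gt_eqF.
rewrite powRr1 ?(ltW q0)//; move: (q `^ _) => w.
by field; rewrite !gt_eqF.
Qed.

Lemma is_derive_testfun q : 0 < q -> q `^ 2^-1 / D < 1 ->
  is_derive q (1 : R) testfun (testfun_slope q).
Proof.
move=> q0 qD; set t := q `^ 2^-1 / D in qD.
have t0 : 0 < t by rewrite divr_gt0// powR_gt0.
have t01 : 0 < t < 1 by rewrite t0.
have d2 := is_derive_chain (radius_derive q0) (is_derive_profile t01).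
have D1 := is_deriveM (is_derive1_powR r q0) d2.
have -> : testfun = (fun q : R => q `^ r) * (fun q => profile (q `^ 2^-1 / D)).
  by [].
apply: (is_derive_eq D1); rewrite /GRing.scale/= /testfun_slope -/t.
rewrite powRB; last by apply/implyP => _; rewrite gt_eqF.
rewrite powRr1 ?(ltW q0)//; move: (q `^ _) (profile t) (profile_slope t) => w f df.
by field; rewrite !gt_eqF.
Qed.

Lemma continuous_testfun_slope q : 0 < q -> q `^ 2^-1 / D < 1 ->
  {for q, continuous testfun_slope}.
Proof.
move=> q0 qD; set t := q `^ 2^-1 / D in qD.
have t0 : 0 < t by rewrite divr_gt0// powR_gt0.
have t01 : 0 < t < 1 by rewrite t0.
have ct : x `^ 2^-1 / D @[x --> q] --> t by exact: continuous_derive (radius_derive q0).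
have cp : x `^ r @[x --> q] --> q `^ r.
  exact: continuous_derive (is_derive1_powR r q0).
have cf : profile (x `^ 2^-1 / D) @[x --> q] --> profile t.
  exact: (cvg_comp _ _ ct (continuous_derive (is_derive_profile t01))).
have cs : profile_slope (x `^ 2^-1 / D) @[x --> q] --> profile_slope t.
  exact: (cvg_comp _ _ ct (continuous_profile_slope t01)).
have cq : (2 * x)^-1 @[x --> q] --> (2 * q)^-1.
  apply: cvgV; first by rewrite gt_eqF// mulr_gt0.
  by apply: cvgM; [exact: cvg_cst|exact: cvg_id].
exact: (cvgM (cvgM cp (cvgD (cvgM (cvg_cst (2 * r)) cf) cs)) cq).
Qed.

Section profile_smooth.
Context (n : nat) (A : set 'rV[R]_n).
Hypothesis oA : open A.

Lemma smooth_on_Xlog j (f : 'rV[R]_n -> R) : (forall x, A x -> 0 < f x < 1) ->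
  smooth_on A f -> smooth_on A (fun x => Xlog j (f x)).
Proof.
move=> f01 sf; elim: j => [|j ih] //.
have X01 x : A x -> 0 < Xlog j (f x) < 1 by move=> /f01; exact: Xlog_itv.
apply: (eq_smooth_on oA (f := fun x => (1 + (-1) * ln (Xlog j (f x)))^-1)).
  by move=> x /X01/andP[X0 _]; rewrite XlogS /X1 X0 mulN1r.
apply: smooth_on_inv => // [x /X01 h|].
  by have := ln_lt0 h; lra.
apply: smooth_onD => //; first exact: smooth_on_cst.
apply: smooth_onZ => //; apply: smooth_on_ln => // x /X01.
by case/andP.
Qed.

Lemma smooth_on_Ylog j (f : 'rV[R]_n -> R) : (forall x, A x -> 0 < f x < 1) ->
  smooth_on A f -> smooth_on A (fun x => Ylog j (f x)).
Proof.
move=> f01 sf; elim: j => [|j ih].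
  by apply: eq_smooth_on (smooth_on_cst A 1) => // x _; rewrite Ylog0.
apply: eq_smooth_on (smooth_onM oA ih (smooth_on_Xlog j.+1 f01 sf)) => // x _.
by rewrite YlogS.
Qed.

Lemma smooth_on_eta_fin j (f : 'rV[R]_n -> R) : (forall x, A x -> 0 < f x < 1) ->
  smooth_on A f -> smooth_on A (fun x => eta_fin j (f x)).
Proof.
move=> f01 sf; elim: j => [|j ih].
  by apply: eq_smooth_on (smooth_on_cst A 0) => // x _; rewrite eta_fin0.
apply: eq_smooth_on (smooth_onD oA ih (smooth_on_Ylog j.+1 f01 sf)) => // x _.
by rewrite eta_finS.
Qed.

Lemma smooth_on_zeta_fin j (f : 'rV[R]_n -> R) : (forall x, A x -> 0 < f x < 1) ->
  smooth_on A f -> smooth_on A (fun x => zeta_fin j (f x)).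
Proof.
move=> f01 sf; elim: j => [|j ih].
  by apply: eq_smooth_on (smooth_on_cst A 0) => // x _; rewrite zeta_fin0.
have sY := smooth_on_Ylog j.+1 f01 sf.
apply: eq_smooth_on (smooth_onD oA ih (smooth_onM oA sY sY)) => // x _.
by rewrite zeta_finS expr2.
Qed.

Lemma smooth_on_testfun (f : 'rV[R]_n -> R) :
  (forall x, A x -> 0 < f x /\ f x `^ 2^-1 / D < 1) ->
  smooth_on A f -> smooth_on A (fun x => testfun (f x)).
Proof.
move=> fD sf; have f0 x : A x -> 0 < f x by move=> /fD[].
pose t x := D^-1 * f x `^ 2^-1.
have st : smooth_on A t by apply: smooth_onZ => //; exact: smooth_on_powR.
have t01 x : A x -> 0 < t x < 1.
  move=> Ax; have [fx0 h] := fD x Ax; rewrite /t mulrC h andbT.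
  by rewrite divr_gt0// powR_gt0.
have se := smooth_on_eta_fin m t01 st; have sz := smooth_on_zeta_fin m t01 st.
have se2 := smooth_onM oA se se.
have sw := smooth_onD oA (smooth_onD oA (smooth_onD oA (smooth_onD oA (smooth_onD oA
  (smooth_on_cst A 1) (smooth_onZ oA alpha se)) (smooth_onZ oA beta se2))
  (smooth_onZ oA gamma sz)) (smooth_onZ oA a se)) (smooth_onZ oA b se2).
apply: (eq_smooth_on oA _ (smooth_onM oA (smooth_on_powR oA r f0 sf) sw)) => x Ax.
by rewrite /testfun /profile /weight /= -!expr2 /t [D^-1 * _]mulrC.
Qed.

End profile_smooth.

End radial_profile.

(** * Young's inequality for the integrands *)

Section hardy_pointwise.
Context (R : realType).
Implicit Types p H : R.

Lemma normr_powR_split p H : H != 0 ->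
  `|H| `^ p = `|H| `^ (p - 2) * H ^+ 2 /\ `|H| `^ (p - 1) = `|H| `^ (p - 2) * `|H|.
Proof.
move=> H0; have nH : `|H| != 0 by rewrite normr_eq0.
split.
  rewrite -real_normK ?num_real// -powR_mulrn// -powRD ?nH ?implybT//.
  by congr (_ `^ _); ring.
rewrite -[X in _ = _ * X]powRr1// -powRD ?nH ?implybT//.
by congr (_ `^ _); ring.
Qed.

(** With $N = d \nabla d \cdot \nabla u$, the last term is absorbed by the
   gradient term through Young's inequality for $y = |\nabla u|$ and the
   point $X = |H| |u| (f/w)^{1/(p-1)} / d$, chosen for the weights to match;
   the price is $(p-1) w (f/w)^{p/(p-1)}$ on the right of [target]. *)
Lemma hardy_pointwise p H s w f df target dx ux y N : 1 < p -> H != 0 ->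
  0 < dx -> 0 < w -> 0 < f -> 0 <= y -> `|N| <= dx * y ->
  target <= p * f + df / H - (p - 1) * w * (f / w) `^ (p / (p - 1)) ->
  `|H| `^ p * target * (dx `^ (s - p) * `|ux| `^ p) <=
  dx `^ s * w * y `^ p + `|H| `^ (p - 2) * H *
    (dx `^ (s - p) * (p * H * f + df) * `|ux| `^ p
     + dx `^ (s - p) * f * (p * (`|ux| `^ (p - 2) * ux)) * N).
Proof.
move=> p1 H0 d0 w0 f0 y0 Ny htarget.
have p0 : 0 < p by lra.
have p10 : 0 < p - 1 by lra.
have dn0 : dx != 0 by rewrite gt_eqF.
have [HpE Hp1E] := normr_powR_split p H0.
have [fw fwE] : exists fw, fw = f / w by exists (f / w).
have fw0 : 0 < fw by rewrite fwE divr_gt0.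
rewrite -fwE in htarget.
pose X := `|H| * `|ux| * fw `^ (p - 1)^-1 * dx^-1.
have X0 : 0 <= X by rewrite !mulr_ge0 ?powR_ge0 ?invr_ge0// ltW.
have XE r : X `^ r = `|H| `^ r * `|ux| `^ r * fw `^ ((p - 1)^-1 * r) * dx `^ (- r).
  have di0 : 0 <= dx^-1 by rewrite invr_ge0 ltW.
  have -> : dx `^ (- r) = dx^-1 `^ r by rewrite -(powR_inv1 (ltW d0)) -powRrM mulN1r.
  by rewrite !powRM ?mulr_ge0 ?powR_ge0// (powRrM fw).
have Yg := powR_young p1 X0 y0; rewrite !XE mulVf ?gt_eqF// in Yg.
rewrite powRr1 ?(ltW fw0)// [(p - 1)^-1 * p]mulrC Hp1E HpE in Yg.
have ds0 : 0 <= dx `^ s * w by rewrite mulr_ge0 ?powR_ge0// ltW.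
have {Yg} := ler_wpM2l ds0 Yg.
have dE1 : dx `^ s * dx `^ (- (p - 1)) = dx `^ (s - p) * dx.
  rewrite -[X in _ = _ * X]powRr1 ?(ltW d0)// -!powRD ?dn0 ?implybT//.
  by congr (_ `^ _); ring.
have dE2 : dx `^ s * dx `^ (- p) = dx `^ (s - p).
  by rewrite -powRD ?dn0 ?implybT.
have v1E : `|ux| `^ (p - 1) = `|ux| `^ (p - 2) * `|ux|.
  rewrite mulrC (_ : p - 2 = p - 1 - 1); last by ring.
  by rewrite mulr_powRB1.
set Q := fw `^ (p / (p - 1)) in htarget *.
set d1 := dx `^ (s - p) in dE1 dE2 *; set ds := dx `^ s in ds0 dE1 dE2 *.
set dm1 := dx `^ (- (p - 1)) in dE1 *; set dm := dx `^ (- p) in dE2 *.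
set h2 := `|H| `^ (p - 2) in HpE Hp1E *.
set v1 := `|ux| `^ (p - 1) in v1E *; set vp := `|ux| `^ p.
set v2 := `|ux| `^ (p - 2) in v1E *; set yp := y `^ p.
move=> Yg.
have {}Yg : p * y * (h2 * `|H|) * v1 * f * (d1 * dx) <=
    ds * w * yp + (p - 1) * w * (h2 * H ^+ 2) * vp * Q * d1.
  move: Yg; rewrite -dE1 -dE2.
  have -> : ds * w * (p * y * (h2 * `|H| * v1 * fw * dm1)) =
    p * y * (h2 * `|H|) * v1 * f * (ds * dm1).
    by rewrite fwE; field; rewrite gt_eqF.
  have -> : ds * w * (yp + (p - 1) * (h2 * H ^+ 2 * vp * Q * dm)) =
    ds * w * yp + (p - 1) * w * (h2 * H ^+ 2) * vp * Q * (ds * dm) by ring.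
  by [].
have d10 : 0 <= d1 by exact: powR_ge0.
have h20 : 0 <= h2 by exact: powR_ge0.
have vp0 : 0 <= vp by exact: powR_ge0.
have v20 : 0 <= v2 by exact: powR_ge0.
have term2 : - (p * y * (h2 * `|H|) * v1 * f * (d1 * dx)) <=
    h2 * H * (d1 * f * (p * (v2 * ux)) * N).
  have : `|h2 * H * (d1 * f * (p * (v2 * ux)) * N)| <=
      p * y * (h2 * `|H|) * v1 * f * (d1 * dx).
    rewrite !normrM (ger0_norm h20) (ger0_norm d10) (ger0_norm v20).
    rewrite (gtr0_norm f0) (gtr0_norm p0) -v1E.
    have -> : p * y * (h2 * `|H|) * v1 * f * (d1 * dx) =
      h2 * `|H| * (d1 * f * (p * v1) * (dx * y)) by ring.
    rewrite ler_wpM2l ?mulr_ge0// ler_wpM2l// !mulr_ge0 ?powR_ge0//.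
      exact: ltW.
    exact: ltW.
  by rewrite ler_norml => /andP[].
have c0 : 0 <= h2 * H ^+ 2 * (d1 * vp).
  by apply: mulr_ge0; apply: mulr_ge0 => //; exact: sqr_ge0.
have main := ler_wpM2l c0 htarget.
have E1 : h2 * H ^+ 2 * (d1 * vp) * (p * f + df / H - (p - 1) * w * Q) =
    h2 * H * (d1 * (p * H * f + df) * vp)
    - (p - 1) * w * (h2 * H ^+ 2) * vp * Q * d1 by field.
rewrite E1 in main.
rewrite HpE mulrDr.
have -> : h2 * H ^+ 2 * target * (d1 * vp) = h2 * H ^+ 2 * (d1 * vp) * target by ring.
clear -main term2 Yg; lra.
Qed.

End hardy_pointwise.

(** * Infinite sums of logarithms and integrability *)

Section infinite_logarithms.
Context (R : realType).
Implicit Types t e : R.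

(** Finite sums converging to the one for $m$; constant for $m$ finite. *)
Definition trunc (m : option nat) (j : nat) : nat := if m is Some m' then m' else j.

Lemma cvg_eta_log m t : 0 < t < 1 ->
  eta_fin (trunc m j) t @[j --> \oo] --> eta_log m t.
Proof.
case: m => [m|] t01 /=; first exact: cvg_cst.
apply: nondecreasing_is_cvgn.
  by move=> j l jl; exact: eta_fin_le.
by exists (4 / - ln t) => _ [j _ <-]; exact: eta_fin_bound.
Qed.

Lemma cvg_zeta_log m t : 0 < t < 1 ->
  zeta_fin (trunc m j) t @[j --> \oo] --> zeta_log m t.
Proof.
case: m => [m|] t01 /=; first exact: cvg_cst.
apply: nondecreasing_is_cvgn.
  by move=> j l jl; exact: zeta_fin_le.
exists (4 / - ln t) => _ [j _ <-].
exact: (le_trans (zeta_le_eta j t01) (eta_fin_bound j t01)).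
Qed.

Lemma eta_log0 m : eta_log m (0 : R) = 0.
Proof.
have X0 i : Xlog i.+1 (0 : R) = 0.
  by elim: i => [|i ih]; rewrite XlogS ?ih /X1 ltxx.
have e0 j : eta_fin j (0 : R) = 0.
  by elim: j => [|j ih]; rewrite ?eta_fin0// eta_finS ih YlogS X0 mulr0 addr0.
case: m => [m|] /=; first exact: e0.
by under eq_fun do rewrite e0; exact: lim_cst.
Qed.

Lemma zeta_log0 m : zeta_log m (0 : R) = 0.
Proof.
have X0 i : Xlog i.+1 (0 : R) = 0.
  by elim: i => [|i ih]; rewrite XlogS ?ih /X1 ltxx.
have z0 j : zeta_fin j (0 : R) = 0.
  elim: j => [|j ih]; rewrite ?zeta_fin0// zeta_finS ih YlogS X0 mulr0.
  by rewrite expr0n addr0.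
case: m => [m|] /=; first exact: z0.
by under eq_fun do rewrite z0; exact: lim_cst.
Qed.

Lemma log_sums_bounds m t e : 0 < e ->
  0 < t <= expR (- (4 / e)) -> t <= expR (- 1) ->
  [/\ 0 <= eta_log m t <= e, 0 <= zeta_log m t <= eta_log m t ^+ 2 &
      eta_log m t ^+ 2 <= 64 * zeta_log m t].
Proof.
move=> e0 te t1; have [t01 _] := eta_fin_small 0 e0 te.
have ce := @cvg_eta_log m t t01; have cz := @cvg_zeta_log m t t01.
have ce2 : eta_fin (trunc m j) t ^+ 2 @[j --> \oo] --> eta_log m t ^+ 2.
  by rewrite expr2; under eq_fun do rewrite expr2; exact: cvgM.
have t0 : 0 < t by case/andP: t01.
have c0 : (0 : R) @[j --> \oo] --> (0 : R) by exact: cvg_cst.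
split.
- apply/andP; split.
    by apply: (ler_cvg_to c0 ce); apply: nearW => j; exact: eta_fin_ge0.
  apply: (ler_cvg_to ce (cvg_cst e)); apply: nearW => j.
  by have [] := eta_fin_small (trunc m j) e0 te.
- apply/andP; split.
    by apply: (ler_cvg_to c0 cz); apply: nearW => j; exact: zeta_fin_ge0.
  by apply: (ler_cvg_to cz ce2); apply: nearW => j; exact: zeta_le_eta2.
- apply: (ler_cvg_to ce2 (cvgM (cvg_cst (64 : R)) cz)); apply: nearW => j.
  by apply: eta2_le_zeta; rewrite t0.
Qed.

End infinite_logarithms.

Section tame_functions.
Context (R : realType) (n : nat) (Omega K : set 'rV[R]_n).
Hypothesis (oO : open Omega) (K0 : K !=set0) (cK : closed K).
Local Notation d := (dist_to K).
Local Notation U := (Omega `\` K).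
Local Notation mu := (lebesgue_rV R n).
Implicit Types (x : 'rV[R]_n) (P h : 'rV[R]_n -> R).

Variables (u : 'rV[R]_n -> R).
Hypothesis tu : test_function U u.

Let mU : measurable U.
Proof.
by apply: open_measurable_rV; rewrite setDE; apply: openI => //; exact: closed_openC.
Qed.

(** The weights carrying $u$ in the integrals: multiplied by any bounded
   measurable function they are integrable, although $d$ may vanish or blow
   up under a negative power away from the support of $u$. *)
Definition tame P := [/\ measurable_fun U P,
  exists2 C, 0 <= C & forall x, `|P x| <= C & forall x, ~ supp u x -> P x = 0].

Lemma tameM_integrable P h B : tame P -> measurable_fun U h ->
  (forall x, U x -> `|h x| <= B) -> mu.-integrable U (EFin \o (fun x => P x * h x)).
Proof.
move=> [mP [C C0 PC] P0] mh hB.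
have [rho [_ [_ _ _ _ Srho]]] := test_function_bounds tu.
apply: (@bounded_support_integrable _ _ _ mU _ rho (C * B)).
- exact: measurable_funM.
- by move=> x Ux; rewrite normrM; apply: ler_pM => //; exact: hB.
- by move=> x _ rx; rewrite P0 ?mul0r// => /Srho; rewrite leNgt rx.
Qed.

Lemma tameM_cvg P (h_ : nat -> 'rV[R]_n -> R) h B : tame P ->
  (forall j, measurable_fun U (h_ j)) -> (forall j x, U x -> `|h_ j x| <= B) ->
  (forall x, U x -> h_ j x @[j --> \oo] --> h x) ->
  mu.-integrable U (EFin \o (fun x => P x * h x)) /\
  (\int[mu]_(x in U) (P x * h_ j x))%R @[j --> \oo]
    --> (\int[mu]_(x in U) (P x * h x))%R.
Proof.
move=> [mP [C C0 PC] P0] mh hB hc.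
have [rho [_ [_ _ _ _ Srho]]] := test_function_bounds tu.
apply: (@bounded_support_cvg _ _ _ mU _ _ rho (C * B)).
- by move=> j; exact: measurable_funM.
- apply: measurable_funM => //; apply: (measurable_fun_cvg mh).
  by move=> x Ux; exact: hc.
- by move=> j x Ux; rewrite normrM; apply: ler_pM => //; exact: hB.
- by move=> j x _ rx; rewrite P0 ?mul0r// => /Srho; rewrite leNgt rx.
- exists set0; first by split => //; exact: measure0.
  by move=> x Ux _; apply: cvgM; [exact: cvg_cst|exact: hc].
Qed.

Lemma tame_integral_domain P h : tame P ->
  mu.-integrable U (EFin \o (fun x => P x * h x)) ->
  (\int[mu]_(x in Omega) (P x * h x)%:E = (\int[mu]_(x in U) (P x * h x))%R%:E)%E.
Proof.
move=> [_ _ P0] iP; have [_ _ SU] := tu.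
rewrite /Rintegral fineK; last exact: integrable_fin_num.
rewrite [LHS]integral_mkcond [RHS]integral_mkcond; congr (integral _ _ _).
apply/funext => x; rewrite /patch.
have [Ox|Ox] := pselect (Omega x); last first.
  by rewrite !memNset// => -[].
rewrite (mem_set Ox); have [Kx|Kx] := pselect (K x); last by rewrite mem_set.
rewrite memNset; last by case.
by rewrite P0 ?mul0r// => /SU[].
Qed.

Lemma dist_powR_bounded (r : R) : exists2 C, 0 <= C &
  forall x, supp u x -> d x `^ r <= C.
Proof.
have [_ cS SU] := tu.
have [S0|/set0P S0] := eqVneq (supp u) set0; first by exists 0 => // x; rewrite S0.
have cd : {within supp u, continuous d}.
  by apply: continuous_subspaceT; exact: continuous_dist_to.
have [y yS hy] := EVT_min_rV S0 cS cd; have [z zS hz] := EVT_max_rV S0 cS cd.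
have dy0 : 0 < d y.
  by apply: dist_to_gt0 => //; move: yS; rewrite inE => /SU[].
have cp q : d y <= q <= d z -> {for q, continuous (fun q : R => q `^ r)}.
  move=> /andP[yq _]; apply: differentiable_continuous; apply/derivable1_diffP.
  by have [] := is_derive1_powR r (lt_le_trans dy0 yq).
have [C C0 hC] := continuous_itv_bounded cp.
exists C => // x xS; rewrite (le_trans (ler_norm _))// hC//.
by rewrite hy ?hz ?inE.
Qed.

Let measurable_dist_powR r : measurable_fun U (fun x => d x `^ r).
Proof.
apply: (measurableT_comp (measurable_powR _)).
apply: (measurable_funS measurableT (@subsetT _ _)).
by apply: continuous_measurable_rV; exact: continuous_dist_to.
Qed.

Let tame_dist_powR r P (C : R) : measurable_fun U P -> 0 <= C ->
  (forall x, `|P x| <= C) -> (forall x, ~ supp u x -> P x = 0) ->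
  tame (fun x => d x `^ r * P x).
Proof.
move=> mP C0 PC P0; have [B B0 hB] := dist_powR_bounded r; split.
- exact: measurable_funM.
- exists (B * C); first exact: mulr_ge0.
  move=> x; have [xS|xS] := pselect (supp u x).
    by rewrite normrM; apply: ler_pM => //; rewrite ger0_norm ?powR_ge0// hB.
  by rewrite P0// mulr0 normr0 mulr_ge0.
- by move=> x xS; rewrite P0// mulr0.
Qed.

Lemma tame_power r p : 0 < p -> tame (fun x => d x `^ r * `|u x| `^ p).
Proof.
move=> p0; have [_ [C [_ C0 uC _ _]]] := test_function_bounds tu.
have [su _ _] := tu.
apply: (@tame_dist_powR _ _ (C `^ p)); first last.
- by move=> x xS; rewrite (supp_notin xS) normr0 powR0// gt_eqF.
- move=> x; rewrite ger0_norm ?powR_ge0//.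
  by apply: ge0_ler_powR; rewrite ?nnegrE// ltW.
- exact: powR_ge0.
apply: (measurableT_comp (measurable_powR _)); apply: measurableT_comp => //.
exact: measurable_smooth.
Qed.

Lemma tame_grad_power r p : 0 < p -> tame (fun x => d x `^ r * enorm (grad u x) `^ p).
Proof.
move=> p0; have [_ [C [_ C0 _ duC _]]] := test_function_bounds tu.
have [su _ _] := tu.
apply: (@tame_dist_powR _ _ ((n%:R * C) `^ p)); first last.
- move=> x xS; rewrite (_ : grad u x = 0); last first.
    by apply/rowP => i; rewrite !mxE pderiv_supp_notin.
  by rewrite -(scale0r 0) /enorm dotpZl mul0r sqrtr0 powR0// gt_eqF.
- move=> x; rewrite ger0_norm ?powR_ge0//.
  apply: ge0_ler_powR; rewrite ?nnegrE ?enorm_ge0 ?mulr_ge0 ?(ltW p0)//.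
  apply: (le_trans (enorm_le_norm _)); rewrite ler_wpM2l//.
  by apply: rV_norm_le => // i; rewrite mxE.
- exact: powR_ge0.
apply: (measurableT_comp (measurable_powR _)).
apply: (eq_measurable_fun
    (fun x => (\sum_(i < n) pderiv i u x * pderiv i u x) `^ 2^-1)).
  move=> x _; rewrite powR12_sqrt; last first.
    by apply: sumr_ge0 => i _; rewrite -expr2 sqr_ge0.
  by rewrite /enorm /dotp; congr Num.sqrt; apply: eq_bigr => i _; rewrite !mxE.
apply: (measurableT_comp (measurable_powR _)).
by apply: measurable_sum => i; apply: measurable_funM; exact: measurable_pderiv.
Qed.

End tame_functions.

(** * The improved Hardy inequality *)

Lemma Rintegral_ge0_ae d (T : measurableType d) (R : realType)
    (mu : {measure set T -> \bar R}) (D N : set T) (f : T -> R) :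
  measurable D -> measurable_fun D f -> measurable N -> mu N = 0%E ->
  (forall x, D x -> ~ N x -> 0 <= f x) -> 0 <= (\int[mu]_(x in D) f x)%R.
Proof.
move=> mD mf mN N0 f0.
have mI : measurable_fun D (\1_(~` N) : T -> R).
  by apply: measurable_indic; exact: measurableC.
have -> : (\int[mu]_(x in D) f x)%R = (\int[mu]_(x in D) (f x * \1_(~` N) x))%R.
  congr fine; apply: ae_eq_integral => //.
  - exact/measurable_EFinP.
  - by apply/measurable_EFinP; exact: measurable_funM.
  exists N; split => // x /= /not_implyP[Dx fx]; apply: contrapT => Nx; apply: fx.
  by rewrite indicE in_setC memNset//= mulr1.
apply: Rintegral_ge0 => x Dx; rewrite indicE in_setC.
by have [Nx|Nx] := pselect (N x); [rewrite mem_set//= mulr0|rewrite memNset//= mulr1 f0].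
Qed.

Section hardy.
Context (R : realType) (n : nat) (Omega K : set 'rV[R]_n).
Hypothesis (oO : open Omega) (K0 : K !=set0) (cK : closed K).
Local Notation d := (dist_to K).
Local Notation U := (Omega `\` K).
Local Notation mu := (lebesgue_rV R n).
Implicit Types (x : 'rV[R]_n) (m : option nat).

Let mU : measurable U.
Proof.
by apply: open_measurable_rV; rewrite setDE; apply: openI => //; exact: closed_openC.
Qed.

Variables (delta t0 D : R).
Hypothesis (delta0 : 0 < delta) (t00 : 0 < t0) (D0 : 0 < D).
Hypothesis (t0delta : t0 <= expR (- (4 / delta))) (t01 : t0 <= expR (- 1)).
Hypothesis hD : forall x, Omega x -> d x < t0 * D.

Local Notation eta m x := (eta_log m (d x / D)).
Local Notation zeta m x := (zeta_log m (d x / D)).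

Lemma radius_small x : U x -> 0 < d x / D /\ d x / D < t0.
Proof.
move=> [Ox Kx]; split; first by rewrite divr_gt0//; exact: dist_to_gt0.
by rewrite ltr_pdivrMr// hD.
Qed.

Lemma radius_lt1 x : U x -> 0 < d x / D < 1.
Proof.
move=> /radius_small[-> h]; apply: (lt_trans h); apply: (le_lt_trans t01).
by rewrite expR_lt1 oppr_lt0.
Qed.

Lemma log_sums_radius m x : U x ->
  [/\ 0 <= eta m x <= delta, 0 <= zeta m x <= eta m x ^+ 2 &
      eta m x ^+ 2 <= 64 * zeta m x].
Proof.
move=> /radius_small[r0 rt]; apply: log_sums_bounds => //.
  by rewrite r0 (le_trans (ltW rt)).
by rewrite (le_trans (ltW rt)).
Qed.

Let measurable_radius (f : R -> R) : (forall t, 0 < t < 1 -> {for t, continuous f}) ->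
  measurable_fun U (fun x => f (d x / D)).
Proof.
move=> cf.
apply: (measurable_comp (F := `]0, 1[%classic : set R)) => //.
- by move=> _ [x Ux <-]; rewrite /= in_itv/= radius_lt1.
- apply: open_continuous_measurable_fun; first exact: interval_open.
  by move=> q; rewrite inE/= in_itv/=; exact: cf.
- apply: measurable_funM; last exact: measurable_cst.
  apply: (measurable_funS measurableT (@subsetT _ _)).
  by apply: continuous_measurable_rV; exact: continuous_dist_to.
Qed.

Lemma measurable_eta_log m : measurable_fun U (fun x => eta m x).
Proof.
apply: (@measurable_fun_cvg _ _ _ _ (fun j x => eta_fin (trunc m j) (d x / D))).
  by move=> j; apply: measurable_radius => t; exact: continuous_eta_fin.
by move=> x Ux; apply: cvg_eta_log; exact: radius_lt1.
Qed.

Lemma measurable_zeta_log m : measurable_fun U (fun x => zeta m x).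
Proof.
apply: (@measurable_fun_cvg _ _ _ _ (fun j x => zeta_fin (trunc m j) (d x / D))).
  by move=> j; apply: measurable_radius => t; exact: continuous_zeta_fin.
by move=> x Ux; apply: cvg_zeta_log; exact: radius_lt1.
Qed.

(** Every integrand of the inequality is a power of $d$ times such a
   combination of logarithms. *)
Definition log_comb (c0 c1 c2 c3 : R) m x : R :=
  c0 + c1 * eta m x + c2 * eta m x ^+ 2 + c3 * zeta m x.

Lemma measurable_log_comb c0 c1 c2 c3 m : measurable_fun U (log_comb c0 c1 c2 c3 m).
Proof.
have me := measurable_eta_log m; have mz := measurable_zeta_log m.
have me2 : measurable_fun U (fun x => eta m x ^+ 2).
  apply: (eq_measurable_fun (fun x => eta m x * eta m x)).
    by move=> x _; rewrite expr2.
  exact: measurable_funM.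
apply: measurable_funD; last by apply: measurable_funM => //; exact: measurable_cst.
apply: measurable_funD; last by apply: measurable_funM => //; exact: measurable_cst.
apply: measurable_funD; first exact: measurable_cst.
by apply: measurable_funM => //; exact: measurable_cst.
Qed.

Lemma log_comb_bounded c0 c1 c2 c3 m x : U x -> `|log_comb c0 c1 c2 c3 m x| <=
  `|c0| + `|c1| * delta + `|c2| * delta ^+ 2 + `|c3| * delta ^+ 2.
Proof.
move=> Ux; have [/andP[e0 e1] /andP[z0 z1] _] := log_sums_radius m Ux.
have e2 : eta m x ^+ 2 <= delta ^+ 2 by rewrite lerXn2r// nnegrE ltW.
apply: (le_trans (ler_normD _ _)); apply: lerD.
  apply: (le_trans (ler_normD _ _)); apply: lerD.
    apply: (le_trans (ler_normD _ _)); rewrite lerD2l normrM.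
    by rewrite ler_wpM2l// ger0_norm.
  by rewrite normrM ler_wpM2l// ger0_norm// sqr_ge0.
by rewrite normrM ler_wpM2l// ger0_norm// (le_trans z1).
Qed.

Lemma cvg_log_comb c0 c1 c2 c3 m x : U x ->
  log_comb c0 c1 c2 c3 (Some (trunc m j)) x @[j --> \oo] --> log_comb c0 c1 c2 c3 m x.
Proof.
move=> /radius_lt1 r1; have ce := @cvg_eta_log R m _ r1; have cz := @cvg_zeta_log R m _ r1.
have ce2 : eta_fin (trunc m j) (d x / D) ^+ 2 @[j --> \oo] --> eta m x ^+ 2.
  by rewrite expr2; under eq_fun do rewrite expr2; exact: cvgM.
apply: cvgD; last by apply: cvgM => //; exact: cvg_cst.
apply: cvgD; last by apply: cvgM => //; exact: cvg_cst.
by apply: cvgD; [exact: cvg_cst|apply: cvgM => //; exact: cvg_cst].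
Qed.

Variables (k : nat) (p s alpha beta gamma : R).
Hypothesis p1 : 1 < p.
Let H := (k%:R + s - p) / p.
Hypothesis H0 : H != 0.
Hypothesis superharm : distr_ge0 (k%:R + s - p) k d U.

Variables a b : R.
Hypothesis log_ineq : forall e z x : R, 0 <= e <= delta -> 0 <= z <= e ^+ 2 ->
  e ^+ 2 <= 64 * z -> 0 <= x <= e * z ->
    let w := 1 + alpha * e + beta * e ^+ 2 + gamma * z in
    let f := w + a * e + b * e ^+ 2 in
    let df := (alpha + a) * (e ^+ 2 + z) / 2 + (beta + b) * e * (e ^+ 2 + z)
      + 2 * gamma * x in
    [/\ 0 < w, 0 < f &
      w + alpha / (2 * H) * (e ^+ 2 + z) + (p - 1) / (2 * p * H ^+ 2) * z <=
      p * f + df / H - (p - 1) * w * (f / w) `^ (p / (p - 1))].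

Variable u : 'rV[R]_n -> R.
Hypothesis tu : test_function U u.

Let p0 : 0 < p. Proof. exact: lt_trans p1. Qed.

Local Notation Pu := (fun x => d x `^ (s - p) * `|u x| `^ p).
Local Notation Pg := (fun x => d x `^ s * enorm (grad u x) `^ p).
Local Notation A0 := (`|H| `^ p).
Local Notation A1 := (`|H| `^ p * alpha).
Local Notation A2 := (`|H| `^ p * beta + `|H| `^ (p - 2) * H * alpha / 2).
Local Notation A3 := ((p - 1) / (2 * p) * `|H| `^ (p - 2)
  + `|H| `^ (p - 2) * H * alpha / 2 + `|H| `^ p * gamma).

Let tPu : tame Omega K u Pu. Proof. exact: tame_power. Qed.
Let tPg : tame Omega K u Pg. Proof. exact: tame_grad_power. Qed.

Let sqr_powR_half (y r : R) : 0 <= y -> (y ^+ 2) `^ (r / 2) = y `^ r.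
Proof. by move=> y0; rewrite powR_sqr_half ger0_norm. Qed.

(** The inequality of integrands holds up to a multiple of the tested
   quantity, whose integral has the favourable sign: the factor
   $k + s - p = pH$ of the hypothesis is a positive multiple of the factor
   $|H|^{p-2} H$ used here. *)
Lemma hardy_finite (m : nat) :
  (\int[mu]_(x in U) (Pu x * log_comb A0 A1 A2 A3 (Some m) x))%R <=
  (\int[mu]_(x in U) (Pg x * log_comb 1 alpha beta gamma (Some m) x))%R.
Proof.
pose T := (t0 * D) ^+ 2.
pose g := testfun m alpha beta gamma a b D ((s - p) / 2).
pose dg := testfun_slope m alpha beta gamma a b D ((s - p) / 2).
have dT x : Omega x -> d x ^+ 2 < T.
  by move=> Ox; rewrite ltrXn2r// ?nnegrE ?dist_to_ge0 ?mulr_ge0 ?hD ?ltW.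
have rT q : 0 < q < T -> 0 < q `^ 2^-1 / D /\ q `^ 2^-1 / D < t0.
  move=> /andP[q0 qT]; split; first by rewrite divr_gt0// powR_gt0.
  rewrite ltr_pdivrMr// powR12_sqrt ?(ltW q0)//.
  have -> : t0 * D = Num.sqrt T by rewrite sqrtr_sqr gtr0_norm// mulr_gt0.
  by rewrite ltr_sqrt// (lt_trans q0).
have t0lt1 : t0 < 1.
  by apply: (le_lt_trans t01); rewrite expR_lt1 oppr_lt0.
have prof_gt0 t : 0 < t < t0 -> 0 < profile m alpha beta gamma a b t.
  move=> /andP[tp tt0].
  have [e0 h1 h2] : [/\ 0 <= eta_fin m t <= delta, 0 <= zeta_fin m t <= eta_fin m t ^+ 2
      & eta_fin m t ^+ 2 <= 64 * zeta_fin m t].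
    apply: (log_sums_bounds (Some m)) => //.
      by rewrite tp (le_trans (ltW tt0)).
    by rewrite (le_trans (ltW tt0)).
  have tt : 0 < t < 1 by rewrite tp (lt_trans tt0).
  by have [] := log_ineq e0 h1 h2 (xi_fin_itv m tt).
have [iL cL] : mu.-integrable U (EFin \o power_integrand K0 cK k g dg p u) /\
    (k%:R + s - p) * (\int[mu]_(x in U) power_integrand K0 cK k g dg p u x)%R <= 0.
  apply: (@weak_inequality_power _ _ _ _ oO K0 cK _ _ superharm T g dg) => //.
  - move=> q qT; have [r0 rt] := rT q qT; have /andP[q0 _] := qT.
    by apply: is_derive_testfun => //; exact: lt_trans t0lt1.
  - move=> q qT; have [r0 rt] := rT q qT; have /andP[q0 _] := qT.
    by apply: continuous_testfun_slope => //; exact: lt_trans t0lt1.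
  - move=> q qT; have [r0 rt] := rT q qT.
    by rewrite mulr_ge0 ?powR_ge0// ltW// prof_gt0// r0.
  - move=> A f oA fT sf; apply: smooth_on_testfun => // x Ax.
    have [r0 rt] := rT _ (fT x Ax); have /andP[f0 _] := fT x Ax; split => //.
    exact: lt_trans t0lt1.
set L := power_integrand K0 cK k g dg p u in iL cL.
pose c := `|H| `^ (p - 2) * H.
have cL0 : c * (\int[mu]_(x in U) L x)%R <= 0.
  have cE : k%:R + s - p = p * H by rewrite /H mulrC divfK// gt_eqF.
  move: cL; rewrite cE -mulrA pmulr_rle0// => cL.
  by rewrite /c -mulrA mulr_ge0_le0// powR_ge0.
have iu := tameM_integrable oO cK tu tPu (measurable_log_comb A0 A1 A2 A3 (Some m))
  (@log_comb_bounded A0 A1 A2 A3 (Some m)).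
have ig := tameM_integrable oO cK tu tPg
  (measurable_log_comb 1 alpha beta gamma (Some m))
  (@log_comb_bounded 1 alpha beta gamma (Some m)).
have icL : mu.-integrable U (EFin \o (fun x => c * L x)).
  exact: (@integrableZl _ _ _ mu U mU c _ iL).
have isum : mu.-integrable U (EFin \o (fun x =>
    Pg x * log_comb 1 alpha beta gamma (Some m) x + c * L x)).
  exact: (@integrableD _ _ _ mu U mU _ _ ig icL).
have : 0 <= (\int[mu]_(x in U) (Pg x * log_comb 1 alpha beta gamma (Some m) x
    + c * L x - Pu x * log_comb A0 A1 A2 A3 (Some m) x))%R.
  apply: (Rintegral_ge0_ae mU _ (measurable_ridges K0 cK) (ridges_null K0 cK)).
    apply: measurable_funB.
      by have /integrableP[/measurable_EFinP] := isum.
    by have /integrableP[/measurable_EFinP] := iu.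
  move=> x Ux xr; rewrite subr_ge0.
  have [Ox Kx] := Ux; have dx0 := dist_to_gt0 K0 cK Kx.
  have [e0 h1 h2] := log_sums_radius (Some m) Ux.
  have := log_ineq e0 h1 h2 (xi_fin_itv m (radius_lt1 Ux)).
  cbv zeta; move=> [w0 f0 main].
  have Nle : `|dotp (dist_field K0 cK x) (grad u x)| <= d x * enorm (grad u x).
    by rewrite -(enorm_dist_field K0 cK xr); exact: cauchy_schwarz.
  have := hardy_pointwise s (u x) p1 H0 dx0 w0 f0 (enorm_ge0 _) Nle main.
  have [HpE _] := normr_powR_split p H0.
  have rE : (d x ^+ 2) `^ 2^-1 / D = d x / D.
    by rewrite -[2^-1]mul1r sqr_powR_half ?powRr1// ltW.
  have gE : g (d x ^+ 2) = d x `^ (s - p) * profile m alpha beta gamma a b (d x / D).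
    by rewrite /g /testfun rE sqr_powR_half// ltW.
  have dgE : 2 * d x ^+ 2 * dg (d x ^+ 2) = d x `^ (s - p) *
      ((s - p) * profile m alpha beta gamma a b (d x / D)
       + profile_slope m alpha beta gamma a b (d x / D)).
    rewrite /dg /testfun_slope rE sqr_powR_half; last exact: ltW.
    by field; rewrite gt_eqF.
  have pH : p * H = k%:R + s - p by rewrite /H mulrC divfK// gt_eqF.
  move=> h; apply: le_trans (le_trans h _); rewrite le_eqVlt; apply/orP; left; apply/eqP.
    rewrite HpE /log_comb; move: (d x `^ (s - p)) (`|u x| `^ p) (`|H| `^ (p - 2)).
    move=> A B h2'; field; rewrite H0 gt_eqF//.
  rewrite /L /power_integrand dgE gE pH /c /profile /weight /profile_slope /log_comb.
  by rewrite /=; ring.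
rewrite RintegralB// RintegralD// RintegralZl//.
by move: cL0; set I1 := Rintegral _ _ _; set I2 := Rintegral _ _ _;
  set I3 := Rintegral _ _ _; lra.
Qed.

(** The number of logarithms can tend to infinity with $D$ fixed, since
   [delta], [t0], [a] and [b] do not depend on it. *)
Lemma hardy_log m :
  (\int[mu]_(x in U) (Pu x * log_comb A0 A1 A2 A3 m x))%R <=
  (\int[mu]_(x in U) (Pg x * log_comb 1 alpha beta gamma m x))%R.
Proof.
have [_ cu] := tameM_cvg oO cK tu tPu
  (fun j => measurable_log_comb A0 A1 A2 A3 (Some (trunc m j)))
  (fun j => @log_comb_bounded A0 A1 A2 A3 (Some (trunc m j)))
  (@cvg_log_comb A0 A1 A2 A3 m).
have [_ cg] := tameM_cvg oO cK tu tPg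
  (fun j => measurable_log_comb 1 alpha beta gamma (Some (trunc m j)))
  (fun j => @log_comb_bounded 1 alpha beta gamma (Some (trunc m j)))
  (@cvg_log_comb 1 alpha beta gamma m).
by apply: (ler_cvg_to cu cg); apply: nearW => j; exact: hardy_finite.
Qed.

Lemma hardy_ereal m :
  (A0%:E * \int[mu]_(x in Omega) (d x `^ (s - p) * `|u x| `^ p)%:E
   + A1%:E * \int[mu]_(x in Omega) (d x `^ (s - p) * eta m x * `|u x| `^ p)%:E
   + A2%:E * \int[mu]_(x in Omega) (d x `^ (s - p) * eta m x ^+ 2 * `|u x| `^ p)%:E
   + A3%:E * \int[mu]_(x in Omega) (d x `^ (s - p) * zeta m x * `|u x| `^ p)%:E
   <= \int[mu]_(x in Omega) (d x `^ s * weight alpha beta gamma m (d x / D)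
        * enorm (grad u x) `^ p)%:E)%E.
Proof.
have iu c0 c1 c2 c3 := tameM_integrable oO cK tu tPu
  (measurable_log_comb c0 c1 c2 c3 m) (@log_comb_bounded c0 c1 c2 c3 m).
have ig := tameM_integrable oO cK tu tPg
  (measurable_log_comb 1 alpha beta gamma m) (@log_comb_bounded 1 alpha beta gamma m).
pose J c0 c1 c2 c3 := (\int[mu]_(x in U) (Pu x * log_comb c0 c1 c2 c3 m x))%R.
have JE c0 c1 c2 c3 (f : 'rV[R]_n -> R) : (forall x, f x = Pu x * log_comb c0 c1 c2 c3 m x) ->
    (\int[mu]_(x in Omega) (f x)%:E = (J c0 c1 c2 c3)%:E)%E.
  move=> fE; rewrite -(tame_integral_domain oO cK tu tPu (iu c0 c1 c2 c3)).
  by apply: eq_integral => x _; rewrite fE.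
rewrite (JE 1 0 0 0); last by move=> x; rewrite /log_comb/=; ring.
rewrite (JE 0 1 0 0); last by move=> x; rewrite /log_comb/=; ring.
rewrite (JE 0 0 1 0); last by move=> x; rewrite /log_comb/=; ring.
rewrite (JE 0 0 0 1); last by move=> x; rewrite /log_comb/=; ring.
have -> : (\int[mu]_(x in Omega) (d x `^ s * weight alpha beta gamma m (d x / D)
    * enorm (grad u x) `^ p)%:E =
    (\int[mu]_(x in U) (Pg x * log_comb 1 alpha beta gamma m x))%R%:E)%E.
  rewrite -(tame_integral_domain oO cK tu tPg ig); apply: eq_integral => x _.
  by rewrite /log_comb /weight mulrAC.
rewrite -!EFinM -!EFinD lee_fin.
apply: le_trans (hardy_log m); rewrite le_eqVlt; apply/orP; left; apply/eqP.
have lin (c0 c1 c2 c3 e0 e1 e2 e3 r : R) :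
    J c0 c1 c2 c3 + r * J e0 e1 e2 e3 =
    J (c0 + r * e0) (c1 + r * e1) (c2 + r * e2) (c3 + r * e3).
  rewrite /J -RintegralZl// -RintegralD//; last first.
    exact: (@integrableZl _ _ _ mu U mU r _ (iu _ _ _ _)).
  by apply: eq_Rintegral => x _; rewrite /log_comb/=; ring.
have -> : A0 * J 1 0 0 0 = J 0 0 0 0 + A0 * J 1 0 0 0.
  rewrite [X in _ = X + _](_ : _ = 0) ?add0r//.
  rewrite /J (@eq_Rintegral _ _ _ mu U (cst 0)) ?Rintegral_cst ?mul0r//.
  by move=> x _; rewrite /log_comb/=; ring.
rewrite !lin; congr (Rintegral _ _ _); apply/funext => x.
by rewrite /log_comb/=; ring.
Qed.

End hardy.

Theorem theorem1 (R : realType) (p s : R) (m : option nat) (N k : nat)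
    (Omega K : set 'rV[R]_N) (alpha beta gamma : R) :
  1 < p ->
  (if m is Some m' then (1 <= m')%N else true) ->
  (2 <= N)%N ->
  (1 <= k <= N)%N ->
  domain Omega ->
  piecewise_smooth_surface k K ->
  finite_set (components K) ->
  (k = N -> finite_set K) ->
  (k = 1%N -> K = boundary Omega) ->
  p != k%:R + s ->
  has_ubound [set dist_to K x | x in Omega] ->
  distr_ge0 (k%:R + s - p) k (dist_to K) (Omega `\` K) ->
  let d := dist_to K in
  let H := (k%:R + s - p) / p in
  let mu := lebesgue_rV R N in
  exists D0 : R,
    [/\ 0 < D0,
        sup [set d x | x in Omega] <= D0,
        (forall D, D0 <= D -> forall x, Omega x ->
           0 < weight alpha beta gamma m (d x / D)) &
        forall D, D0 <= D -> forall u, test_function (Omega `\` K) u ->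
          let etaD x := eta_log m (d x / D) in
          let zetaD x := zeta_log m (d x / D) in
          ((`|H| `^ p)%:E * \int[mu]_(x in Omega)
              (d x `^ (s - p) * `|u x| `^ p)%:E
           + (`|H| `^ p * alpha)%:E * \int[mu]_(x in Omega)
              (d x `^ (s - p) * etaD x * `|u x| `^ p)%:E
           + (`|H| `^ p * beta + `|H| `^ (p - 2) * H * alpha / 2)%:E *
             \int[mu]_(x in Omega)
              (d x `^ (s - p) * etaD x ^+ 2 * `|u x| `^ p)%:E
           + ((p - 1) / (2 * p) * `|H| `^ (p - 2)
              + `|H| `^ (p - 2) * H * alpha / 2 + `|H| `^ p * gamma)%:E *
             \int[mu]_(x in Omega)
              (d x `^ (s - p) * zetaD x * `|u x| `^ p)%:E
           <= \int[mu]_(x in Omega)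
              (d x `^ s * weight alpha beta gamma m (d x / D)
               * enorm (grad u x) `^ p)%:E)%E].
Proof.
move=> p1 _ _ _ [_ oO _] [K0 cK _] _ _ _ pks bd superharm d H mu.
have p0 : 0 < p by exact: lt_trans p1.
have H0 : H != 0.
  rewrite mulf_neq0 ?invr_eq0 ?(gt_eqF p0)//.
  by rewrite subr_eq0 eq_sym.
have [a [b [delta [delta0 log_ineq]]]] := log_weight_inequality alpha beta gamma p1 H0.
(* for d/D at most t0, eta is at most delta and eta^2 at most 64 zeta *)
pose t0 := Num.min (expR (- (4 / delta))) (expR (- 1)).
have t00 : 0 < t0 by rewrite lt_min !expR_gt0.
have t0delta : t0 <= expR (- (4 / delta)) by rewrite ge_min lexx.
have t01 : t0 <= expR (- 1) by rewrite ge_min lexx orbT.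
have t0le1 : t0 <= 1 by apply: (le_trans t01); rewrite expR_le1 oppr_le0.
pose M := sup [set d x | x in Omega].
exists ((2 * `|M| + 1) / t0).
have M0 : 0 < 2 * `|M| + 1 by rewrite ltr_wpDl// mulr_ge0.
have small D : (2 * `|M| + 1) / t0 <= D -> 0 < D /\ forall x, Omega x -> d x < t0 * D.
  move=> hD; split; first by apply: lt_le_trans hD; rewrite divr_gt0.
  move=> x Ox; apply: (@lt_le_trans _ _ (2 * `|M| + 1)).
    have : d x <= M by apply: ub_le_sup => //; exists x.
    by have := ler_norm M; have := normr_ge0 M; lra.
  by rewrite [t0 * D]mulrC -ler_pdivrMr.
split.
- by rewrite divr_gt0.
- rewrite -/M ler_pdivlMr//; apply: (@le_trans _ _ (`|M| * 1)).
    by apply: (le_trans (ler_wpM2r (ltW t00) (ler_norm M))); rewrite ler_wpM2l.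
  by rewrite mulr1; have := normr_ge0 M; lra.
- move=> D /small[D0 hD] x Ox; have [Kx|Kx] := pselect (K x).
    rewrite /d (dist_to_mem K0 cK Kx) mul0r /weight eta_log0 zeta_log0.
    by rewrite expr0n/= !mulr0 !addr0.
  have Ux : (Omega `\` K) x by [].
  have [e0 z0 ez] := log_sums_radius K0 cK delta0 D0 t0delta t01 hD m Ux.
  have xi0 : 0 <= (0 : R) <= eta_log m (d x / D) * zeta_log m (d x / D).
    by rewrite lexx mulr_ge0//; [case/andP: e0|case/andP: z0].
  by have [] := log_ineq _ _ _ e0 z0 ez xi0.
- move=> D /small[D0 hD] u tu.
  exact: (hardy_ereal oO K0 cK delta0 t00 D0 t0delta t01 hD p1 H0 superharm log_ineq tu).
Qed.
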